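(* Suppose that $\mathcal{S}$ is not a single graph. Then there exist $K,N\in\mathbb{Z}_{>0}$ and $c\in(0,1)$ such that the following holds. For any $x\in[0,1]$ and any $\mathbf{u}\in\mathcal{A}^*$ with $|\mathbf{u}|\ge N$, there exist $k\in\{1,\ldots,K\}$ and $\mathbf{a},\mathbf{b}\in\mathcal{A}^N$ such that $$\left|(\Delta_{\mathbf{u}\mathbf{a}\mathbf{c},\mathbf{u}\mathbf{b}\mathbf{d}})^{(k)}(x)\right|\ge c\,(r_{\min}\kappa_{\min})^{|\mathbf{u}|}\qquad\text{for all }\mathbf{c},\mathbf{d}\in\mathcal{A}^*.$$
   Context: Setting. $\mathbb{S}^1=\mathbb{R}/\mathbb{Z}$ with fundamental domain $[0,1)$, $U=[-1,1]$. $f:\mathbb{S}^1\to\mathbb{S}^1$ is a real analytic expanding map ($|f'|>1$ everywhere), orientation preserving, with $f(0)=0$, of degree $b\ge 2$. $g$ is real analytic on $\mathbb{S}^1\times U$ (on a neighbourhood of it), $0<|\partial_y g|<1$ on $\mathbb{S}^1\times U$, and $T(x,y)=(f(x),g(x,y))$ maps $\mathbb{S}^1\times U$ into itself. $g$ is also regarded as a function on $\mathbb{R}\times U$, $1$-periodic in $x$. Words. $\mathcal{A}=\{0,\ldots,b-1\}$, $\mathcal{A}^*=\bigcup_{n\ge0}\mathcal{A}^n$ (finite words, including the empty word); juxtaposition of words is concatenation. $|\mathbf{u}|$ is the length of $\mathbf{u}$ and $\mathbf{u}|_k=u_1\cdots u_k$. Let $\widetilde f:\mathbb{R}\to\mathbb{R}$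 be the lift of $f$ with $\widetilde f(0)=0$ and $f_i(x)=\widetilde f^{-1}(x+i)$, $i\in\mathcal{A}$. For $\mathbf{u}=u_1\cdots u_n$, $\mathbf{u}[x]:=f_{u_n}\circ\cdots\circ f_{u_1}(x)$. Curves. For $\mathbf{u}\in\mathcal{A}^n$, $\theta_{\mathbf{u}}(x,y):=g((\mathbf{u}|_1)[x],g((\mathbf{u}|_2)[x],\ldots,g((\mathbf{u}|_n)[x],y)\ldots))$, and $\theta_{\mathbf{u}}(x):=\theta_{\mathbf{u}}(x,0)$. $\Delta_{\mathbf{a},\mathbf{b}}(x):=\theta_{\mathbf{a}}(x)-\theta_{\mathbf{b}}(x)$; superscript $(k)$ is the $k$-th derivative in $x$. Constants. $r_{\min}:=\min_{\mathbb{S}^1\times U}|\partial_y g|>0$ and $\kappa_{\min}:=\min_{i\in\mathcal{A},\,x\in[0,1]}|f_i'(x)|>0$. Attractor. $\mathcal{S}:=\bigcap_{n\ge0}T^n(\mathbb{S}^1\times U)$; it is a single graph if $\mathcal{S}=\{(x,\theta(x)):x\in\mathbb{S}^1\}$ for some analytic $\theta:\mathbb{S}^1\to U$. *)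

(* Defs.v *)
(* Stdlib reals and Coquelicot. *)
From Stdlib Require Import Reals Lra Lia List ClassicalEpsilon.
From Coquelicot Require Import Coquelicot.
Open Scope R_scope.

(* R/Z, each class being represented by its element in the fundamental domain
   [0,1).  A function h on the circle is studied through [fun x => h (proj x)],
   the associated 1-periodic function on R. *)
Record circle : Type := mk_circle
  { circle_rep : R; circle_rep_bound : 0 <= circle_rep < 1 }.

Lemma frac_part_bound (x : R) : 0 <= frac_part x < 1.
Proof. destruct (base_fp x); lra. Qed.

Definition proj (x : R) : circle := mk_circle (frac_part x) (frac_part_bound x).

Definition in_U (y : R) : Prop := -1 <= y <= 1.

Definition analytic_at (h : R -> R) (x0 : R) : Prop :=
  exists (a : nat -> R) (r : posreal),
    forall x, Rabs (x - x0) < r -> is_pseries a (x - x0) (h x).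

(* Near (x0,y0), h is the sum of an absolutely convergent double power series. *)
Definition analytic2_at (h : R -> R -> R) (x0 y0 : R) : Prop :=
  exists (a : nat -> nat -> R) (r : posreal),
    forall x y, Rabs (x - x0) < r -> Rabs (y - y0) < r ->
      let t m n := a m n * (x - x0) ^ m * (y - y0) ^ n in
      (forall m, ex_series (fun n => Rabs (t m n))) /\
      ex_series (fun m => Series (fun n => Rabs (t m n))) /\
      is_series (fun m => Series (t m)) (h x y).

(* The derivative and the real analyticity of f are those of its lifts. *)
Definition is_lift (f : circle -> circle) (F : R -> R) : Prop :=
  (forall x, continuous F x) /\ (forall x, proj (F x) = f (proj x)).

Definition has_degree (F : R -> R) (b : nat) : Prop :=
  forall x, F (x + 1) = F x + INR b.

Definition skew (f : circle -> circle) (g : circle -> R -> R)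
  (p : circle * R) : circle * R := (f (fst p), g (fst p) (snd p)).

Definition attractor (f : circle -> circle) (g : circle -> R -> R)
  (p : circle * R) : Prop :=
  forall n : nat, exists q : circle * R,
    in_U (snd q) /\ Nat.iter n (skew f g) q = p.

Definition single_graph (S : circle * R -> Prop) : Prop :=
  exists theta : circle -> R,
    (forall x, in_U (theta x)) /\
    (forall x, analytic_at (fun t => theta (proj t)) x) /\
    (forall p, S p <-> snd p = theta (fst p)).

(* Finite words are lists; the letter u_1 is the head. *)
Definition is_word (b : nat) (u : list nat) : Prop :=
  List.Forall (fun i => (i < b)%nat) u.

Definition inverse (F : R -> R) (x : R) : R :=
  epsilon (inhabits 0) (fun t => F t = x).

Definition branch (F : R -> R) (i : nat) (x : R) : R := inverse F (x + INR i).

(* u[x] = f_{u_n} o ... o f_{u_1} (x): the head of u acts first. *)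
Definition word_act (F : R -> R) (u : list nat) (x : R) : R :=
  fold_left (fun z i => branch F i z) u x.

Definition theta2 (F : R -> R) (g : circle -> R -> R) (u : list nat)
  (x y : R) : R :=
  fold_right (fun k z => g (proj (word_act F (firstn k u) x)) z) y
    (List.seq 1 (length u)).

Definition theta (F : R -> R) (g : circle -> R -> R) (u : list nat)
  (x : R) : R := theta2 F g u x 0.

Definition theta_diff (F : R -> R) (g : circle -> R -> R) (u v : list nat)
  (x : R) : R := theta F g u x - theta F g v x.

(* The next two infima are minima, of continuous functions on compact sets. *)
Definition r_min (g : circle -> R -> R) : R :=
  real (Glb_Rbar (fun r => exists (x : circle) (y : R),
    in_U y /\ r = Rabs (Derive (g x) y))).

Definition kappa_min (b : nat) (F : R -> R) : R :=
  real (Glb_Rbar (fun r => exists (i : nat) (x : R),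
    (i < b)%nat /\ 0 <= x <= 1 /\ r = Rabs (Derive (branch F i) x))).

(* Main.v *)
Require Import Defs.
From Stdlib Require Import Reals ZArith Lra Lia List ClassicalEpsilon ProofIrrelevance.
From Coquelicot Require Import Coquelicot.
Open Scope R_scope.

(** Reading words in base [b], with lowest digit first, turns every [theta_u] into
    a translate of one sequence of curves on the line: [theta_u(x)] is the
    [|u|]-th iterate of the graph transform [a |-> g(F^-1 X, a(F^-1 X))], started
    from [0] and evaluated at [x + val u].  These iterates converge to an
    analytic curve [Theta] on the line.  If [Theta (x + M) = Theta x] for all [M]
    at a single point [x], then, going backwards along a dense set, [Theta] is
    periodic and the attractor is its graph; so [Theta] separates translates at
    every point.

    Analyticity is quantified by the norm [sum |a_k| rho^k] of Taylor
    coefficients, which is submultiplicative, behaves well under composition, and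
    is lower semicontinuous under mere pointwise convergence.

    Suppose the conclusion fails along a sequence of words of growing length.
    The difference of two curves is a product of divided differences of [g], with
    bounded distortion, so after normalisation the failing differences have
    uniformly bounded norm; all their derivatives tend to [0] at a point, hence
    they tend to [1] everywhere on the line.  Comparing the products at two
    points forces [|d_y g|] to be constant along [Theta]; as the values
    [Theta (x + M)] accumulate, [d_y g] is constant.  In this affine case first
    derivatives suffice: otherwise [Theta' (p + M) = Theta' p] for all [M] at some
    [p], so [Theta'] is periodic by density, and so is [Theta], being bounded. *)

(* [ring] does not recognise equations typed in a Coquelicot structure on [R]. *)
Ltac ring_R := match goal with |- ?x = ?y => change (@eq R x y) end; ring.

(** * Power series with bounded weighted norm *)

(** Everything stays on the real line. Inverse branches contract, so a disc of radius [rho] goes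
    into one of radius [kap * rho], and a single radius serves all iterates; the class [curve]
    records this, and it makes the estimates independent of the length of [u].

    No explicit constant arises: [K], [N] and [1 / c] are all tied to one index [n], and failure at
    every [n] is refuted. The obstacle is the order of quantifiers. A failure supplies continuations
    that depend on the order [k] of the derivative, while flatness needs all orders for one
    function. Continuations move the suffix curves by at most a multiple of [lam ^ n]; the
    normalised differences then move as little, and the norm bound turns this into closeness of each
    derivative.

    Words only give translates by natural numbers, hence periodicity on a half-line. Comparing whole
    products at two points, and again at their images under [F], isolates a single factor by
    subtraction. In the affine case the chain rule along the inverse iterates brings in [kappa_min];
    elsewhere differences are compared with the power of [r_min] alone. *)

Definition coef_bound (rho M : R) (a : nat -> R) : Prop :=
  forall n, sum_n (fun k => Rabs (a k) * rho ^ k) n <= M.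

Definition has_coefs (rho M : R) (a : nat -> R) (h : R -> R) : Prop :=
  coef_bound rho M a /\ forall t, Rabs t < rho -> is_pseries a t (h t).

(** A relation instead of a number: [M] is an upper bound for the weighted l1 norm of the Taylor
    coefficients at 0. Bounding partial sums lets the bound pass to coefficientwise limits without a
    convergence proof beforehand. *)
Definition anorm_le (rho M : R) (h : R -> R) : Prop :=
  exists a, has_coefs rho M a h.

Lemma sum_n_le_R (u v : nat -> R) (n : nat) :
  (forall k, u k <= v k) -> sum_n u n <= sum_n v n.
Proof.
  intros H; induction n as [|n IH].
  - rewrite !sum_O; auto.
  - rewrite !sum_Sn; unfold plus; simpl; specialize (H (S n)); lra.
Qed.

Lemma sum_n_abs_le (u : nat -> R) (n : nat) :
  Rabs (sum_n u n) <= sum_n (fun k => Rabs (u k)) n.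
Proof.
  induction n as [|n IH].
  - rewrite !sum_O; apply Rle_refl.
  - rewrite !sum_Sn; unfold plus; simpl.
    eapply Rle_trans; [apply Rabs_triang|]; lra.
Qed.

Lemma sum_n_pos (u : nat -> R) (n : nat) :
  (forall k, 0 <= u k) -> 0 <= sum_n u n.
Proof.
  intros H; induction n as [|n IH].
  - rewrite sum_O; auto.
  - rewrite sum_Sn; unfold plus; simpl; specialize (H (S n)); lra.
Qed.

Lemma coef_bound_term (rho M : R) (a : nat -> R) (k : nat) :
  0 <= rho -> coef_bound rho M a -> Rabs (a k) * rho ^ k <= M.
Proof.
  intros Hr H; eapply Rle_trans; [|apply (H k)].
  destruct k as [|k].
  - rewrite sum_O; apply Rle_refl.
  - rewrite sum_Sn; unfold plus; simpl.
    assert (0 <= sum_n (fun k => Rabs (a k) * rho ^ k) k).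
    { apply sum_n_pos; intros j; apply Rmult_le_pos;
      [apply Rabs_pos | apply pow_le; lra]. }
    lra.
Qed.

Lemma coef_bound_nonneg (rho M : R) (a : nat -> R) :
  coef_bound rho M a -> 0 <= M.
Proof.
  intros H; specialize (H 0%nat); rewrite sum_O in H; simpl in H.
  pose proof (Rabs_pos (a 0%nat)); lra.
Qed.

Lemma coef_bound_weaken (rho M M' : R) (a : nat -> R) :
  M <= M' -> coef_bound rho M a -> coef_bound rho M' a.
Proof. intros H Ha n; specialize (Ha n); lra. Qed.

Lemma coef_bound_radius (rho M t : R) (a : nat -> R) :
  coef_bound rho M a -> Rabs t < rho -> Rbar_lt (Rabs t) (CV_radius a).
Proof.
  intros H Ht.
  assert (Hr : 0 <= rho) by (pose proof (Rabs_pos t); lra).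
  apply Rbar_lt_le_trans with rho; [exact Ht|].
  apply (proj1 (CV_radius_bounded a)).
  exists M; intros n; rewrite Rabs_mult, <- RPow_abs, (Rabs_pos_eq rho) by exact Hr.
  now apply coef_bound_term.
Qed.

Lemma coef_bound_ex_pseries (rho M t : R) (a : nat -> R) :
  coef_bound rho M a -> Rabs t < rho -> ex_pseries a t.
Proof.
  intros H Ht; apply CV_radius_inside; eapply coef_bound_radius; eauto.
Qed.

Lemma coef_bound_has_coefs (rho M : R) (a : nat -> R) :
  coef_bound rho M a -> has_coefs rho M a (PSeries a).
Proof.
  intros H; split; [exact H|]; intros t Ht.
  apply PSeries_correct; eapply coef_bound_ex_pseries; eauto.
Qed.

Lemma has_coefs_PSeries (rho M t : R) (a : nat -> R) (h : R -> R) :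
  has_coefs rho M a h -> Rabs t < rho -> h t = PSeries a t.
Proof. intros [_ H] Ht; symmetry; apply is_pseries_unique; auto. Qed.

Lemma has_coefs_anorm (rho M : R) (a : nat -> R) (h : R -> R) :
  has_coefs rho M a h -> anorm_le rho M h.
Proof. now exists a. Qed.

(** Every term beyond the n-th gains the factor [th ^ S n] over its weighted size. Keeping the
    difference of weighted partial sums on the right makes the induction on [p] exact. *)
Lemma partial_tail (rho M th t : R) (a : nat -> R) (n p : nat) :
  0 <= rho -> coef_bound rho M a -> 0 <= th < 1 -> Rabs t <= th * rho ->
  Rabs (sum_n (fun k => a k * t ^ k) (n + p) - sum_n (fun k => a k * t ^ k) n)
   <= th ^ S n * (sum_n (fun k => Rabs (a k) * rho ^ k) (n + p)
                  - sum_n (fun k => Rabs (a k) * rho ^ k) n).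
Proof.
  intros Hr Ha Hth Ht; induction p as [|p IH].
  - rewrite Nat.add_0_r, !Rminus_diag, Rabs_R0; lra.
  - rewrite Nat.add_succ_r, !sum_Sn; unfold plus; simpl plus.
    set (m := S (n + p)) in *.
    assert (Hm : Rabs (a m * t ^ m) <= th ^ S n * (Rabs (a m) * rho ^ m)).
    { rewrite Rabs_mult, <- RPow_abs.
      replace (th ^ S n * (Rabs (a m) * rho ^ m))
        with (Rabs (a m) * (th ^ S n * rho ^ m)) by ring.
      apply Rmult_le_compat_l; [apply Rabs_pos|].
      eapply Rle_trans; [apply pow_incr; split; [apply Rabs_pos|exact Ht]|].
      rewrite Rpow_mult_distr; apply Rmult_le_compat_r; [apply pow_le; lra|].
      replace m with (S n + p)%nat by (unfold m; lia).
      rewrite pow_add; rewrite <- (Rmult_1_r (th ^ S n)) at 2.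
      apply Rmult_le_compat_l; [apply pow_le; lra|].
      rewrite <- (pow1 p); apply pow_incr; lra. }
    set (u := sum_n (fun k => a k * t ^ k) (n + p)) in *.
    set (v := sum_n (fun k => a k * t ^ k) n) in *.
    set (U := sum_n (fun k => Rabs (a k) * rho ^ k) (n + p)) in *.
    set (V := sum_n (fun k => Rabs (a k) * rho ^ k) n) in *.
    change (Rabs (u + a m * t ^ m - v) <= th ^ S n * (U + Rabs (a m) * rho ^ m - V)).
    replace (u + a m * t ^ m - v) with ((u - v) + a m * t ^ m) by ring.
    eapply Rle_trans; [apply Rabs_triang|].
    lra.
Qed.

Lemma is_pseries_lim (a : nat -> R) (t l : R) :
  is_pseries a t l <-> is_lim_seq (sum_n (fun k => a k * t ^ k)) l.
Proof. rewrite is_pseries_R; reflexivity. Qed.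

Lemma pseries_tail (rho M th t l : R) (a : nat -> R) (n : nat) :
  0 < rho -> coef_bound rho M a -> 0 <= th < 1 -> Rabs t <= th * rho ->
  is_pseries a t l ->
  Rabs (l - sum_n (fun k => a k * t ^ k) n) <= M * th ^ S n.
Proof.
  intros Hr Ha Hth Ht Hl; apply is_pseries_lim in Hl.
  set (s := sum_n (fun k => a k * t ^ k) n).
  assert (Hlim : is_lim_seq
    (fun p => Rabs (sum_n (fun k => a k * t ^ k) (n + p) - s)) (Rabs (l - s))).
  { apply (is_lim_seq_abs _ (l - s)).
    apply is_lim_seq_minus'; [|apply is_lim_seq_const].
    apply is_lim_seq_ext with (fun p => sum_n (fun k => a k * t ^ k) (p + n)).
    - intros p; now rewrite Nat.add_comm.
    - now apply -> (is_lim_seq_incr_n (sum_n (fun k => a k * t ^ k)) n). }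
  refine (is_lim_seq_le _ _ _ (M * th ^ S n) _ Hlim (is_lim_seq_const _)).
  intros p; eapply Rle_trans; [eapply partial_tail; eauto; lra|].
  rewrite Rmult_comm; apply Rmult_le_compat_r; [apply pow_le; lra|].
  assert (0 <= sum_n (fun k => Rabs (a k) * rho ^ k) n).
  { apply sum_n_pos; intros j; apply Rmult_le_pos;
      [apply Rabs_pos | apply pow_le; lra]. }
  specialize (Ha (n + p)%nat); lra.
Qed.

Lemma has_coefs_0 (rho M : R) (a : nat -> R) (h : R -> R) :
  0 < rho -> has_coefs rho M a h -> h 0 = a 0%nat.
Proof.
  intros Hr H; rewrite (has_coefs_PSeries _ _ 0 _ _ H) by (rewrite Rabs_R0; lra).
  apply PSeries_0.
Qed.

Lemma anorm_le_lip (rho M t : R) (h : R -> R) :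
  anorm_le rho M h -> Rabs t < rho -> Rabs (h t - h 0) <= M / rho * Rabs t.
Proof.
  intros [a Ha] Ht.
  assert (Hr : 0 < rho) by (pose proof (Rabs_pos t); lra).
  rewrite (has_coefs_0 _ _ _ _ Hr Ha).
  assert (Hth : 0 <= Rabs t / rho < 1).
  { split; [apply Rdiv_le_0_compat; [apply Rabs_pos|lra]|].
    apply (Rdiv_lt_1 _ _ Hr); lra. }
  (* The tail after the constant term, with the smallest admissible ratio, is linear in [Rabs t]. *)
  pose proof (pseries_tail rho M (Rabs t / rho) t (h t) a 0 Hr (proj1 Ha) Hth) as H.
  rewrite sum_O in H; simpl in H.
  replace (M / rho * Rabs t) with (M * (Rabs t / rho * 1)) by (field; lra).
  rewrite <- (Rmult_1_r (a 0%nat)) at 1.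
  apply H; [right; field; lra | apply (proj2 Ha _ Ht)].
Qed.

Lemma anorm_le_val (rho M t : R) (h : R -> R) :
  anorm_le rho M h -> Rabs t < rho -> Rabs (h t) <= M.
Proof.
  intros [a [Ha Hh]] Ht; specialize (Hh t Ht); apply is_pseries_lim in Hh.
  apply is_lim_seq_abs in Hh.
  refine (is_lim_seq_le _ _ _ M _ Hh (is_lim_seq_const _)).
  intros n; eapply Rle_trans; [apply sum_n_abs_le|].
  eapply Rle_trans; [|apply (Ha n)].
  apply sum_n_le_R; intros k; rewrite Rabs_mult, <- RPow_abs.
  apply Rmult_le_compat_l; [apply Rabs_pos|].
  apply pow_incr; split; [apply Rabs_pos|lra].
Qed.

Lemma anorm_le_nonneg (rho M : R) (h : R -> R) : anorm_le rho M h -> 0 <= M.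
Proof. intros [a [Ha _]]; eapply coef_bound_nonneg; eauto. Qed.

Lemma anorm_le_weaken (rho M M' : R) (h : R -> R) :
  M <= M' -> anorm_le rho M h -> anorm_le rho M' h.
Proof.
  intros H [a [Ha Hh]]; exists a; split; [eapply coef_bound_weaken; eauto|auto].
Qed.

Lemma anorm_le_ext (rho M : R) (h h' : R -> R) :
  (forall t, Rabs t < rho -> h t = h' t) -> anorm_le rho M h -> anorm_le rho M h'.
Proof.
  intros H [a [Ha Hh]]; exists a; split; [exact Ha|].
  intros t Ht; rewrite <- H by exact Ht; auto.
Qed.

Lemma is_pseries_finite (a : nat -> R) (t : R) (N : nat) :
  (forall k, (N < k)%nat -> a k = 0) ->
  is_pseries a t (sum_n (fun k => a k * t ^ k) N).
Proof.
  intros H; apply is_pseries_lim.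
  apply is_lim_seq_ext_loc with (fun _ => sum_n (fun k => a k * t ^ k) N).
  2: apply is_lim_seq_const.
  exists N; intros n Hn.
  induction Hn as [|n Hn IH]; [reflexivity|].
  rewrite sum_Sn, H by lia; change (Hierarchy.plus ?x ?y) with (x + y).
  now rewrite Rmult_0_l, Rplus_0_r.
Qed.

Lemma anorm_le_const (rho c : R) : 0 <= rho -> anorm_le rho (Rabs c) (fun _ => c).
Proof.
  intros Hr; exists (fun k => match k with O => c | _ => 0 end); split.
  - intros n; induction n as [|n IH].
    + rewrite sum_O; simpl; lra.
    + rewrite sum_Sn; unfold plus; simpl; rewrite Rabs_R0; lra.
  - intros t _.
    pose proof (is_pseries_finite (fun k => match k with O => c | _ => 0 end) t 0) as H.
    rewrite sum_O in H; simpl in H; rewrite Rmult_1_r in H; apply H.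
    intros [|k] Hk; [lia|reflexivity].
Qed.

Lemma anorm_le_id (rho : R) : 0 <= rho -> anorm_le rho rho (fun t => t).
Proof.
  intros Hr; exists (fun k => match k with 1%nat => 1 | _ => 0 end); split.
  - intros n; destruct n as [|n].
    { rewrite sum_O; simpl; rewrite Rabs_R0; lra. }
    induction n as [|n IH].
    + rewrite sum_Sn, sum_O; unfold plus; simpl; rewrite Rabs_R0, Rabs_R1; lra.
    + rewrite sum_Sn; unfold plus; simpl plus; simpl in IH |- *; rewrite Rabs_R0; lra.
  - intros t _.
    pose proof (is_pseries_finite (fun k => match k with 1%nat => 1 | _ => 0 end) t 1) as H.
    rewrite sum_Sn, sum_O in H; unfold plus in H; simpl in H.
    replace (0 * 1 + 1 * (t * 1)) with t in H by ring; apply H.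
    intros [|[|k]] Hk; [lia|lia|reflexivity].
Qed.

Lemma coef_bound_plus (rho M M' : R) (a b : nat -> R) :
  0 <= rho -> coef_bound rho M a -> coef_bound rho M' b ->
  coef_bound rho (M + M') (fun k => a k + b k).
Proof.
  intros Hr Ha Hb n.
  eapply Rle_trans; [|apply (Rplus_le_compat _ _ _ _ (Ha n) (Hb n))].
  change (sum_n (fun k => Rabs (a k + b k) * rho ^ k) n <=
    plus (sum_n (fun k => Rabs (a k) * rho ^ k) n) (sum_n (fun k => Rabs (b k) * rho ^ k) n)).
  rewrite <- sum_n_plus; apply sum_n_le_R; intros k; unfold plus; simpl.
  rewrite <- Rmult_plus_distr_r; apply Rmult_le_compat_r;
    [apply pow_le; lra|apply Rabs_triang].
Qed.

Lemma anorm_le_plus (rho M M' : R) (h h' : R -> R) :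
  0 <= rho -> anorm_le rho M h -> anorm_le rho M' h' ->
  anorm_le rho (M + M') (fun t => h t + h' t).
Proof.
  intros Hr [a [Ha Hh]] [b [Hb Hh']]; exists (fun k => a k + b k); split.
  - now apply coef_bound_plus.
  - intros t Ht; exact (is_pseries_plus a b t _ _ (Hh t Ht) (Hh' t Ht)).
Qed.

Lemma coef_bound_opp (rho M : R) (a : nat -> R) :
  coef_bound rho M a -> coef_bound rho M (fun k => - a k).
Proof.
  intros Ha n; erewrite sum_n_ext; [apply (Ha n)|].
  intros k; simpl; now rewrite Rabs_Ropp.
Qed.

(** The partial sum of the Cauchy product is only a part of the product of the two partial sums; the
    remainder given by [cauchy_finite] has nonnegative terms. *)
Lemma coef_bound_mult (rho M M' : R) (a b : nat -> R) :
  0 <= rho -> coef_bound rho M a -> coef_bound rho M' b ->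
  coef_bound rho (M * M') (PS_mult a b).
Proof.
  intros Hr Ha Hb n.
  set (A := fun k => Rabs (a k) * rho ^ k).
  set (B := fun k => Rabs (b k) * rho ^ k).
  assert (HA : forall k, 0 <= A k).
  { intros k; apply Rmult_le_pos; [apply Rabs_pos|apply pow_le; lra]. }
  assert (HB : forall k, 0 <= B k).
  { intros k; apply Rmult_le_pos; [apply Rabs_pos|apply pow_le; lra]. }
  apply Rle_trans with (sum_n A n * sum_n B n).
  2:{ apply Rmult_le_compat; [now apply sum_n_pos|now apply sum_n_pos|apply Ha|apply Hb]. }
  apply Rle_trans with (sum_n (fun k => sum_f_R0 (fun p => A p * B (k - p)%nat) k) n).
  - apply sum_n_le_R; intros k; unfold PS_mult.
    rewrite <- (Rabs_pos_eq (rho ^ k)) by (apply pow_le; lra).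
    rewrite <- Rabs_mult, Rmult_comm, scal_sum.
    eapply Rle_trans; [apply sum_f_R0_triangle|].
    right; apply sum_eq; intros i Hi; unfold A, B.
    rewrite !Rabs_mult, (Rabs_pos_eq (rho ^ k)) by (apply pow_le; lra).
    replace k with (i + (k - i))%nat at 2 by lia; rewrite pow_add; ring.
  - rewrite !sum_n_Reals; destruct n as [|n]; [simpl; lra|].
    rewrite (cauchy_finite A B (S n)) by lia.
    match goal with |- ?u <= ?u + ?v => assert (0 <= v); [|lra] end.
    apply cond_pos_sum; intros k; apply cond_pos_sum; intros l.
    apply Rmult_le_pos; auto.
Qed.

Lemma anorm_le_mult (rho M M' : R) (h h' : R -> R) :
  0 <= rho -> anorm_le rho M h -> anorm_le rho M' h' ->
  anorm_le rho (M * M') (fun t => h t * h' t).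
Proof.
  intros Hr [a [Ha Hh]] [b [Hb Hh']]; exists (PS_mult a b); split.
  - now apply coef_bound_mult.
  - intros t Ht; apply is_pseries_mult; auto; eapply coef_bound_radius; eauto.
Qed.

Lemma anorm_le_scal (rho M c : R) (h : R -> R) :
  0 <= rho -> anorm_le rho M h -> anorm_le rho (Rabs c * M) (fun t => c * h t).
Proof. intros Hr H; apply anorm_le_mult; auto; now apply anorm_le_const. Qed.

Lemma anorm_le_opp (rho M : R) (h : R -> R) :
  anorm_le rho M h -> anorm_le rho M (fun t => - h t).
Proof.
  intros [a [Ha Hh]]; exists (fun k => - a k); split.
  - now apply coef_bound_opp.
  - intros t Ht; exact (is_pseries_opp a t _ (Hh t Ht)).
Qed.

Lemma anorm_le_minus (rho M M' : R) (h h' : R -> R) :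
  0 <= rho -> anorm_le rho M h -> anorm_le rho M' h' ->
  anorm_le rho (M + M') (fun t => h t - h' t).
Proof. intros; apply anorm_le_plus; auto; now apply anorm_le_opp. Qed.

Lemma anorm_le_pow (rho M : R) (h : R -> R) (n : nat) :
  0 <= rho -> anorm_le rho M h -> anorm_le rho (M ^ n) (fun t => h t ^ n).
Proof.
  intros Hr H; induction n as [|n IH]; simpl.
  - apply anorm_le_weaken with (Rabs 1); [rewrite Rabs_R1; lra|].
    now apply anorm_le_const.
  - now apply anorm_le_mult.
Qed.

Lemma coef_bound_decr_1 (rho M : R) (a : nat -> R) :
  0 < rho -> coef_bound rho M a -> coef_bound rho (M / rho) (PS_decr_1 a).
Proof.
  intros Hr Ha n.
  apply Rmult_le_reg_l with rho; [exact Hr|].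
  replace (rho * (M / rho)) with M by (field; lra).
  eapply Rle_trans; [|apply (Ha (S n))].
  rewrite (sum_n_Reals (fun k => Rabs (a k) * rho ^ k)), decomp_sum by lia; simpl pred.
  rewrite <- sum_n_Reals.
  change (rho * ?s) with (mult rho s).
  rewrite <- (sum_n_mult_l rho (fun k => Rabs (PS_decr_1 a k) * rho ^ k)).
  apply Rle_trans with (0 + sum_n (fun i => Rabs (a (S i)) * rho ^ S i) n).
  - rewrite Rplus_0_l; right; apply sum_n_ext; intros k.
    unfold mult, PS_decr_1; simpl; ring.
  - apply Rplus_le_compat_r; simpl; pose proof (Rabs_pos (a 0%nat)); lra.
Qed.

(** The norm bound makes all the series Lipschitz at 0 with the same constant [M / rho], so one
    small [t] serves every index. The filter is left general in order to cover both sequences and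
    pairs of indices. *)
Lemma first_coef_lim_zero {I : Type} (G : (I -> Prop) -> Prop) {HG : Filter G}
  (rho M : R) (a : I -> nat -> R) :
  0 < rho -> (forall i, coef_bound rho M (a i)) ->
  (forall t, 0 < t < rho -> forall e, 0 < e -> G (fun i => Rabs (PSeries (a i) t) < e)) ->
  forall e, 0 < e -> G (fun i => Rabs (a i 0%nat) < e).
Proof.
  intros Hr Ha Hlim e He.
  set (t := Rmin (rho / 2) (e * rho / (2 * (Rabs M + 1)))).
  pose proof (Rabs_pos M) as HM.
  assert (Ht : 0 < t < rho).
  { split; [apply Rmin_pos; [lra|apply Rdiv_lt_0_compat; nra]|].
    eapply Rle_lt_trans; [apply Rmin_l|lra]. }
  apply filter_imp with (2 := Hlim t Ht (e / 2) ltac:(lra)).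
  intros i Hi.
  pose proof (coef_bound_has_coefs _ _ _ (Ha i)) as Hc.
  pose proof (anorm_le_lip rho M t (PSeries (a i)) (has_coefs_anorm _ _ _ _ Hc)) as H.
  rewrite (Rabs_pos_eq t) in H by lra; specialize (H (proj2 Ht)).
  rewrite PSeries_0 in H.
  assert (M / rho * t <= e / 2).
  { assert (Hm : t <= e * rho / (2 * (Rabs M + 1))) by apply Rmin_r.
    assert (M <= Rabs M) by apply Rle_abs.
    apply Rle_trans with (Rabs M / rho * (e * rho / (2 * (Rabs M + 1)))).
    - apply Rmult_le_compat; try lra.
      + apply Rdiv_le_0_compat; [|lra]. exact (coef_bound_nonneg _ _ _ (Ha i)).
      + apply Rmult_le_compat_r; [left; now apply Rinv_0_lt_compat|lra].
    - replace (Rabs M / rho * (e * rho / (2 * (Rabs M + 1))))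
        with ((e / 2) * (Rabs M / (Rabs M + 1))) by (field; lra).
      rewrite <- (Rmult_1_r (e / 2)) at 2; apply Rmult_le_compat_l; [lra|].
      apply Rmult_le_reg_r with (Rabs M + 1); [lra|].
      unfold Rdiv; rewrite Rmult_assoc, Rinv_l; lra. }
  replace (a i 0%nat) with (PSeries (a i) t - (PSeries (a i) t - a i 0%nat)) by ring.
  eapply Rle_lt_trans; [apply Rabs_triang|]; rewrite Rabs_Ropp; lra.
Qed.

(* Convergence to zero at the points [t <> 0] is enough, which is what makes
   the induction on [k], by division by [t], possible. *)
Lemma coefs_lim_zero {I : Type} (G : (I -> Prop) -> Prop) {HG : Filter G}
  (rho M : R) (a : I -> nat -> R) :
  0 < rho -> (forall i, coef_bound rho M (a i)) ->
  (forall t, 0 < t < rho -> forall e, 0 < e -> G (fun i => Rabs (PSeries (a i) t) < e)) ->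
  forall k e, 0 < e -> G (fun i => Rabs (a i k) < e).
Proof.
  intros Hr Ha Hlim k; revert M a Ha Hlim; induction k as [|k IH];
    intros M a Ha Hlim e He.
  - now apply (first_coef_lim_zero G rho M a).
  - apply (IH (M / rho) (fun i => PS_decr_1 (a i))); auto.
    { intros i; now apply coef_bound_decr_1. }
    intros t Ht e' He'.
    assert (Hte : 0 < t * e' / 2) by nra.
    pose proof (first_coef_lim_zero G rho M a Hr Ha Hlim _ Hte) as H0.
    pose proof (Hlim t Ht _ Hte) as Ht'.
    apply filter_imp with (2 := filter_and _ _ H0 Ht').
    intros i [H1 H2].
    assert (Hex : ex_pseries (a i) t).
    { eapply coef_bound_ex_pseries; [apply Ha|rewrite Rabs_pos_eq; lra]. }
    rewrite (PSeries_decr_1 _ _ Hex) in H2.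
    set (s := PSeries (PS_decr_1 (a i)) t) in *.
    assert (H3 : Rabs (t * s) < t * e').
    { replace (t * s) with ((a i 0%nat + t * s) - a i 0%nat) by ring.
      eapply Rle_lt_trans; [apply Rabs_triang|]; rewrite Rabs_Ropp; lra. }
    rewrite Rabs_mult, (Rabs_pos_eq t) in H3 by lra; nra.
Qed.

(** The tails beyond one order [K] are small for all indices at once; the head consists of finitely
    many coefficients, each of which converges along the filter. *)
Lemma pseries_lim_uniform {I : Type} (G : (I -> Prop) -> Prop) {HG : Filter G}
  (rho M th : R) (a : I -> nat -> R) (c : nat -> R) :
  0 < rho -> 0 <= th < 1 -> (forall i, coef_bound rho M (a i)) -> coef_bound rho M c ->
  (forall k e, 0 < e -> G (fun i => Rabs (a i k - c k) < e)) ->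
  forall e, 0 < e ->
  G (fun i => forall t, Rabs t <= th * rho -> Rabs (PSeries (a i) t - PSeries c t) < e).
Proof.
  intros Hr Hth Ha Hc Hlim e He.
  pose proof (coef_bound_nonneg _ _ _ Hc) as HM.
  assert (HK : exists K, 2 * M * th ^ S K < e / 2).
  { destruct (pow_lt_1_zero th ltac:(rewrite Rabs_pos_eq; lra) (e / 2 / (2 * M + 1)))
      as [K HK]; [apply Rdiv_lt_0_compat; lra|].
    exists K; specialize (HK (S K) ltac:(lia)).
    rewrite Rabs_pos_eq in HK by (apply pow_le; lra).
    assert (0 <= th ^ S K) by (apply pow_le; lra).
    apply Rmult_lt_compat_r with (r := 2 * M + 1) in HK; [|lra].
    replace (e / 2 / (2 * M + 1) * (2 * M + 1)) with (e / 2) in HK by (field; lra).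
    nra. }
  destruct HK as [K HK].
  assert (Hsum : forall N d, 0 < d -> G (fun i =>
    sum_n (fun k => Rabs (a i k - c k) * rho ^ k) N < d)).
  { induction N as [|N IH]; intros d Hd.
    - apply filter_imp with (2 := Hlim 0%nat d Hd); intros i Hi.
      rewrite sum_O; simpl; lra.
    - assert (Hp : 0 < rho ^ S N) by (apply pow_lt; lra).
      assert (Hd2 : 0 < d / 2) by lra.
      assert (Hd3 : 0 < d / 2 / rho ^ S N) by (apply Rdiv_lt_0_compat; lra).
      pose proof (IH _ Hd2) as G1; pose proof (Hlim (S N) _ Hd3) as G2.
      apply filter_imp with (2 := filter_and _ _ G1 G2).
      intros i [H1 H2]; rewrite sum_Sn.
      apply Rmult_lt_compat_r with (r := rho ^ S N) in H2; [|exact Hp].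
      replace (d / 2 / rho ^ S N * rho ^ S N) with (d / 2) in H2 by (field; lra).
      change (Hierarchy.plus ?x ?y) with (x + y).
      lra. }
  apply filter_imp with (2 := Hsum K (e / 2) ltac:(lra)); intros i Hi t Ht.
  assert (Ht' : Rabs t < rho) by nra.
  pose proof (pseries_tail rho M th t _ (a i) K Hr (Ha i) Hth Ht
    (proj2 (coef_bound_has_coefs _ _ _ (Ha i)) t Ht')) as H1.
  pose proof (pseries_tail rho M th t _ c K Hr Hc Hth Ht
    (proj2 (coef_bound_has_coefs _ _ _ Hc) t Ht')) as H2.
  set (x := PSeries (a i) t) in *; set (y := PSeries c t) in *.
  set (x' := sum_n (fun k => a i k * t ^ k) K) in *.
  set (y' := sum_n (fun k => c k * t ^ k) K) in *.
  assert (H3 : Rabs (x' - y') < e / 2).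
  { eapply Rle_lt_trans; [|exact Hi].
    replace (x' - y') with (sum_n (fun k => (a i k - c k) * t ^ k) K).
    - eapply Rle_trans; [apply sum_n_abs_le|].
      apply sum_n_le_R; intros k; rewrite Rabs_mult, <- RPow_abs.
      apply Rmult_le_compat_l; [apply Rabs_pos|].
      apply pow_incr; split; [apply Rabs_pos|lra].
    - unfold x', y'; clear; induction K as [|K IH].
      + rewrite !sum_O.
        ring_R.
      + rewrite !sum_Sn, IH; change (Hierarchy.plus ?x ?y) with (x + y).
        ring_R. }
  replace (x - y) with ((x - x') + (x' - y') - (y - y')) by ring.
  eapply Rle_lt_trans; [apply Rabs_triang|]; rewrite Rabs_Ropp.
  pose proof (Rabs_triang (x - x') (x' - y')); lra.
Qed.

Lemma is_lim_seq_eps (u : nat -> R) (l : R) :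
  is_lim_seq u l <-> forall e, 0 < e -> eventually (fun n => Rabs (u n - l) < e).
Proof.
  rewrite is_lim_seq_Reals; unfold Un_cv, Rdist, eventually; split; intros H e He;
    destruct (H e He) as [N HN]; exists N; intros n Hn; apply HN; lia.
Qed.

(* A Montel-type statement: only pointwise convergence is assumed. *)
Lemma anorm_le_lim (rho M : R) (h : nat -> R -> R) (h' : R -> R) :
  0 < rho -> (forall n, anorm_le rho M (h n)) ->
  (forall t, Rabs t < rho -> is_lim_seq (fun n => h n t) (h' t)) ->
  anorm_le rho M h'.
Proof.
  intros Hr Hh Hlim.
  destruct (choice _ Hh) as [a Ha].
  (* No candidate for the limit coefficients is known yet, so each coefficient is first shown to be
     Cauchy, by applying [coefs_lim_zero] to differences indexed by pairs. *)
  assert (Hc : forall k e, 0 < e ->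
    filter_prod eventually eventually
      (fun p : nat * nat => Rabs (a (fst p) k - a (snd p) k) < e)).
  { apply (coefs_lim_zero (filter_prod eventually eventually) rho (M + M)
      (fun p k => a (fst p) k - a (snd p) k) Hr).
    { intros p; apply coef_bound_plus; [lra|apply Ha|apply coef_bound_opp, Ha]. }
    intros t Ht e He.
    assert (Ht' : Rabs t < rho) by (rewrite Rabs_pos_eq; lra).
    pose proof (proj1 (is_lim_seq_eps _ _) (Hlim t Ht') (e / 2) ltac:(lra)) as Hev.
    apply Filter_prod with (1 := Hev) (2 := Hev); intros n m Hn Hm.
    assert (Heq : PSeries (fun k => a n k - a m k) t = h n t - h m t).
    { rewrite (has_coefs_PSeries _ _ _ _ _ (Ha n) Ht'),
        (has_coefs_PSeries _ _ _ _ _ (Ha m) Ht').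
      apply PSeries_minus; eapply coef_bound_ex_pseries; eauto; apply Ha. }
    simpl; rewrite Heq.
    replace (h n t - h m t) with ((h n t - h' t) - (h m t - h' t)) by ring.
    eapply Rle_lt_trans; [apply Rabs_triang|]; rewrite Rabs_Ropp; lra. }
  assert (Hex : forall k, exists l : R, is_lim_seq (fun n => a n k) l).
  { intros k; apply ex_lim_seq_cauchy_corr; intros e.
    destruct (Hc k e (cond_pos e)) as [P Q [N1 HP] [N2 HQ] HPQ].
    exists (N1 + N2)%nat; intros n m Hn Hm; apply (HPQ n m); [apply HP|apply HQ]; lia. }
  destruct (choice _ Hex) as [c Hlimc].
  assert (Hcb : coef_bound rho M c).
  { intros n.
    assert (Hs : is_lim_seq (fun i => sum_n (fun k => Rabs (a i k) * rho ^ k) n)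
      (sum_n (fun k => Rabs (c k) * rho ^ k) n)).
    { induction n as [|n IH].
      - rewrite sum_O; apply is_lim_seq_ext with (fun i => Rabs (a i 0%nat) * rho ^ 0).
        { intros i; now rewrite sum_O. }
        apply is_lim_seq_mult'; [|apply is_lim_seq_const].
        apply (is_lim_seq_abs _ (c 0%nat)), Hlimc.
      - rewrite sum_Sn.
        apply is_lim_seq_ext with (fun i =>
          sum_n (fun k => Rabs (a i k) * rho ^ k) n + Rabs (a i (S n)) * rho ^ S n).
        { intros i; now rewrite sum_Sn. }
        apply is_lim_seq_plus'; [exact IH|].
        apply is_lim_seq_mult'; [|apply is_lim_seq_const].
        apply (is_lim_seq_abs _ (c (S n))), Hlimc. }
    refine (is_lim_seq_le _ _ _ M _ Hs (is_lim_seq_const _)).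
    intros i; apply (proj1 (Ha i)). }
  exists c; split; [exact Hcb|]; intros t Ht.
  replace (h' t) with (PSeries c t).
  { apply PSeries_correct; eapply coef_bound_ex_pseries; eauto. }
  assert (H1 : is_lim_seq (fun n => h n t) (PSeries c t)).
  { apply is_lim_seq_eps; intros e He.
    pose proof (Rabs_pos t) as Ht0.
    assert (Hth : 0 <= Rabs t / rho < 1).
    { split; [apply Rdiv_le_0_compat; lra|apply (Rdiv_lt_1 _ _ Hr); lra]. }
    pose proof (pseries_lim_uniform eventually rho M (Rabs t / rho) a c Hr Hth
      (fun i => proj1 (Ha i)) Hcb) as H.
    apply filter_imp with (2 := H (fun k => proj1 (is_lim_seq_eps _ _) (Hlimc k)) e He).
    intros i Hi; rewrite (has_coefs_PSeries _ _ _ _ _ (Ha i) Ht); apply Hi.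
    right; field; lra. }
  pose proof (is_lim_seq_unique _ _ H1) as E1.
  pose proof (is_lim_seq_unique _ _ (Hlim t Ht)) as E2.
  rewrite E1 in E2; now injection E2.
Qed.

(** Partial sums of [h] composed with [phi] are handled by submultiplicativity, and the limit by
    [anorm_le_lim]. As [h 0 = 0], each nonzero term has at least one factor of norm at most
    [c * rho1]; keeping a single [c] gives the gain in the conclusion. *)
Lemma anorm_le_comp (rho rho1 M m c : R) (h phi : R -> R) :
  0 < rho -> 0 < rho1 -> 0 <= c <= 1 -> h 0 = 0 ->
  anorm_le rho1 M h -> anorm_le rho m phi -> m <= c * rho1 ->
  (forall t, Rabs t < rho -> Rabs (phi t) < rho1) ->
  anorm_le rho (c * M) (fun t => h (phi t)).
Proof.
  intros Hr Hr1 Hc H0 [a Ha] Hphi Hm Hrange.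
  pose proof (has_coefs_0 _ _ _ _ Hr1 Ha) as Ha0; rewrite H0 in Ha0.
  pose proof (anorm_le_nonneg _ _ _ Hphi) as Hm0.
  apply anorm_le_lim with (fun n t => sum_n (fun k => a k * phi t ^ k) n); [exact Hr| |].
  - intros n; apply anorm_le_weaken with (c * sum_n (fun k => Rabs (a k) * rho1 ^ k) n).
    { apply Rmult_le_compat_l; [lra|apply (proj1 Ha)]. }
    induction n as [|n IH].
    + apply anorm_le_ext with (fun _ => 0).
      { intros t _; rewrite sum_O, <- Ha0; ring. }
      apply anorm_le_weaken with (Rabs 0); [|apply anorm_le_const; lra].
      rewrite sum_O, <- Ha0, Rabs_R0; lra.
    + apply anorm_le_ext with
        (fun t => sum_n (fun k => a k * phi t ^ k) n + a (S n) * phi t ^ S n).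
      { intros t _; now rewrite sum_Sn. }
      rewrite sum_Sn; change (Hierarchy.plus ?x ?y) with (x + y).
      rewrite Rmult_plus_distr_l; apply anorm_le_plus; [lra|exact IH|].
      apply anorm_le_weaken with (Rabs (a (S n)) * m ^ S n).
      { replace (c * (Rabs (a (S n)) * rho1 ^ S n))
          with (Rabs (a (S n)) * (c * rho1 ^ S n)) by ring.
        apply Rmult_le_compat_l; [apply Rabs_pos|].
        simpl; apply Rle_trans with (c * rho1 * rho1 ^ n); [|right; ring].
        apply Rmult_le_compat; [lra|apply pow_le; lra|lra|].
        apply pow_incr; split; [lra|nra]. }
      apply anorm_le_scal, anorm_le_pow; auto; lra.
  - intros t Ht; apply is_pseries_lim, (proj2 Ha), Hrange, Ht.
Qed.

Lemma has_coefs_Derive_n (rho M x : R) (a : nat -> R) (h : R -> R) (k : nat) :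
  0 < rho -> has_coefs rho M a (fun t => h (x + t)) ->
  Derive_n h k x = a k * INR (Factorial.fact k).
Proof.
  intros Hr Ha.
  assert (HR : Rbar_lt 0 (CV_radius a)).
  { rewrite <- Rabs_R0; eapply coef_bound_radius; [apply Ha|rewrite Rabs_R0; lra]. }
  rewrite <- (Derive_n_coef a k HR).
  transitivity (Derive_n (fun t => h (t + x)) k 0).
  { rewrite Derive_n_comp_trans; f_equal; ring. }
  apply Derive_n_ext_loc; exists (mkposreal rho Hr); intros t Ht.
  change (Rabs (t - 0) < rho) in Ht; rewrite Rminus_0_r in Ht.
  rewrite Rplus_comm; exact (has_coefs_PSeries _ _ _ _ _ Ha Ht).
Qed.

Lemma has_coefs_is_derive (rho M x t : R) (a : nat -> R) (h : R -> R) :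
  has_coefs rho M a (fun t => h (x + t)) -> Rabs t < rho ->
  is_derive h (x + t) (PSeries (PS_derive a) t).
Proof.
  intros Ha Ht.
  assert (Hd := is_derive_PSeries a t (coef_bound_radius _ _ _ _ (proj1 Ha) Ht)).
  assert (Hd' : is_derive (fun s => PSeries a (s - x)) (x + t) (PSeries (PS_derive a) t)).
  { replace (PSeries (PS_derive a) t) with (scal 1 (PSeries (PS_derive a) t))
      by (unfold scal; simpl; unfold mult; simpl; ring).
    apply (is_derive_comp (PSeries a) (fun s => s - x)).
    - replace (x + t - x) with t by ring; exact Hd.
    - auto_derive; auto; ring. }
  apply is_derive_ext_loc with (2 := Hd').
  assert (Hp : 0 < rho - Rabs t) by lra.
  exists (mkposreal _ Hp); intros s Hs.
  change (Rabs (s - (x + t)) < rho - Rabs t) in Hs.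
  assert (Hst : Rabs (s - x) < rho).
  { replace (s - x) with ((s - (x + t)) + t) by ring.
    eapply Rle_lt_trans; [apply Rabs_triang|lra]. }
  rewrite <- (has_coefs_PSeries _ _ _ _ _ Ha Hst); f_equal; ring.
Qed.

(** * Functions acting on power series *)

(** One base coordinate and two fibre coordinates around the same [y0]: the operator of main
    interest is the divided difference, which takes two points of a fibre. *)
Definition near3 (rho x0 y0 eps : R) (xi al be : R -> R) : Prop :=
  anorm_le rho eps (fun t => xi t - x0) /\ anorm_le rho eps (fun t => al t - y0) /\
  anorm_le rho eps (fun t => be t - y0).

Definition dist3 (rho d : R) (xi al be xi' al' be' : R -> R) : Prop :=
  anorm_le rho d (fun t => xi t - xi' t) /\ anorm_le rho d (fun t => al t - al' t) /\
  anorm_le rho d (fun t => be t - be' t).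

Definition ball3 (x0 y0 eps x y z : R) : Prop :=
  Rabs (x - x0) <= eps /\ Rabs (y - y0) <= eps /\ Rabs (z - y0) <= eps.

(* Substituting power series that stay within [eps] of the centre
   [(x0, y0, y0)] into [Phi] gives a power series of norm at most [M], and the
   substitution is [L]-Lipschitz, at every radius [rho]. *)
Definition op_bound (x0 y0 eps M L : R) (Phi : R -> R -> R -> R) : Prop :=
  forall rho d xi al be xi' al' be', 0 < rho ->
    near3 rho x0 y0 eps xi al be -> near3 rho x0 y0 eps xi' al' be' ->
    dist3 rho d xi al be xi' al' be' ->
    anorm_le rho M (fun t => Phi (xi t) (al t) (be t)) /\
    anorm_le rho (L * d) (fun t => Phi (xi t) (al t) (be t) - Phi (xi' t) (al' t) (be' t)).

Lemma near3_ball3 (rho x0 y0 eps : R) (xi al be : R -> R) (t : R) :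
  near3 rho x0 y0 eps xi al be -> Rabs t < rho -> ball3 x0 y0 eps (xi t) (al t) (be t).
Proof.
  intros [H1 [H2 H3]] Ht; repeat split.
  - exact (anorm_le_val _ _ _ _ H1 Ht).
  - exact (anorm_le_val _ _ _ _ H2 Ht).
  - exact (anorm_le_val _ _ _ _ H3 Ht).
Qed.

Lemma anorm_le_const_le (rho c M : R) :
  0 <= rho -> Rabs c <= M -> anorm_le rho M (fun _ => c).
Proof.
  intros Hr Hc; apply anorm_le_weaken with (1 := Hc); now apply anorm_le_const.
Qed.

Lemma ball3_near3 (rho x0 y0 eps x y z : R) :
  0 < rho -> ball3 x0 y0 eps x y z ->
  near3 rho x0 y0 eps (fun _ => x) (fun _ => y) (fun _ => z).
Proof.
  intros Hr [H1 [H2 H3]]; repeat split; apply anorm_le_const_le; auto; lra.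
Qed.

(** Numbers are constant power series, so the operator bound contains the pointwise one. *)
Lemma op_bound_val (x0 y0 eps M L : R) (Phi : R -> R -> R -> R) (x y z : R) :
  op_bound x0 y0 eps M L Phi -> ball3 x0 y0 eps x y z -> Rabs (Phi x y z) <= M.
Proof.
  intros H Hb.
  destruct (H 1 0 (fun _ => x) (fun _ => y) (fun _ => z)
    (fun _ => x) (fun _ => y) (fun _ => z)) as [H1 _].
  - lra.
  - apply ball3_near3; auto; lra.
  - apply ball3_near3; auto; lra.
  - repeat split; rewrite Rminus_diag; apply anorm_le_const_le; rewrite ?Rabs_R0; lra.
  - apply (anorm_le_val 1 M 0 _ H1); rewrite Rabs_R0; lra.
Qed.

Lemma op_bound_lip (x0 y0 eps M L d : R) (Phi : R -> R -> R -> R) (x y z x' y' z' : R) :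
  op_bound x0 y0 eps M L Phi -> ball3 x0 y0 eps x y z -> ball3 x0 y0 eps x' y' z' ->
  Rabs (x - x') <= d -> Rabs (y - y') <= d -> Rabs (z - z') <= d ->
  Rabs (Phi x y z - Phi x' y' z') <= L * d.
Proof.
  intros H Hb Hb' Hx Hy Hz.
  destruct (H 1 d (fun _ => x) (fun _ => y) (fun _ => z)
    (fun _ => x') (fun _ => y') (fun _ => z')) as [_ H1].
  - lra.
  - apply ball3_near3; auto; lra.
  - apply ball3_near3; auto; lra.
  - repeat split; apply anorm_le_const_le; lra.
  - apply (anorm_le_val 1 _ 0 _ H1); rewrite Rabs_R0; lra.
Qed.

Lemma dist3_nonneg (rho d : R) (xi al be xi' al' be' : R -> R) :
  dist3 rho d xi al be xi' al' be' -> 0 <= d.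
Proof. intros [H _]; exact (anorm_le_nonneg _ _ _ H). Qed.

Lemma op_bound_weaken (x0 y0 eps M M' L L' : R) (Phi : R -> R -> R -> R) :
  M <= M' -> L <= L' -> op_bound x0 y0 eps M L Phi -> op_bound x0 y0 eps M' L' Phi.
Proof.
  intros HM HL H rho d xi al be xi' al' be' Hr Hn Hn' Hd.
  destruct (H rho d _ _ _ _ _ _ Hr Hn Hn' Hd) as [H1 H2].
  pose proof (dist3_nonneg _ _ _ _ _ _ _ _ Hd).
  split; [now apply anorm_le_weaken with M|apply anorm_le_weaken with (L * d); auto].
  now apply Rmult_le_compat_r.
Qed.

Lemma anorm_le_shift (rho e e' c c' : R) (h : R -> R) :
  0 <= rho -> anorm_le rho e (fun t => h t - c) -> e + Rabs (c - c') <= e' ->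
  anorm_le rho e' (fun t => h t - c').
Proof.
  intros Hr H He; apply anorm_le_weaken with (1 := He).
  apply anorm_le_ext with (fun t => (h t - c) + (c - c')); [intros; ring|].
  apply anorm_le_plus; auto; now apply anorm_le_const.
Qed.

Lemma op_bound_recenter (x0 y0 eps M L x1 y1 eps1 : R) (Phi : R -> R -> R -> R) :
  eps1 + Rabs (x1 - x0) <= eps -> eps1 + Rabs (y1 - y0) <= eps ->
  op_bound x0 y0 eps M L Phi -> op_bound x1 y1 eps1 M L Phi.
Proof.
  intros Hx Hy H rho d xi al be xi' al' be' Hr [A1 [A2 A3]] [B1 [B2 B3]] Hd.
  apply H; auto; repeat split; eapply anorm_le_shift; eauto; lra.
Qed.

Lemma op_bound_ext (x0 y0 eps M L : R) (Phi Psi : R -> R -> R -> R) :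
  (forall x y z, ball3 x0 y0 eps x y z -> Phi x y z = Psi x y z) ->
  op_bound x0 y0 eps M L Phi -> op_bound x0 y0 eps M L Psi.
Proof.
  intros He H rho d xi al be xi' al' be' Hr Hn Hn' Hd.
  destruct (H rho d _ _ _ _ _ _ Hr Hn Hn' Hd) as [H1 H2].
  split; (eapply anorm_le_ext; [|eassumption]); intros t Ht; simpl;
    pose proof (near3_ball3 _ _ _ _ _ _ _ _ Hn Ht);
    pose proof (near3_ball3 _ _ _ _ _ _ _ _ Hn' Ht); rewrite ?He; auto.
Qed.

Lemma op_bound_const (x0 y0 eps c : R) : op_bound x0 y0 eps (Rabs c) 0 (fun _ _ _ => c).
Proof.
  intros rho d xi al be xi' al' be' Hr Hn Hn' Hd; split.
  - apply anorm_le_const; lra.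
  - rewrite Rminus_diag; apply anorm_le_const_le; rewrite ?Rabs_R0; lra.
Qed.

Lemma op_bound_coord (x0 y0 eps : R) :
  op_bound x0 y0 eps eps 1 (fun x _ _ => x - x0) /\
  op_bound x0 y0 eps eps 1 (fun _ y _ => y - y0) /\
  op_bound x0 y0 eps eps 1 (fun _ _ z => z - y0).
Proof.
  split; [|split].
  - intros rho d xi al be xi' al' be' Hr [A1 [A2 A3]] _ [D1 [D2 D3]]; split; [exact A1|].
    rewrite Rmult_1_l; eapply anorm_le_ext; [|exact D1]; intros; simpl; ring.
  - intros rho d xi al be xi' al' be' Hr [A1 [A2 A3]] _ [D1 [D2 D3]]; split; [exact A2|].
    rewrite Rmult_1_l; eapply anorm_le_ext; [|exact D2]; intros; simpl; ring.
  - intros rho d xi al be xi' al' be' Hr [A1 [A2 A3]] _ [D1 [D2 D3]]; split; [exact A3|].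
    rewrite Rmult_1_l; eapply anorm_le_ext; [|exact D3]; intros; simpl; ring.
Qed.

Lemma op_bound_plus (x0 y0 eps M L M' L' : R) (Phi Psi : R -> R -> R -> R) :
  op_bound x0 y0 eps M L Phi -> op_bound x0 y0 eps M' L' Psi ->
  op_bound x0 y0 eps (M + M') (L + L') (fun x y z => Phi x y z + Psi x y z).
Proof.
  intros H H' rho d xi al be xi' al' be' Hr Hn Hn' Hd.
  destruct (H rho d _ _ _ _ _ _ Hr Hn Hn' Hd) as [H1 H2].
  destruct (H' rho d _ _ _ _ _ _ Hr Hn Hn' Hd) as [H3 H4].
  split; [apply anorm_le_plus; auto; lra|].
  rewrite Rmult_plus_distr_r.
  eapply anorm_le_ext; [|apply anorm_le_plus; [|exact H2|exact H4]; lra].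
  intros; simpl; ring.
Qed.

Lemma dist3_refl (rho d : R) (xi al be : R -> R) :
  0 < rho -> 0 <= d -> dist3 rho d xi al be xi al be.
Proof.
  intros Hr Hd; repeat split; (apply anorm_le_ext with (fun _ => 0);
    [intros; ring | apply anorm_le_const_le; rewrite ?Rabs_R0; lra]).
Qed.

Lemma op_bound_mult (x0 y0 eps M L M' L' : R) (Phi Psi : R -> R -> R -> R) :
  op_bound x0 y0 eps M L Phi -> op_bound x0 y0 eps M' L' Psi ->
  op_bound x0 y0 eps (M * M') (M * L' + L * M') (fun x y z => Phi x y z * Psi x y z).
Proof.
  intros H H' rho d xi al be xi' al' be' Hr Hn Hn' Hd.
  destruct (H rho d _ _ _ _ _ _ Hr Hn Hn' Hd) as [H1 H2].
  destruct (H' rho d _ _ _ _ _ _ Hr Hn Hn' Hd) as [H3 H4].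
  assert (Hd' := dist3_refl rho d xi' al' be' Hr (dist3_nonneg _ _ _ _ _ _ _ _ Hd)).
  destruct (H' rho d _ _ _ _ _ _ Hr Hn' Hn' Hd') as [H5 _].
  split; [apply anorm_le_mult; auto; lra|].
  replace ((M * L' + L * M') * d) with (M * (L' * d) + (L * d) * M') by ring.
  eapply anorm_le_ext; [|apply anorm_le_plus; [lra| |]].
  2: apply anorm_le_mult; [lra|exact H1|exact H4].
  2: apply anorm_le_mult; [lra|exact H2|exact H5].
  intros; simpl; ring.
Qed.

Lemma op_bound_scal (x0 y0 eps M L c : R) (Phi : R -> R -> R -> R) :
  op_bound x0 y0 eps M L Phi ->
  op_bound x0 y0 eps (Rabs c * M) (Rabs c * L) (fun x y z => c * Phi x y z).
Proof.
  intros H; eapply op_bound_weaken.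
  3: exact (op_bound_mult _ _ _ _ _ _ _ _ _ (op_bound_const x0 y0 eps c) H).
  all: lra.
Qed.

Lemma op_bound_lim (x0 y0 eps M L : R) (Phi : nat -> R -> R -> R -> R)
  (Psi : R -> R -> R -> R) :
  (forall n, op_bound x0 y0 eps M L (Phi n)) ->
  (forall x y z, ball3 x0 y0 eps x y z ->
     is_lim_seq (fun n => Phi n x y z) (Psi x y z)) ->
  op_bound x0 y0 eps M L Psi.
Proof.
  intros H Hlim rho d xi al be xi' al' be' Hr Hn Hn' Hd; split.
  - apply anorm_le_lim with (fun n t => Phi n (xi t) (al t) (be t)); [exact Hr| |].
    + intros n; apply (H n rho d _ _ _ _ _ _ Hr Hn Hn' Hd).
    + intros t Ht; apply Hlim; now apply (near3_ball3 rho).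
  - apply anorm_le_lim with
      (fun n t => Phi n (xi t) (al t) (be t) - Phi n (xi' t) (al' t) (be' t)); [exact Hr| |].
    + intros n; apply (H n rho d _ _ _ _ _ _ Hr Hn Hn' Hd).
    + intros t Ht; apply is_lim_seq_minus'; apply Hlim; now apply (near3_ball3 rho).
Qed.

Lemma op_bound_series (x0 y0 eps B : R) (A : nat -> R)
  (Phi : nat -> R -> R -> R -> R) (Psi : R -> R -> R -> R) :
  (forall n, op_bound x0 y0 eps (A n) (A n) (Phi n)) ->
  (forall n, sum_n A n <= B) ->
  (forall x y z, ball3 x0 y0 eps x y z -> is_series (fun n => Phi n x y z) (Psi x y z)) ->
  op_bound x0 y0 eps B B Psi.
Proof.
  intros H HB Hs.
  apply op_bound_lim with (fun n x y z => sum_n (fun k => Phi k x y z) n).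
  2: exact Hs.
  intros n; apply op_bound_weaken with (sum_n A n) (sum_n A n); auto.
  induction n as [|n IH].
  - rewrite sum_O; apply op_bound_ext with (2 := H 0%nat); intros; now rewrite sum_O.
  - rewrite sum_Sn; eapply op_bound_ext.
    2: exact (op_bound_plus _ _ _ _ _ _ _ _ _ IH (H (S n))).
    intros; simpl; now rewrite sum_Sn.
Qed.

Lemma sum_n_le_Series (A : nat -> R) (n : nat) :
  (forall k, 0 <= A k) -> ex_series A -> sum_n A n <= Series A.
Proof.
  intros HA Hex; apply Series_correct in Hex.
  apply (is_lim_seq_incr_compare (sum_n A)); [exact Hex|].
  intros k; rewrite sum_Sn; change (Hierarchy.plus ?x ?y) with (x + y).
  specialize (HA (S k)); lra.
Qed.

Lemma op_bound_double_series (x0 y0 eps : R) (A : nat -> nat -> R)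
  (Phi : nat -> nat -> R -> R -> R -> R) :
  (forall m n, 0 <= A m n) ->
  (forall m n, op_bound x0 y0 eps (A m n) (A m n) (Phi m n)) ->
  (forall m, ex_series (A m)) -> ex_series (fun m => Series (A m)) ->
  exists B, op_bound x0 y0 eps B B
    (fun x y z => Series (fun m => Series (fun n => Phi m n x y z))).
Proof.
  intros HA H Hex1 Hex2; exists (Series (fun m => Series (A m))).
  assert (Hpos : forall m, 0 <= Series (A m)).
  { intros m; apply Rle_trans with (sum_n (A m) 0); [rewrite sum_O; auto|].
    now apply sum_n_le_Series. }
  assert (Hin : forall m, op_bound x0 y0 eps (Series (A m)) (Series (A m))
    (fun x y z => Series (fun n => Phi m n x y z))).
  { intros m; apply op_bound_series with (A := A m) (Phi := Phi m); auto.
    { intros n; now apply sum_n_le_Series. }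
    intros x y z Hb; apply Series_correct.
    apply (ex_series_le (K := R_AbsRing) (V := R_CompleteNormedModule) _ (A m)).
    - intros n; exact (op_bound_val _ _ _ _ _ _ _ _ _ (H m n) Hb).
    - auto. }
  apply op_bound_series with (1 := Hin).
  { intros n; now apply (sum_n_le_Series (fun m => Series (A m))). }
  intros x y z Hb; apply Series_correct.
  apply (ex_series_le (K := R_AbsRing) (V := R_CompleteNormedModule) _ (fun m => Series (A m))).
  - intros m; exact (op_bound_val _ _ _ _ _ _ _ _ _ (Hin m) Hb).
  - auto.
Qed.

(** The natural Lipschitz constant [n * eps ^ (n - 1)] is replaced by [/ eps * (2 * eps) ^ n], a
    geometric bound that reproduces itself under the product rule. *)
Lemma op_bound_pow (x0 y0 eps : R) (Phi : R -> R -> R -> R) (n : nat) :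
  0 < eps -> op_bound x0 y0 eps eps 1 Phi ->
  op_bound x0 y0 eps (eps ^ n) (/ eps * (2 * eps) ^ n) (fun x y z => Phi x y z ^ n).
Proof.
  intros He H; induction n as [|n IH].
  - simpl; eapply op_bound_weaken; [| |apply op_bound_const].
    + rewrite Rabs_R1; lra.
    + pose proof (Rinv_0_lt_compat _ He); lra.
  - simpl; eapply op_bound_weaken; [| |exact (op_bound_mult _ _ _ _ _ _ _ _ _ H IH)]; [lra|].
    assert (eps ^ n <= (2 * eps) ^ n) by (apply pow_incr; lra).
    replace (eps * (/ eps * (2 * eps) ^ n)) with ((2 * eps) ^ n) by (field; lra).
    replace (/ eps * (2 * eps * (2 * eps) ^ n)) with (2 * (2 * eps) ^ n) by (field; lra).
    lra.
Qed.

(** The quotient of [y ^ n - z ^ n] by [y - z] as a polynomial, hence meaningful on the diagonal as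
    well. *)
Fixpoint pow_secant (n : nat) (y z : R) : R :=
  match n with O => 0 | S n => y ^ n + z * pow_secant n y z end.

Lemma pow_secant_spec (n : nat) (y z : R) : y ^ n - z ^ n = pow_secant n y z * (y - z).
Proof.
  induction n as [|n IH]; simpl; [ring|].
  replace ((y ^ n + z * pow_secant n y z) * (y - z))
    with (y ^ n * (y - z) + z * (pow_secant n y z * (y - z))) by ring.
  rewrite <- IH; ring.
Qed.

Lemma op_bound_pow_secant (x0 y0 eps : R) (n : nat) : 0 < eps ->
  op_bound x0 y0 eps (/ eps * (2 * eps) ^ n) (/ eps * / eps * (4 * eps) ^ n)
    (fun _ y z => pow_secant n (y - y0) (z - y0)).
Proof.
  intros He; pose proof (Rinv_0_lt_compat _ He) as He'.
  destruct (op_bound_coord x0 y0 eps) as [_ [Hy Hz]].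
  induction n as [|n IH].
  - simpl; eapply op_bound_weaken; [| |apply op_bound_const]; rewrite ?Rabs_R0; nra.
  - simpl; eapply op_bound_weaken; [| |apply op_bound_plus;
      [exact (op_bound_pow _ _ _ _ n He Hy)|exact (op_bound_mult _ _ _ _ _ _ _ _ _ Hz IH)]].
    + assert (eps ^ n <= (2 * eps) ^ n) by (apply pow_incr; lra).
      replace (eps * (/ eps * (2 * eps) ^ n)) with ((2 * eps) ^ n) by (field; lra).
      replace (/ eps * (2 * eps * (2 * eps) ^ n)) with (2 * (2 * eps) ^ n) by (field; lra).
      lra.
    + assert ((2 * eps) ^ n <= (4 * eps) ^ n) by (apply pow_incr; lra).
      assert (0 <= (2 * eps) ^ n) by (apply pow_le; lra).
      replace (eps * (/ eps * / eps * (4 * eps) ^ n)) with (/ eps * (4 * eps) ^ n) by (field; lra).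
      replace (/ eps * / eps * (4 * eps * (4 * eps) ^ n)) with (/ eps * (4 * (4 * eps) ^ n))
        by (field; lra).
      rewrite Rmult_1_l, <- !Rmult_plus_distr_l.
      apply Rmult_le_compat_l; lra.
Qed.

(** The divided difference is taken termwise in the double power series, which shows that it is
    analytic across the diagonal. *)
Lemma analytic2_secant (h : R -> R -> R) (x0 y0 : R) :
  analytic2_at h x0 y0 ->
  exists (eps L : R) (s : R -> R -> R -> R), 0 < eps /\ 0 <= L /\
    op_bound x0 y0 eps L L s /\ op_bound x0 y0 eps L L (fun x y _ => h x y) /\
    forall x y z, ball3 x0 y0 eps x y z -> h x y - h x z = s x y z * (y - z).
Proof.
  intros [a [r Ha]]; pose proof (cond_pos r) as Hr.
  (* The bounds for [pow_secant] grow like [(4 * eps) ^ n]; with [eps = r / 8] their ratio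
     [q = r / 2] lies inside the domain of absolute convergence. *)
  set (eps := r / 8); assert (He : 0 < eps) by (unfold eps; lra).
  set (q := 4 * eps); assert (Hq : 0 < q < r) by (unfold q, eps; lra).
  pose proof (Rinv_0_lt_compat _ He) as He'.
  set (A0 := fun m n => Rabs (a m n) * (q ^ m * q ^ n)).
  assert (HA0 : (forall m, ex_series (A0 m)) /\ ex_series (fun m => Series (A0 m))).
  { destruct (Ha (x0 + q) (y0 + q)) as [H1 [H2 _]];
      try (replace (x0 + q - x0) with q by ring);
      try (replace (y0 + q - y0) with q by ring); try (rewrite Rabs_pos_eq; lra).
    assert (E : forall m n, A0 m n = Rabs (a m n * (x0 + q - x0) ^ m * (y0 + q - y0) ^ n)).
    { intros m n; replace (x0 + q - x0) with q by ring; replace (y0 + q - y0) with q by ring.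
      unfold A0; rewrite !Rabs_mult, (Rabs_pos_eq (q ^ m)), (Rabs_pos_eq (q ^ n));
        try (apply pow_le; lra); ring. }
    split.
    - intros m; apply ex_series_ext with (2 := H1 m); intros n; symmetry; apply E.
    - apply ex_series_ext with (2 := H2); intros m; apply Series_ext; intros n.
      symmetry; apply E. }
  destruct HA0 as [HA1 HA2].
  set (K := 1 + / eps + / eps * / eps).
  assert (HK : 1 <= K /\ / eps <= K /\ / eps * / eps <= K)
    by (unfold K; pose proof (Rmult_lt_0_compat _ _ He' He'); lra).
  assert (HA0p : forall m n, 0 <= A0 m n).
  { intros m n; apply Rmult_le_pos; [apply Rabs_pos|];
      apply Rmult_le_pos; apply pow_le; lra. }
  set (A := fun m n => 2 * K * K * A0 m n).
  assert (HAex1 : forall m, ex_series (A m)) by 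
    (intros m; exact (ex_series_scal (2 * K * K) (A0 m) (HA1 m))).
  assert (HAex2 : ex_series (fun m => Series (A m))).
  { apply ex_series_ext with (fun m => 2 * K * K * Series (A0 m)).
    - intros m; unfold A; now rewrite Series_scal_l.
    - exact (ex_series_scal (2 * K * K) _ HA2). }
  assert (HAp : forall m n, 0 <= A m n).
  { intros m n; unfold A; specialize (HA0p m n); apply Rmult_le_pos; [nra|auto]. }
  destruct (op_bound_coord x0 y0 eps) as [Hx [Hy Hz]].
  assert (Hpow : forall Phi n, op_bound x0 y0 eps eps 1 Phi ->
    op_bound x0 y0 eps (K * q ^ n) (K * q ^ n) (fun x y z => Phi x y z ^ n)).
  { intros Phi n HP; eapply op_bound_weaken; [| |exact (op_bound_pow _ _ _ _ n He HP)].
    - assert (eps ^ n <= q ^ n) by (apply pow_incr; unfold q; lra).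
      assert (0 <= q ^ n) by (apply pow_le; lra). nra.
    - apply Rmult_le_compat; [lra|apply pow_le; lra|lra|apply pow_incr; unfold q; lra]. }
  assert (Hh : forall n, op_bound x0 y0 eps (K * q ^ n) (K * q ^ n)
    (fun _ y z => pow_secant n (y - y0) (z - y0))).
  { intros n; eapply op_bound_weaken; [| |exact (op_bound_pow_secant x0 y0 eps n He)].
    - apply Rmult_le_compat; [lra|apply pow_le; lra|lra|apply pow_incr; unfold q; lra].
    - fold q; apply Rmult_le_compat_r; [apply pow_le; lra|lra]. }
  assert (Hterm : forall m n Phi,
    op_bound x0 y0 eps (K * q ^ n) (K * q ^ n) Phi ->
    op_bound x0 y0 eps (A m n) (A m n)
      (fun x y z => a m n * ((x - x0) ^ m * Phi x y z))).
  { intros m n Phi HP; eapply op_bound_weaken.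
    3: exact (op_bound_scal _ _ _ _ _ (a m n) _
         (op_bound_mult _ _ _ _ _ _ _ _ _ (Hpow _ m Hx) HP)).
    - unfold A; specialize (HA0p m n).
      apply Rle_trans with (K * K * A0 m n); [unfold A0; right; ring|].
      apply Rmult_le_compat_r; [auto|nra].
    - unfold A, A0; right; ring. }
  destruct (op_bound_double_series x0 y0 eps A
    (fun m n x y z => a m n * ((x - x0) ^ m * pow_secant n (y - y0) (z - y0))) HAp
    (fun m n => Hterm m n _ (Hh n)) HAex1 HAex2) as [B1 HB1].
  destruct (op_bound_double_series x0 y0 eps A
    (fun m n x y z => a m n * ((x - x0) ^ m * (y - y0) ^ n)) HAp
    (fun m n => Hterm m n _ (Hpow _ n Hy)) HAex1 HAex2) as [B2 HB2].
  set (s := fun x y z => Series (fun m => Series (fun n =>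
    a m n * ((x - x0) ^ m * pow_secant n (y - y0) (z - y0))))).
  fold s in HB1.
  assert (Hval : forall x y, Rabs (x - x0) <= eps -> Rabs (y - y0) <= eps ->
    (forall m, ex_series (fun n => a m n * ((x - x0) ^ m * (y - y0) ^ n))) /\
    is_series (fun m => Series (fun n => a m n * ((x - x0) ^ m * (y - y0) ^ n))) (h x y)).
  { intros x y Hx' Hy'.
    destruct (Ha x y) as [H1 [_ H3]]; try (unfold q in Hq; lra).
    split.
    - intros m; apply ex_series_ext with (fun n => a m n * (x - x0) ^ m * (y - y0) ^ n).
      + intros n; ring_R.
      + apply ex_series_Rabs, H1.
    - apply is_series_ext with (2 := H3); intros m; apply Series_ext; intros n; ring_R. }
  exists eps, (Rmax 0 (Rmax B1 B2)), s.
  split; [exact He|split; [apply Rmax_l|split; [|split]]].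
  - apply op_bound_weaken with (3 := HB1);
      (eapply Rle_trans; [apply Rmax_l|apply Rmax_r]).
  - apply op_bound_weaken with B2 B2;
      try (eapply Rle_trans; [apply Rmax_r|apply Rmax_r]).
    apply op_bound_ext with (2 := HB2); intros x y z [H1 [H2 _]].
    apply is_series_unique, (Hval x y H1 H2).
  - intros x y z [H1 [H2 H3]].
    destruct (Hval x y H1 H2) as [E1 S1]; destruct (Hval x z H1 H3) as [E2 S2].
    rewrite <- (is_series_unique _ _ S1), <- (is_series_unique _ _ S2).
    rewrite <- Series_minus by (eexists; eassumption).
    unfold s; rewrite <- Series_scal_r; apply Series_ext; intros m.
    rewrite <- Series_minus by auto; rewrite <- Series_scal_r; apply Series_ext; intros n.
    replace (y - z) with ((y - y0) - (z - y0)) by ring.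
    rewrite !Rmult_assoc, <- pow_secant_spec; ring.
Qed.

(** Compactness of an interval by a supremum argument. The index [n] measures the quality of all
    constants at once; monotonicity lets the sum of two indices serve where each of them did. *)
Lemma compact_uniform (a b : R) (P : R -> nat -> Prop) :
  (forall x n m, (n <= m)%nat -> P x n -> P x m) ->
  (forall x, a <= x <= b -> exists n d, 0 < d /\
     forall y, a <= y <= b -> Rabs (y - x) < d -> P y n) ->
  exists n, forall x, a <= x <= b -> P x n.
Proof.
  intros Hmono Hloc.
  destruct (Rle_lt_dec a b) as [Hab|Hab]; [|exists 0%nat; intros x Hx; lra].
  set (E := fun c => a <= c <= b /\ exists n, forall x, a <= x <= c -> P x n).
  assert (HEa : E a).
  { split; [lra|]; destruct (Hloc a) as [n [d [Hd H]]]; [lra|].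
    exists n; intros x Hx; apply H; [lra|]; replace x with a by lra.
    rewrite Rminus_diag, Rabs_R0; exact Hd. }
  destruct (completeness E) as [m [Hub Hlub]].
  { exists b; intros c [Hc _]; lra. }
  { now exists a. }
  assert (Hm : a <= m <= b).
  { split; [now apply Hub|apply Hlub; intros c [Hc _]; lra]. }
  destruct (Hloc m Hm) as [n1 [d [Hd H1]]].
  assert (Hc : exists c, E c /\ m - d < c).
  { apply NNPP; intros Hn; assert (m <= m - d); [|lra].
    apply Hlub; intros c Hc; apply Rnot_lt_le; intros Hlt; apply Hn; now exists c. }
  destruct Hc as [c [[Hc [n2 H2]] Hcm]].
  assert (Hcm' : c <= m) by (apply Hub; split; [auto|now exists n2]).
  assert (Hext : forall x, a <= x <= b -> x < m + d -> P x (n1 + n2)%nat).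
  { intros x Hx Hxm; destruct (Rle_lt_dec x c) as [Hxc|Hxc].
    - apply Hmono with n2; [lia|apply H2; lra].
    - apply Hmono with n1; [lia|apply H1; [lra|]]; apply Rabs_def1; lra. }
  destruct (Rle_lt_dec b (m + d / 2)) as [Hb|Hb].
  - exists (n1 + n2)%nat; intros x Hx; apply Hext; lra.
  - exfalso; assert (m + d / 2 <= m); [|lra].
    apply Hub; split; [lra|]; exists (n1 + n2)%nat; intros x Hx; apply Hext; lra.
Qed.

(** * Divided differences *)

Definition secant (h : R -> R -> R) (x y z : R) : R :=
  if Req_EM_T y z then Derive (h x) y else (h x y - h x z) / (y - z).

Lemma secant_spec (h : R -> R -> R) (x y z : R) :
  h x y - h x z = secant h x y z * (y - z).
Proof.
  unfold secant; destruct (Req_EM_T y z) as [->|Hyz]; [ring|field; lra].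
Qed.

Lemma secant_diag (h : R -> R -> R) (x y : R) : secant h x y y = Derive (h x) y.
Proof. unfold secant; destruct (Req_EM_T y y); [reflexivity|easy]. Qed.

(** Comparing with the constant series at the centre costs only [L * e]. On a small ball the norm of
    the divided difference is thus nearly the absolute value of the derivative, which is below 1. *)
Lemma op_bound_shrink (x0 y0 eps M L e : R) (Phi : R -> R -> R -> R) :
  0 <= e <= eps -> op_bound x0 y0 eps M L Phi ->
  op_bound x0 y0 e (Rabs (Phi x0 y0 y0) + L * e) L Phi.
Proof.
  intros He H.
  assert (H' : op_bound x0 y0 e M L Phi).
  { apply op_bound_recenter with (3 := H); rewrite Rminus_diag, Rabs_R0; lra. }
  intros rho d xi al be xi' al' be' Hr Hn Hn' Hd; split.
  - assert (Hc : near3 rho x0 y0 e (fun _ => x0) (fun _ => y0) (fun _ => y0)).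
    { apply ball3_near3; [exact Hr|]; unfold ball3; rewrite !Rminus_diag, Rabs_R0; lra. }
    destruct (H' rho e _ _ _ _ _ _ Hr Hn Hc Hn) as [_ H1].
    eapply anorm_le_ext; [|apply anorm_le_plus; [|apply anorm_le_const|exact H1]; lra].
    intros; simpl; ring.
  - apply (H' rho d _ _ _ _ _ _ Hr Hn Hn' Hd).
Qed.

Lemma is_derive_secant_lim (f : R -> R) (y l L d0 : R) :
  0 < d0 -> 0 <= L ->
  (forall u, Rabs u < d0 -> exists s, f (y + u) - f y = s * u /\ Rabs (s - l) <= L * Rabs u) ->
  is_derive f y l.
Proof.
  intros Hd0 HL H; apply is_derive_Reals; intros e He.
  assert (Hd : 0 < Rmin d0 (e / (L + 1))).
  { apply Rmin_pos; [lra|apply Rdiv_lt_0_compat; lra]. }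
  exists (mkposreal _ Hd); intros u Hu0 Hu; simpl in Hu.
  destruct (H u) as [s [E1 E2]].
  { eapply Rlt_le_trans; [exact Hu|apply Rmin_l]. }
  rewrite E1; replace (s * u / u) with s by (field; auto).
  eapply Rle_lt_trans; [exact E2|].
  assert (Hu2 : Rabs u < e / (L + 1)) by (eapply Rlt_le_trans; [exact Hu|apply Rmin_r]).
  apply Rmult_lt_compat_r with (r := L + 1) in Hu2; [|lra].
  replace (e / (L + 1) * (L + 1)) with e in Hu2 by (field; lra).
  pose proof (Rabs_pos_lt u Hu0); nra.
Qed.

(** The analytic [s] agrees with [secant] off the diagonal by division, and on it because the
    Lipschitz bound identifies [s x y y] with the derivative. Halving the radius leaves room for
    increments. *)
Lemma secant_local (h : R -> R -> R) (x0 y0 : R) :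
  analytic2_at h x0 y0 ->
  exists eps L, 0 < eps /\ 0 <= L /\
    op_bound x0 y0 eps L L (secant h) /\ op_bound x0 y0 eps L L (fun x y _ => h x y) /\
    forall x y, Rabs (x - x0) <= eps -> Rabs (y - y0) <= eps ->
      is_derive (h x) y (secant h x y y).
Proof.
  intros Han.
  destruct (analytic2_secant h x0 y0 Han) as [eps [L [s [He [HL [Hs [Hh Heq]]]]]]].
  assert (Hd : forall x y, Rabs (x - x0) <= eps / 2 -> Rabs (y - y0) <= eps / 2 ->
    is_derive (h x) y (s x y y)).
  { intros x y Hx Hy; apply is_derive_secant_lim with L (eps / 2); [lra|exact HL|].
    intros u Hu; exists (s x (y + u) y).
    assert (Hb : ball3 x0 y0 eps x (y + u) y).
    { repeat split; try lra; replace (y + u - y0) with ((y - y0) + u) by ring.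
      pose proof (Rabs_triang (y - y0) u); lra. }
    split.
    - rewrite (Heq _ _ _ Hb); f_equal; ring.
    - apply (op_bound_lip x0 y0 eps L L (Rabs u) s); auto.
      + repeat split; lra.
      + rewrite Rminus_diag, Rabs_R0; apply Rabs_pos.
      + replace (y + u - y) with u by ring; lra.
      + rewrite Rminus_diag, Rabs_R0; apply Rabs_pos. }
  assert (Hsec : forall x y z, ball3 x0 y0 (eps / 2) x y z -> s x y z = secant h x y z).
  { intros x y z [Hx [Hy Hz]]; unfold secant; destruct (Req_EM_T y z) as [<-|Hyz].
    - symmetry; apply is_derive_unique; auto.
    - rewrite (Heq x y z) by (repeat split; lra); field; lra. }
  exists (eps / 2), L; split; [lra|split; [lra|split; [|split]]].
  - apply op_bound_ext with (1 := Hsec).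
    apply op_bound_recenter with (3 := Hs); rewrite Rminus_diag, Rabs_R0; lra.
  - apply op_bound_recenter with (3 := Hh); rewrite Rminus_diag, Rabs_R0; lra.
  - intros x y Hx Hy; rewrite <- Hsec by (repeat split; auto); auto.
Qed.

Lemma exists_inv_le (e : R) : 0 < e -> exists n : nat, / (INR n + 1) <= e.
Proof.
  intros He; destruct (archimed_cor1 e He) as [n [Hn Hn0]]; exists n.
  left; eapply Rle_lt_trans; [|exact Hn].
  apply Rinv_le_contravar; [now apply lt_0_INR|lra].
Qed.

Lemma inv_INR_pos (n : nat) : 0 < / (INR n + 1).
Proof. apply Rinv_0_lt_compat; pose proof (pos_INR n); lra. Qed.

Lemma inv_INR_decr (n m : nat) : (n <= m)%nat -> / (INR m + 1) <= / (INR n + 1).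
Proof.
  intros H; apply Rinv_le_contravar; [pose proof (pos_INR n); lra|].
  apply le_INR in H; lra.
Qed.

Lemma compact_uniform2 (a b c d : R) (P : R -> R -> nat -> Prop) :
  (forall x y n m, (n <= m)%nat -> P x y n -> P x y m) ->
  (forall x y, a <= x <= b -> c <= y <= d -> exists n e, 0 < e /\
     forall x' y', a <= x' <= b -> c <= y' <= d ->
       Rabs (x' - x) < e -> Rabs (y' - y) < e -> P x' y' n) ->
  exists n, forall x y, a <= x <= b -> c <= y <= d -> P x y n.
Proof.
  intros Hmono Hloc.
  destruct (compact_uniform a b (fun x n => forall y, c <= y <= d -> P x y n)) as [n Hn].
  - intros x n m Hnm H y Hy; apply Hmono with n; auto.
  - intros x Hx.
    (* As in the tube lemma, the inner property carries a neighbourhood of [x] whose width depends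
       on the same index. *)
    destruct (compact_uniform c d (fun y n => forall x', a <= x' <= b ->
      Rabs (x' - x) < / (INR n + 1) -> P x' y n)) as [n Hn].
    + intros y n m Hnm H x' Hx' Hd; apply Hmono with n; auto; apply H; auto.
      pose proof (inv_INR_decr n m Hnm); lra.
    + intros y Hy; destruct (Hloc x y Hx Hy) as [n [e [He H]]].
      destruct (exists_inv_le e He) as [n' Hn'].
      exists (n + n')%nat, e; split; [exact He|]; intros y' Hy' Hd x' Hx' Hd'.
      apply Hmono with n; [lia|]; apply H; auto.
      pose proof (inv_INR_decr n' (n + n') ltac:(lia)); lra.
    + exists n, (/ (INR n + 1)); split; [apply inv_INR_pos|]; intros y Hy Hd z Hz.
      now apply Hn.
  - exists n; intros; now apply Hn.
Qed.

(** The number [lam] bounds the norm of the divided difference and not just its values, so that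
    multiplying by it contracts norms; [r] keeps it away from 0, which allows relative errors and
    logarithms. *)
Definition good_secant (h : R -> R -> R) (eps L lam r x0 y0 : R) : Prop :=
  op_bound x0 y0 eps lam L (secant h) /\ op_bound x0 y0 eps L L (fun x y _ => h x y) /\
  (forall x y z, ball3 x0 y0 eps x y z -> r <= Rabs (secant h x y z)) /\
  (forall x y, Rabs (x - x0) <= eps -> Rabs (y - y0) <= eps ->
     is_derive (h x) y (secant h x y y)).

Lemma good_secant_mono (h : R -> R -> R) (eps L lam r eps' L' lam' r' x0 y0 x1 y1 : R) :
  eps' + Rabs (x1 - x0) <= eps -> eps' + Rabs (y1 - y0) <= eps ->
  L <= L' -> lam <= lam' -> r' <= r ->
  good_secant h eps L lam r x0 y0 -> good_secant h eps' L' lam' r' x1 y1.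
Proof.
  intros Hx Hy HL Hlam Hr [H1 [H2 [H3 H4]]].
  assert (Hb : forall u v w, Rabs (u - v) <= eps' -> eps' + Rabs (v - w) <= eps ->
    Rabs (u - w) <= eps).
  { intros u v w Hu Hv; replace (u - w) with ((u - v) + (v - w)) by ring.
    pose proof (Rabs_triang (u - v) (v - w)); lra. }
  split; [|split; [|split]].
  - apply op_bound_weaken with (3 := op_bound_recenter _ _ _ _ _ _ _ _ _ Hx Hy H1); auto.
  - apply op_bound_weaken with (3 := op_bound_recenter _ _ _ _ _ _ _ _ _ Hx Hy H2); auto.
  - intros x y z [B1 [B2 B3]]; eapply Rle_trans; [exact Hr|].
    apply H3; repeat split; eauto.
  - intros x y B1 B2; apply H4; eauto.
Qed.

Lemma good_secant_local (h : R -> R -> R) (x0 y0 : R) :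
  analytic2_at h x0 y0 -> 0 < Rabs (Derive (h x0) y0) < 1 ->
  exists n, good_secant h (2 * / (INR n + 1)) (INR n) (1 - / (INR n + 1))
    (/ (INR n + 1)) x0 y0.
Proof.
  intros Han Hd.
  destruct (secant_local h x0 y0 Han) as [eps [L [He [HL [H1 [H2 H3]]]]]].
  set (gam := Rabs (Derive (h x0) y0)) in *.
  (* With [e = / (INR n + 1)], the four indices give in turn [2 * e <= eps],
     [gam + 2 * L * e <= 1 - e], [gam - 2 * L * e >= e] and [L <= INR n]. The ball has radius
     [2 * e] so that nearby centres retain a ball of radius [e]. *)
  destruct (exists_inv_le (eps / 2)) as [n1 Hn1]; [lra|].
  destruct (exists_inv_le ((1 - gam) / (2 * L + 1))) as [n2 Hn2];
    [apply Rdiv_lt_0_compat; lra|].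
  destruct (exists_inv_le (gam / (2 * L + 1))) as [n3 Hn3];
    [apply Rdiv_lt_0_compat; lra|].
  destruct (INR_unbounded L) as [n4 Hn4].
  set (n := (n1 + n2 + n3 + n4)%nat); exists n.
  pose proof (inv_INR_decr n1 n ltac:(lia)) as D1.
  pose proof (inv_INR_decr n2 n ltac:(lia)) as D2.
  pose proof (inv_INR_decr n3 n ltac:(lia)) as D3.
  pose proof (le_INR n4 n ltac:(lia)) as D4.
  pose proof (inv_INR_pos n) as Hp; set (e := / (INR n + 1)) in *.
  assert (C2 : e * (2 * L + 1) <= 1 - gam).
  { replace (1 - gam) with ((1 - gam) / (2 * L + 1) * (2 * L + 1)) by (field; lra).
    apply Rmult_le_compat_r; lra. }
  assert (C3 : e * (2 * L + 1) <= gam).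
  { replace gam with (gam / (2 * L + 1) * (2 * L + 1)) by (field; lra).
    apply Rmult_le_compat_r; lra. }
  assert (E : 0 <= 2 * e <= eps) by lra.
  split; [|split; [|split]].
  - apply op_bound_weaken with (3 := op_bound_shrink _ _ _ _ _ _ _ E H1).
    + rewrite secant_diag; fold gam; lra.
    + lra.
  - apply op_bound_weaken with L L; try lra.
    apply op_bound_recenter with (3 := H2); rewrite Rminus_diag, Rabs_R0; lra.
  - intros x y z Hb.
    assert (Hlip : Rabs (secant h x y z - secant h x0 y0 y0) <= L * (2 * e)).
    { destruct Hb as [B1 [B2 B3]].
      apply (op_bound_lip x0 y0 eps L L); auto; repeat split;
        rewrite ?Rminus_diag, ?Rabs_R0; lra. }
    rewrite secant_diag in Hlip.
    pose proof (Rabs_triang (secant h x y z) (Derive (h x0) y0 - secant h x y z)) as T.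
    replace (secant h x y z + (Derive (h x0) y0 - secant h x y z))
      with (Derive (h x0) y0) in T by ring.
    rewrite Rabs_minus_sym in Hlip; fold gam in T; lra.
  - intros x y Hx Hy; apply H3; lra.
Qed.

Lemma op_bound_translate (x0 y0 eps M L q : R) (Phi : R -> R -> R -> R) :
  (forall x y z, Phi (x + q) y z = Phi x y z) ->
  op_bound x0 y0 eps M L Phi -> op_bound (x0 + q) y0 eps M L Phi.
Proof.
  intros Hq H rho d xi al be xi' al' be' Hr [A1 [A2 A3]] [B1 [B2 B3]] [D1 [D2 D3]].
  destruct (H rho d (fun t => xi t - q) al be (fun t => xi' t - q) al' be' Hr) as [H1 H2].
  - repeat split; auto; eapply anorm_le_ext; [|exact A1]; intros; simpl; ring.
  - repeat split; auto; eapply anorm_le_ext; [|exact B1]; intros; simpl; ring.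
  - repeat split; auto; eapply anorm_le_ext; [|exact D1]; intros; simpl; ring.
  - assert (E : forall x y z, Phi (x - q) y z = Phi x y z).
    { intros x y z; rewrite <- Hq; f_equal; ring. }
    split; (eapply anorm_le_ext; [|eassumption]); intros; simpl; now rewrite ?E.
Qed.

Lemma good_secant_uniform (h : R -> R -> R) :
  (forall x (q : Z) y, h (x + IZR q) y = h x y) ->
  (forall x y, in_U y -> analytic2_at h x y) ->
  (forall x y, in_U y -> 0 < Rabs (Derive (h x) y) < 1) ->
  exists eps L lam r, 0 < eps /\ 0 <= L /\ 0 < lam < 1 /\ 0 < r /\
    forall x y, in_U y -> good_secant h eps L lam r x y.
Proof.
  intros Hper Han Hd.
  destruct (compact_uniform2 0 1 (-1) 1 (fun x y n =>
    good_secant h (/ (INR n + 1)) (INR n) (1 - / (INR n + 1)) (/ (INR n + 1)) x y))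
    as [n Hn].
  - intros x y n m Hnm H; pose proof (inv_INR_decr n m Hnm); apply le_INR in Hnm.
    apply good_secant_mono with (6 := H); rewrite ?Rminus_diag, ?Rabs_R0; lra.
  - intros x y Hx Hy.
    destruct (good_secant_local h x y (Han x y Hy) (Hd x y Hy)) as [n Hn].
    exists n, (/ (INR n + 1)); split; [apply inv_INR_pos|].
    intros x' y' _ _ Hx' Hy'; apply good_secant_mono with (6 := Hn); lra.
  (* Passing to [S n] ensures [lam > 0], which would fail for the index 0. *)
  - pose proof (inv_INR_pos (S n)) as Hp.
    pose proof (inv_INR_decr n (S n) ltac:(lia)) as Hle.
    pose proof (le_INR n (S n) ltac:(lia)) as Hle'.
    exists (/ (INR (S n) + 1)), (INR (S n)), (1 - / (INR (S n) + 1)), (/ (INR (S n) + 1)).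
    split; [exact Hp|split; [apply pos_INR|split; [split|split; [exact Hp|]]]].
    + rewrite S_INR in *; pose proof (pos_INR n).
      assert (/ (INR n + 1 + 1) < 1); [|lra].
      rewrite <- Rinv_1; apply Rinv_lt_contravar; lra.
    + lra.
    + intros x y Hy.
      assert (Hs : forall (q : Z) x y z, secant h (x + IZR q) y z = secant h x y z).
      { intros q x' y' z'; unfold secant; destruct (Req_EM_T y' z').
        - apply Derive_ext; intros; apply Hper.
        - now rewrite !Hper. }
      destruct (base_fp x) as [Hf1 Hf2].
      assert (Ex : x = frac_part x + IZR (Int_part x)) by (unfold frac_part; ring).
      destruct (Hn (frac_part x) y) as [H1 [H2 [H3 H4]]]; [lra|exact Hy|].
      apply good_secant_mono with (/ (INR n + 1)) (INR n) (1 - / (INR n + 1))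
        (/ (INR n + 1)) x y; rewrite ?Rminus_diag, ?Rabs_R0; try lra.
      rewrite Ex; split; [|split; [|split]].
      * apply op_bound_translate; auto.
      * apply op_bound_translate; auto.
      * intros x' y' z' [B1 [B2 B3]].
        replace x' with ((x' - IZR (Int_part x)) + IZR (Int_part x)) by ring.
        rewrite Hs; apply H3; repeat split; auto.
        rewrite <- Ex in B1; unfold frac_part.
        replace (x' - IZR (Int_part x) - (x - IZR (Int_part x))) with (x' - x) by ring; auto.
      * intros x' y' B1 B2.
        replace x' with ((x' - IZR (Int_part x)) + IZR (Int_part x)) by ring.
        rewrite Hs.
        apply is_derive_ext with (h (x' - IZR (Int_part x))); [intros; now rewrite Hper|].
        apply H4; auto; rewrite <- Ex in B1; unfold frac_part.
        replace (x' - IZR (Int_part x) - (x - IZR (Int_part x))) with (x' - x) by ring; auto.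
Qed.

(** By the mean value theorem a divided difference is a derivative at an intermediate point, which
    remains in the interval. *)
Lemma secant_bounds (h : R -> R -> R) (lam r x y z : R) :
  (forall y, in_U y -> is_derive (h x) y (secant h x y y)) ->
  (forall y, in_U y -> r <= Rabs (secant h x y y) <= lam) ->
  in_U y -> in_U z -> r <= Rabs (secant h x y z) <= lam.
Proof.
  intros Hd Hb Hy Hz; destruct (Req_dec y z) as [<-|Hyz]; [auto|].
  destruct (MVT_gen (h x) z y (fun y => secant h x y y)) as [c [Hc E]].
  - intros c Hc; apply Hd; unfold in_U in *.
    assert (Rmin z y >= -1) by (unfold Rmin; destruct (Rle_dec z y); lra).
    assert (Rmax z y <= 1) by (unfold Rmax; destruct (Rle_dec z y); lra). lra.
  - intros c Hc; apply continuity_pt_filterlim.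
    apply (ex_derive_continuous (h x)); eexists; apply Hd; unfold in_U in *.
    assert (Rmin z y >= -1) by (unfold Rmin; destruct (Rle_dec z y); lra).
    assert (Rmax z y <= 1) by (unfold Rmax; destruct (Rle_dec z y); lra). lra.
  - rewrite secant_spec in E.
    apply Rmult_eq_reg_r in E; [|lra]; rewrite E; apply Hb; unfold in_U in *.
    assert (Rmin z y >= -1) by (unfold Rmin; destruct (Rle_dec z y); lra).
    assert (Rmax z y <= 1) by (unfold Rmax; destruct (Rle_dec z y); lra). lra.
Qed.

(** * The inverse of the lift *)

Lemma is_series_first (u : nat -> R) :
  (forall m, (0 < m)%nat -> u m = 0) -> is_series u (u 0%nat).
Proof.
  intros H; pose proof (is_pseries_finite u 1 0 H) as E.
  apply is_pseries_lim in E; rewrite sum_O in E; simpl in E; rewrite Rmult_1_r in E.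
  apply is_lim_seq_ext with (2 := E); intros n; apply sum_n_ext; intros k.
  rewrite pow1; ring_R.
Qed.

(** Makes the two-variable results on divided differences available for the lift. *)
Lemma analytic_at_analytic2 (f : R -> R) (x0 y0 : R) :
  analytic_at f y0 -> analytic2_at (fun _ y => f y) x0 y0.
Proof.
  intros [a [r Ha]].
  exists (fun m n => match m with O => a n | _ => 0 end), r; intros x y Hx Hy t.
  assert (Hex : forall s, Rabs s < r -> ex_pseries a s).
  { intros s Hs; exists (f (y0 + s)); pose proof (Ha (y0 + s)) as E.
    replace (y0 + s - y0) with s in E by ring; exact (E Hs). }
  assert (Hrad : Rbar_lt (Rabs (y - y0)) (CV_radius a)).
  { set (s := (Rabs (y - y0) + r) / 2).
    pose proof (Rabs_pos (y - y0)) as Hp; unfold s.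
    assert (Hs : Rabs s < r) by (rewrite Rabs_pos_eq; unfold s; lra).
    apply Rbar_lt_le_trans with s; [simpl; unfold s; lra|].
    rewrite <- (Rabs_pos_eq s) by (unfold s; lra).
    apply Rbar_not_lt_le; intros Hlt.
    apply (CV_disk_outside a s Hlt); apply ex_series_lim_0.
    apply ex_pseries_R, Hex, Hs. }
  assert (E0 : forall n, t 0%nat n = a n * (y - y0) ^ n) by (intros n; unfold t; simpl; ring).
  assert (Em : forall m n, (0 < m)%nat -> t m n = 0).
  { intros [|m] n Hm; [lia|unfold t; ring]. }
  assert (Z : forall u : nat -> R, (forall n, u n = 0) -> is_series u 0).
  { intros u Hu; rewrite <- (Hu 0%nat); apply is_series_first; auto. }
  split; [|split].
  - intros [|m].
    + apply ex_series_ext with (fun n => Rabs (a n * (y - y0) ^ n)).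
      * intros n; now rewrite E0.
      * now apply CV_disk_inside.
    + exists 0; apply Z; intros n; rewrite Em by lia; apply Rabs_R0.
  - eexists; apply is_series_first; intros m Hm.
    apply is_series_unique, Z; intros n; rewrite Em by lia; apply Rabs_R0.
  - replace (f y) with (Series (t 0%nat)).
    + apply (is_series_first (fun m => Series (t m))); intros m Hm.
      apply is_series_unique, Z; intros n; now apply Em.
    + apply is_series_unique.
      apply is_series_ext with (fun n => a n * (y - y0) ^ n); [intros n; now rewrite E0|].
      apply is_pseries_R, Ha, Hy.
Qed.

(* [Finv (F Y + t) - Y] is the pointwise limit of the iterates of
   [phi |-> (t - (F (Y + phi) - F Y - a1 * phi)) / a1], with [a1 = F' y0]. *)
Lemma inverse_anorm_local (f finv : R -> R) (y0 : R) :
  analytic_at f y0 -> 1 < Derive f y0 ->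
  (forall X, f (finv X) = X) -> (forall X X', Rabs (finv X - finv X') <= Rabs (X - X')) ->
  (forall Y, finv (f Y) = Y) ->
  exists n, forall Y rho, Rabs (Y - y0) <= / (INR n + 1) -> 0 < rho <= / (INR n + 1) ->
    anorm_le rho ((1 - / (INR n + 1)) * rho) (fun t => finv (f Y + t) - Y).
Proof.
  intros Han Hd Hinv Hlip Hinv'.
  destruct (secant_local (fun _ y => f y) 0 y0 (analytic_at_analytic2 f 0 y0 Han))
    as [eps [L [He [HL [Hs _]]]]].
  set (a1 := Derive f y0) in *.
  destruct (exists_inv_le (eps / 2)) as [n1 Hn1]; [lra|].
  (* The resulting inequality [e * (a1 + 2 * L) <= a1 - 1] implies
     [1 + 2 * L * e * (1 - e) <= a1 * (1 - e)], which is the invariance of the bound [(1 - e) * rho]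
     under the iteration. *)
  destruct (exists_inv_le ((a1 - 1) / (a1 + 2 * L))) as [n2 Hn2];
    [apply Rdiv_lt_0_compat; lra|].
  set (n := S (n1 + n2)%nat); exists n.
  pose proof (inv_INR_decr n1 n ltac:(lia)) as D1.
  pose proof (inv_INR_decr n2 n ltac:(lia)) as D2.
  pose proof (inv_INR_pos n) as Hp.
  assert (Hp1 : / (INR n + 1) < 1).
  { rewrite <- Rinv_1; apply Rinv_lt_contravar; unfold n; rewrite S_INR;
      pose proof (pos_INR (n1 + n2)); lra. }
  set (e := / (INR n + 1)) in *.
  assert (C : e * (a1 + 2 * L) <= a1 - 1).
  { replace (a1 - 1) with ((a1 - 1) / (a1 + 2 * L) * (a1 + 2 * L)) by (field; lra).
    apply Rmult_le_compat_r; lra. }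
  assert (HcL : 2 * L * e <= a1 - 1) by nra.
  set (sec := secant (fun _ y => f y) 0) in *.
  assert (Hdev : forall rho al be, 0 < rho ->
    anorm_le rho (2 * e) (fun t => al t - y0) -> anorm_le rho (2 * e) (fun t => be t - y0) ->
    anorm_le rho (2 * L * e) (fun t => sec (al t) (be t) - a1)).
  { intros rho al be Hr Hal Hbe.
    assert (Hz : anorm_le rho 0 (fun _ => 0)) by (apply anorm_le_const_le; rewrite ?Rabs_R0; lra).
    assert (Hzero : forall c M, 0 <= M -> anorm_le rho M (fun _ => c - c)).
    { intros c M HM; apply anorm_le_weaken with 0; [exact HM|].
      eapply anorm_le_ext; [|exact Hz]; intros; simpl; ring. }
    destruct (Hs rho (2 * e) (fun _ => 0) al be (fun _ => 0) (fun _ => y0) (fun _ => y0) Hr)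
      as [_ H].
    - split; [apply Hzero; lra|split]; apply anorm_le_weaken with (2 * e); auto; lra.
    - split; [apply Hzero; lra|split]; apply Hzero; lra.
    - split; [apply Hzero; lra|split]; auto.
    - replace (2 * L * e) with (L * (2 * e)) by ring.
      eapply anorm_le_ext; [|exact H]; intros t Ht; simpl.
      rewrite secant_diag; reflexivity. }
  intros Y rho HY Hrho.
  set (E := fun v => (sec (Y + v) Y - a1) * v).
  assert (HE : forall v w, Rabs v <= e -> Rabs w <= e ->
    Rabs (E v - E w) <= (a1 - 1) * Rabs (v - w)).
  { intros v w Hv Hw.
    assert (HEf : forall u, E u = f (Y + u) - f Y - a1 * u).
    { intros u; unfold E, sec.
      pose proof (secant_spec (fun _ y => f y) 0 (Y + u) Y) as S; simpl in S.
      replace (Y + u - Y) with u in S by ring. rewrite S; ring. }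
    rewrite !HEf.
    pose proof (secant_spec (fun _ y => f y) 0 (Y + v) (Y + w)) as S; simpl in S.
    fold sec in S.
    replace (f (Y + v) - f Y - a1 * v - (f (Y + w) - f Y - a1 * w))
      with ((f (Y + v) - f (Y + w)) - a1 * (v - w)) by ring.
    rewrite S; replace (Y + v - (Y + w)) with (v - w) by ring.
    replace (sec (Y + v) (Y + w) * (v - w) - a1 * (v - w))
      with ((sec (Y + v) (Y + w) - a1) * (v - w)) by ring.
    rewrite Rabs_mult; apply Rmult_le_compat_r; [apply Rabs_pos|].
    apply Rle_trans with (2 * L * e); [|exact HcL].
    assert (Hc : forall u, Rabs u <= e -> anorm_le 1 (2 * e) (fun _ => Y + u - y0)).
    { intros u Hu; apply anorm_le_const_le; [lra|].
      replace (Y + u - y0) with ((Y - y0) + u) by ring.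
      pose proof (Rabs_triang (Y - y0) u); lra. }
    pose proof (Hdev 1 (fun _ => Y + v) (fun _ => Y + w) ltac:(lra) (Hc v Hv) (Hc w Hw)) as H.
    apply (anorm_le_val _ _ 0 _ H); rewrite Rabs_R0; lra. }
  set (phi := fix phi (j : nat) (t : R) : R :=
    match j with O => 0 | S j => (t - E (phi j t)) / a1 end).
  apply anorm_le_lim with phi; [lra| |].
  - intros j; induction j as [|j IH]; simpl.
    + apply anorm_le_const_le; rewrite ?Rabs_R0; [lra|nra].
    + assert (H1 : anorm_le rho (2 * L * e) (fun t => sec (Y + phi j t) Y - a1)).
      { apply Hdev; [lra| |].
        - apply anorm_le_ext with (fun t => phi j t + (Y - y0)); [intros; ring|].
          apply anorm_le_weaken with ((1 - e) * rho + Rabs (Y - y0)); [nra|].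
          apply anorm_le_plus; [lra|exact IH|apply anorm_le_const; lra].
        - apply anorm_le_const_le; lra. }
      pose proof (anorm_le_mult rho _ _ _ _ ltac:(lra) H1 IH) as H2.
      pose proof (anorm_le_minus rho _ _ _ _ ltac:(lra) (anorm_le_id rho ltac:(lra)) H2) as H3.
      pose proof (anorm_le_scal rho _ (/ a1) _ ltac:(lra) H3) as H4.
      eapply anorm_le_ext; [|apply anorm_le_weaken with (2 := H4)].
      { intros t Ht; simpl; unfold E; field; lra. }
      rewrite Rabs_pos_eq by (left; apply Rinv_0_lt_compat; lra).
      apply Rmult_le_reg_l with a1; [lra|].
      rewrite <- Rmult_assoc, Rinv_r, Rmult_1_l by lra.
      assert (0 <= rho * (a1 - 1 - e * (a1 + 2 * L))) by (apply Rmult_le_pos; lra).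
      assert (0 <= rho * (2 * L * e * e)) by (apply Rmult_le_pos; nra).
      nra.
  (* The increment [h] is a fixed point of the iteration, small because [finv] is 1-Lipschitz; as
     [E] is [(a1 - 1)]-Lipschitz there, the iterates approach it at the rate [(a1 - 1) / a1]. *)
  - intros t Ht; set (h := finv (f Y + t) - Y).
    assert (Hh : Rabs h <= Rabs t).
    { unfold h; rewrite <- (Hinv' Y) at 2; eapply Rle_trans; [apply Hlip|].
      right; f_equal; ring. }
    assert (Hfix : h = (t - E h) / a1).
    { unfold E, sec.
      pose proof (secant_spec (fun _ y => f y) 0 (Y + h) Y) as S; simpl in S.
      replace (Y + h - Y) with h in S by ring.
      assert (Hf : f (Y + h) = f Y + t).
      { unfold h; replace (Y + (finv (f Y + t) - Y)) with (finv (f Y + t)) by ring; apply Hinv. }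
      rewrite Hf in S.
      rewrite Rmult_minus_distr_r, <- S; field; lra. }
    set (th := (a1 - 1) / a1).
    assert (Hth : 0 <= th < 1).
    { unfold th; split; [apply Rdiv_le_0_compat; lra|apply Rlt_div_l; lra]. }
    assert (Hj : forall j, Rabs (phi j t) <= e /\ Rabs (phi j t - h) <= th ^ j * Rabs h).
    { induction j as [|j [IH1 IH2]]; simpl.
      - rewrite Rabs_R0, Rminus_0_l, Rabs_Ropp; lra.
      - assert (Hk : Rabs ((t - E (phi j t)) / a1 - h) <= th * Rabs (phi j t - h)).
        { rewrite Hfix at 1.
          replace ((t - E (phi j t)) / a1 - (t - E h) / a1)
            with (- ((E (phi j t) - E h) / a1)) by (field; lra).
          rewrite Rabs_Ropp; unfold Rdiv; rewrite Rabs_mult, (Rabs_pos_eq (/ a1))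
            by (left; apply Rinv_0_lt_compat; lra).
          unfold th; apply Rle_trans with ((a1 - 1) * Rabs (phi j t - h) * / a1);
            [|right; field; lra].
          apply Rmult_le_compat_r; [left; apply Rinv_0_lt_compat; lra|].
          apply HE; auto; lra. }
        split; [|rewrite Rmult_assoc; eapply Rle_trans; [exact Hk|];
          apply Rmult_le_compat_l; lra].
        assert (E0 : E 0 = 0) by (unfold E; ring).
        pose proof (HE (phi j t) 0 IH1 ltac:(rewrite Rabs_R0; lra)) as H0.
        rewrite E0, !Rminus_0_r in H0.
        unfold Rdiv; rewrite Rabs_mult, (Rabs_pos_eq (/ a1))
          by (left; apply Rinv_0_lt_compat; lra).
        apply Rmult_le_reg_r with a1; [lra|].
        rewrite Rmult_assoc, Rinv_l, Rmult_1_r by lra.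
        pose proof (Rabs_triang t (- E (phi j t))) as T; rewrite Rabs_Ropp in T.
        fold (t - E (phi j t)) in T; nra. }
    apply is_lim_seq_eps; intros d Hdd.
    destruct (pow_lt_1_zero th ltac:(rewrite Rabs_pos_eq; lra) (d / (Rabs h + 1))) as [N HN].
    { apply Rdiv_lt_0_compat; [lra|pose proof (Rabs_pos h); lra]. }
    exists N; intros j HjN; eapply Rle_lt_trans; [apply Hj|].
    specialize (HN j HjN); rewrite Rabs_pos_eq in HN by (apply pow_le; lra).
    pose proof (Rabs_pos h) as Hh0.
    apply Rmult_lt_compat_r with (r := Rabs h + 1) in HN; [|lra].
    replace (d / (Rabs h + 1) * (Rabs h + 1)) with d in HN by (field; lra).
    assert (0 <= th ^ j) by (apply pow_le; lra); nra.
Qed.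

Section Lift.

Variables (b : nat) (F : R -> R).
Hypothesis hF0 : F 0 = 0.
Hypothesis hdeg : has_degree F b.
Hypothesis hFan : forall x, analytic_at F x.
Hypothesis hexp : forall x, 1 < Derive F x.

Notation Finv := (inverse F).

Lemma lift_is_derive (x : R) : is_derive F x (Derive F x).
Proof.
  destruct (secant_local (fun _ y => F y) 0 x (analytic_at_analytic2 F 0 x (hFan x)))
    as [eps [L [He [_ [_ [_ H]]]]]].
  apply Derive_correct; eexists; apply (H 0 x); rewrite Rminus_diag, Rabs_R0; lra.
Qed.

Lemma lift_continuity : continuity F.
Proof.
  intros x; apply continuity_pt_filterlim, (ex_derive_continuous F).
  eexists; apply lift_is_derive.
Qed.

Lemma lift_expand (x y : R) : x <= y -> y - x <= F y - F x.
Proof.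
  intros Hxy; destruct (MVT_gen F x y (Derive F)) as [c [_ E]].
  - intros c _; apply lift_is_derive.
  - intros c _; apply lift_continuity.
  - rewrite E; specialize (hexp c); nra.
Qed.

Lemma lift_inj (x y : R) : F x = F y -> x = y.
Proof.
  intros H; destruct (Rle_lt_dec x y) as [Hl|Hl].
  - pose proof (lift_expand x y Hl); lra.
  - pose proof (lift_expand y x ltac:(lra)); lra.
Qed.

Lemma lift_surj (X : R) : exists x, F x = X.
Proof.
  destruct (IVT_gen F 0 X X) as [x [_ Hx]]; [exact lift_continuity| |now exists x].
  rewrite hF0; destruct (Rle_lt_dec 0 X) as [Hl|Hl].
  - pose proof (lift_expand 0 X Hl); rewrite Rmin_left, Rmax_right; lra.
  - pose proof (lift_expand X 0 ltac:(lra)); rewrite Rmin_right, Rmax_left; lra.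
Qed.

Lemma lift_inverse (X : R) : F (Finv X) = X.
Proof. apply (epsilon_spec (inhabits 0) (fun t => F t = X)), lift_surj. Qed.

Lemma inverse_lift (x : R) : Finv (F x) = x.
Proof. apply lift_inj, lift_inverse. Qed.

Lemma inverse_le (X X' : R) : X <= X' -> Finv X <= Finv X'.
Proof.
  intros H; apply Rnot_lt_le; intros Hl.
  pose proof (lift_expand _ _ (Rlt_le _ _ Hl)) as E; rewrite !lift_inverse in E; lra.
Qed.

Lemma inverse_0 : Finv 0 = 0.
Proof. rewrite <- hF0 at 1; apply inverse_lift. Qed.

Lemma inverse_nonneg (X : R) : 0 <= X -> 0 <= Finv X.
Proof. intros H; rewrite <- inverse_0; now apply inverse_le. Qed.

Lemma inverse_lip1 (X X' : R) : Rabs (Finv X - Finv X') <= Rabs (X - X').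
Proof.
  assert (H : forall X X', X <= X' -> Rabs (Finv X - Finv X') <= Rabs (X - X')).
  { clear X X'; intros X X' H; pose proof (inverse_le _ _ H) as H'.
    pose proof (lift_expand _ _ H') as E; rewrite !lift_inverse in E.
    rewrite !Rabs_left1; lra. }
  destruct (Rle_lt_dec X X') as [Hl|Hl]; [auto|].
  rewrite (Rabs_minus_sym (Finv X)), (Rabs_minus_sym X); apply H; lra.
Qed.

Lemma lift_nat (x : R) (n : nat) : F (x + INR n) = F x + INR b * INR n.
Proof.
  induction n as [|n IH]; [simpl; rewrite !Rmult_0_r, !Rplus_0_r; reflexivity|].
  rewrite S_INR; replace (x + (INR n + 1)) with ((x + INR n) + 1) by ring.
  rewrite hdeg, IH; ring.
Qed.

Lemma lift_Z (x : R) (q : Z) : F (x + IZR q) = F x + INR b * IZR q.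
Proof.
  destruct (Z.le_gt_cases 0 q) as [Hq|Hq].
  - rewrite <- (Z2Nat.id q Hq), <- INR_IZR_INZ; apply lift_nat.
  - set (n := Z.to_nat (- q)).
    assert (E : IZR q = - INR n).
    { unfold n; rewrite INR_IZR_INZ, Z2Nat.id, opp_IZR by lia; ring. }
    rewrite E; pose proof (lift_nat (x + - INR n) n) as H.
    replace (x + - INR n + INR n) with x in H by ring; lra.
Qed.

Lemma inverse_Z (X : R) (q : Z) : Finv (X + INR b * IZR q) = Finv X + IZR q.
Proof.
  apply lift_inj; rewrite lift_inverse, lift_Z, lift_inverse; reflexivity.
Qed.

Lemma inverse_le_1 (X : R) : X <= INR b -> Finv X <= 1.
Proof.
  intros H; apply Rle_trans with (Finv (0 + INR b * IZR 1)).
  - apply inverse_le; lra.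
  - rewrite inverse_Z, inverse_0; simpl; lra.
Qed.

(** Contraction in norm, with one [kap] for all centres and all small radii: compactness covers [Y]
    in [[0,1]], and equivariance under translations covers the line. *)
Lemma inverse_anorm : exists rho0 kap, 0 < rho0 /\ 0 < kap < 1 /\
  forall rho X, 0 < rho <= rho0 ->
    anorm_le rho (kap * rho) (fun t => Finv (X + t) - Finv X).
Proof.
  destruct (compact_uniform 0 1 (fun Y n => forall rho, 0 < rho <= / (INR n + 1) ->
    anorm_le rho ((1 - / (INR n + 1)) * rho) (fun t => Finv (F Y + t) - Y))) as [n Hn].
  - intros Y n m Hnm H rho Hrho; pose proof (inv_INR_decr n m Hnm).
    apply anorm_le_weaken with ((1 - / (INR n + 1)) * rho); [nra|apply H; lra].
  - intros Y HY.
    destruct (inverse_anorm_local F Finv Y (hFan Y) (hexp Y) lift_inverse inverse_lip1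
      inverse_lift) as [n Hn].
    exists n, (/ (INR n + 1)); split; [apply inv_INR_pos|].
    intros Y' _ HY' rho Hrho; apply Hn; auto; lra.
  - pose proof (inv_INR_pos (S n)) as Hp.
    pose proof (inv_INR_decr n (S n) ltac:(lia)) as Hle.
    assert (Hlt : / (INR (S n) + 1) < 1).
    { rewrite <- Rinv_1; apply Rinv_lt_contravar; rewrite S_INR; pose proof (pos_INR n); lra. }
    exists (/ (INR (S n) + 1)), (1 - / (INR (S n) + 1)).
    split; [exact Hp|split; [lra|]].
    intros rho X Hrho.
    set (Y := Finv X); set (q := Int_part Y).
    assert (HY : Y = frac_part Y + IZR q) by (unfold frac_part, q; ring).
    destruct (base_fp Y) as [Hf1 Hf2].
    assert (HX : X = F (frac_part Y) + INR b * IZR q).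
    { rewrite <- lift_Z, <- HY; symmetry; apply lift_inverse. }
    apply anorm_le_weaken with ((1 - / (INR n + 1)) * rho); [nra|].
    eapply anorm_le_ext; [|apply (Hn (frac_part Y)); lra].
    intros t Ht; simpl.
    replace (X + t) with (F (frac_part Y) + t + INR b * IZR q) by lra.
    rewrite inverse_Z; fold Y; lra.
Qed.

End Lift.

(** * The graph transform on the line *)

Lemma lipschitz_of_local (h : R -> R) (K d : R) :
  0 < d -> 0 <= K ->
  (forall x t, Rabs t < d -> Rabs (h (x + t) - h x) <= K * Rabs t) ->
  forall x y, Rabs (h y - h x) <= K * Rabs (y - x).
Proof.
  intros Hd HK H x y.
  destruct (exists_inv_le (d / (2 * (Rabs (y - x) + 1)))) as [N HN].
  { apply Rdiv_lt_0_compat; [lra|pose proof (Rabs_pos (y - x)); lra]. }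
  pose proof (inv_INR_pos N) as Hp; pose proof (Rabs_pos (y - x)) as Hxy.
  set (s := (y - x) * / (INR N + 1)).
  assert (Hs : Rabs s < d).
  { unfold s; rewrite Rabs_mult, (Rabs_pos_eq (/ _)) by lra.
    apply Rle_lt_trans with (Rabs (y - x) * (d / (2 * (Rabs (y - x) + 1)))).
    - apply Rmult_le_compat_l; lra.
    - apply Rmult_lt_reg_r with (2 * (Rabs (y - x) + 1)); [lra|].
      replace (Rabs (y - x) * (d / (2 * (Rabs (y - x) + 1))) * (2 * (Rabs (y - x) + 1)))
        with (Rabs (y - x) * d) by (field; lra). nra. }
  assert (Hk : forall k, Rabs (h (x + INR k * s) - h x) <= K * (INR k * Rabs s)).
  { induction k as [|k IH].
    - simpl; rewrite Rmult_0_l, Rplus_0_r, Rminus_diag, Rabs_R0; lra.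
    - rewrite S_INR; replace (x + (INR k + 1) * s) with ((x + INR k * s) + s) by ring.
      pose proof (H (x + INR k * s) s Hs) as H1.
      replace (h (x + INR k * s + s) - h x)
        with ((h (x + INR k * s + s) - h (x + INR k * s)) + (h (x + INR k * s) - h x)) by ring.
      eapply Rle_trans; [apply Rabs_triang|]; lra. }
  pose proof (Hk (S N)) as H1; rewrite S_INR in H1; pose proof (pos_INR N).
  replace (x + (INR N + 1) * s) with y in H1 by (unfold s; field; lra).
  replace ((INR N + 1) * Rabs s) with (Rabs (y - x)) in H1; [exact H1|].
  unfold s; rewrite Rabs_mult, (Rabs_pos_eq (/ _)) by lra; field; lra.
Qed.

Lemma anorm_le_increment_lip (rho M : R) (h : R -> R) :
  0 < rho -> 0 <= M -> (forall x, anorm_le rho M (fun t => h (x + t) - h x)) ->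
  forall x y, Rabs (h y - h x) <= M / rho * Rabs (y - x).
Proof.
  intros Hr HM H; apply lipschitz_of_local with rho; [exact Hr|apply Rdiv_le_0_compat; lra|].
  intros x t Ht; pose proof (anorm_le_lip _ _ t _ (H x) Ht) as E; simpl in E.
  rewrite Rplus_0_r, Rminus_diag, Rminus_0_r in E; exact E.
Qed.

Lemma pow_le_1 (x : R) (n : nat) : 0 <= x <= 1 -> 0 <= x ^ n <= 1.
Proof.
  intros H; split; [apply pow_le; lra|].
  rewrite <- (pow1 n); apply pow_incr; lra.
Qed.

Lemma exp_ge_1 (x : R) : 0 <= x -> 1 <= exp x.
Proof.
  intros H; destruct (Req_dec x 0) as [->|Hx]; [rewrite exp_0; lra|].
  pose proof (exp_ineq1 x Hx); lra.
Qed.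

Lemma exp_ge_plus1 (x : R) : 1 + x <= exp x.
Proof.
  destruct (Req_dec x 0) as [->|Hx]; [rewrite exp_0; lra|].
  left; exact (exp_ineq1 x Hx).
Qed.

Lemma pow_lim_zero (th C : R) : 0 <= th < 1 ->
  forall e, 0 < e -> exists N, forall n, (N <= n)%nat -> C * th ^ n < e.
Proof.
  intros Hth e He; pose proof (Rabs_pos C) as HC.
  destruct (pow_lt_1_zero th ltac:(rewrite Rabs_pos_eq; lra) (e / (Rabs C + 1))) as [N HN].
  { apply Rdiv_lt_0_compat; lra. }
  exists N; intros n Hn; specialize (HN n Hn).
  rewrite Rabs_pos_eq in HN by (apply pow_le; lra).
  apply Rmult_lt_compat_r with (r := Rabs C + 1) in HN; [|lra].
  replace (e / (Rabs C + 1) * (Rabs C + 1)) with e in HN by (field; lra).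
  assert (0 <= th ^ n) by (apply pow_le; lra).
  pose proof (Rle_abs C); nra.
Qed.

(** * Sequences of analytic functions that tend to 1 *)

Definition one_coefs (k : nat) : R := match k with O => 1 | _ => 0 end.

Lemma one_coefs_bound (rho : R) : coef_bound rho 1 one_coefs.
Proof.
  intros n; induction n as [|n IH].
  - rewrite sum_O; simpl; rewrite Rabs_R1; lra.
  - rewrite sum_Sn; change (Hierarchy.plus ?x ?y) with (x + y).
    simpl one_coefs; rewrite Rabs_R0; lra.
Qed.

Lemma PSeries_one_coefs (t : R) : PSeries one_coefs t = 1.
Proof.
  apply is_pseries_unique.
  pose proof (is_pseries_finite one_coefs t 0) as H; rewrite sum_O in H.
  simpl in H; rewrite Rmult_1_r in H; apply H.
  intros [|k] Hk; [lia|reflexivity].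
Qed.

Lemma coef_bound_radius_le (rho rho' M : R) (a : nat -> R) :
  0 <= rho' <= rho -> coef_bound rho M a -> coef_bound rho' M a.
Proof.
  intros H Ha n; eapply Rle_trans; [|apply (Ha n)].
  apply sum_n_le_R; intros k; apply Rmult_le_compat_l; [apply Rabs_pos|].
  apply pow_incr; lra.
Qed.

(** The fraction [3 / 4] exceeds the step length [1 / 2] used when the centre is moved, and so
    leaves an interval of length [rho / 4] at the new centre. *)
Definition flat_at (rho : R) (h : nat -> R -> R) (x : nat -> R) : Prop :=
  forall e, 0 < e -> eventually (fun n =>
    forall t, Rabs t <= 3 / 4 * rho -> Rabs (h n (x n + t) - 1) < e).

(** The limit lemmas ask for a bound at every index; the finitely many early terms are replaced by
    the coefficients of the constant 1, which is why [M] is at least 1. *)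
Lemma eventually_coefs (rho M : R) (h : nat -> R -> R) (x : nat -> R) :
  1 <= M -> eventually (fun n => anorm_le rho M (fun t => h n (x n + t))) ->
  exists a : nat -> nat -> R, (forall n, coef_bound rho M (a n)) /\
    eventually (fun n => has_coefs rho M (a n) (fun t => h n (x n + t))).
Proof.
  intros HM [N HN].
  assert (H : forall n, exists a, coef_bound rho M a /\
    ((N <= n)%nat -> has_coefs rho M a (fun t => h n (x n + t)))).
  { intros n; destruct (Nat.le_gt_cases N n) as [Hn|Hn].
    - destruct (HN n Hn) as [a Ha]; exists a; split; [apply Ha|auto].
    - exists one_coefs; split; [|lia].
      eapply coef_bound_weaken; [exact HM|apply one_coefs_bound]. }
  destruct (choice _ H) as [a Ha]; exists a; split; [intros n; exact (proj1 (Ha n))|].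
  exists N; intros n Hn; exact (proj2 (Ha n) Hn).
Qed.

Lemma flat_at_of_coefs (rho M : R) (h : nat -> R -> R) (x : nat -> R) (a : nat -> nat -> R) :
  0 < rho -> 1 <= M -> (forall n, coef_bound rho M (a n)) ->
  eventually (fun n => has_coefs rho M (a n) (fun t => h n (x n + t))) ->
  (forall k e, 0 < e -> eventually (fun n => Rabs (a n k - one_coefs k) < e)) ->
  flat_at rho h x.
Proof.
  intros Hr HM Ha Hh Hlim e He.
  pose proof (pseries_lim_uniform eventually rho M (3 / 4) a one_coefs Hr ltac:(lra) Ha
    (coef_bound_weaken _ _ _ _ HM (one_coefs_bound rho)) Hlim e He) as H.
  apply filter_imp with (2 := filter_and _ _ Hh H); intros n [H1 H2] t Ht.
  specialize (H2 t Ht); rewrite PSeries_one_coefs in H2.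
  rewrite (has_coefs_PSeries _ _ t _ _ H1) by lra; exact H2.
Qed.

Lemma flat_at_base (rho C : R) (h : nat -> R -> R) (x : nat -> R) :
  0 < rho -> (forall n, h n (x n) = 1) ->
  eventually (fun n => anorm_le rho C (fun t => h n (x n + t))) ->
  (forall k e, (1 <= k)%nat -> 0 < e ->
     eventually (fun n => Rabs (Derive_n (h n) k (x n)) < e)) ->
  flat_at rho h x.
Proof.
  intros Hr H1 Hn Hd.
  set (M := Rmax 1 C).
  destruct (eventually_coefs rho M h x) as [a [Ha Hh]].
  - apply Rmax_l.
  - apply filter_imp with (2 := Hn); intros n H.
    apply anorm_le_weaken with C; [apply Rmax_r|exact H].
  - apply flat_at_of_coefs with M a; auto; [apply Rmax_l|].
    intros k e He; destruct k as [|k].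
    + apply filter_imp with (2 := Hh); intros n H.
      rewrite <- (has_coefs_0 _ _ _ _ Hr H), Rplus_0_r, H1; simpl.
      rewrite Rminus_diag, Rabs_R0; exact He.
    + apply filter_imp with (2 := filter_and _ _ Hh (Hd (S k) e ltac:(lia) He)).
      intros n [H2 H3]; simpl one_coefs; rewrite Rminus_0_r.
      rewrite (has_coefs_Derive_n rho M (x n) (a n) (h n) (S k) Hr H2) in H3.
      rewrite Rabs_mult in H3; eapply Rle_lt_trans; [|exact H3].
      rewrite <- (Rmult_1_r (Rabs (a n (S k)))) at 1.
      apply Rmult_le_compat_l; [apply Rabs_pos|].
      rewrite Rabs_pos_eq by apply pos_INR.
      pose proof (lt_O_fact (S k)) as Hf; apply (le_INR 1); lia.
Qed.

(** Closeness of values on one side of the centre, together with a norm bound, gives closeness of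
    every Taylor coefficient. A small k-th derivative can therefore be moved from one pair of curves
    to another. *)
Lemma derive_transfer (rho rho1 C : R) (h h' : nat -> R -> R) (x : nat -> R) (k : nat) :
  0 < rho1 < rho ->
  eventually (fun n => anorm_le rho C (fun t => h n (x n + t))) ->
  eventually (fun n => anorm_le rho C (fun t => h' n (x n + t))) ->
  (forall t, 0 < t < rho1 -> forall e, 0 < e ->
     eventually (fun n => Rabs (h n (x n + t) - h' n (x n + t)) < e)) ->
  (forall e, 0 < e -> eventually (fun n => Rabs (Derive_n (h' n) k (x n)) < e)) ->
  forall e, 0 < e -> eventually (fun n => Rabs (Derive_n (h n) k (x n)) < e).
Proof.
  intros Hr Hn Hn' Hc Hd e He.
  assert (Hr0 : 0 < rho) by lra.
  set (M := Rmax 1 C).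
  assert (HM : forall h : nat -> R -> R,
    eventually (fun n => anorm_le rho C (fun t => h n (x n + t))) ->
    eventually (fun n => anorm_le rho M (fun t => h n (x n + t)))).
  { intros f Hf; apply filter_imp with (2 := Hf); intros n H.
    apply anorm_le_weaken with C; [apply Rmax_r|exact H]. }
  destruct (eventually_coefs rho M h x (Rmax_l _ _) (HM h Hn)) as [a [Ha Hh]].
  destruct (eventually_coefs rho M h' x (Rmax_l _ _) (HM h' Hn')) as [a' [Ha' Hh']].
  assert (Hb : forall n, coef_bound rho1 (M + M) (fun k => a n k - a' n k)).
  { intros n; apply coef_bound_plus; [lra| |].
    - apply coef_bound_radius_le with rho; [lra|apply Ha].
    - apply coef_bound_opp, coef_bound_radius_le with rho; [lra|apply Ha']. }
  assert (Hfk : 0 < INR (Factorial.fact k)) by apply INR_fact_lt_0.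
  assert (He2 : 0 < e / 2 / INR (Factorial.fact k)) by (apply Rdiv_lt_0_compat; lra).
  assert (Hz : eventually (fun n => Rabs (a n k - a' n k) < e / 2 / INR (Factorial.fact k))).
  { apply (coefs_lim_zero eventually rho1 (M + M) (fun n k => a n k - a' n k)
      ltac:(lra) Hb); [|exact He2].
    intros t Ht d Hdd.
    apply filter_imp with (2 := filter_and _ _ (Hc t Ht d Hdd) (filter_and _ _ Hh Hh')).
    intros n [H1 [H2 H3]].
    assert (Ht' : Rabs t < rho) by (rewrite Rabs_pos_eq; lra).
    assert (Heq : PSeries (fun k => a n k - a' n k) t = PSeries (a n) t - PSeries (a' n) t).
    { apply (PSeries_minus (a n) (a' n) t); eapply coef_bound_ex_pseries; eauto. }
    rewrite Heq, <- (has_coefs_PSeries _ _ t _ _ H2 Ht'), <- (has_coefs_PSeries _ _ t _ _ H3 Ht').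
    exact H1. }
  assert (He3 : 0 < e / 2) by lra.
  pose proof (Hd _ He3) as Hd'.
  apply filter_imp with (2 := filter_and _ _ (filter_and _ _ Hz Hd') (filter_and _ _ Hh Hh')).
  intros n [[H1 H2] [H3 H4]].
  rewrite (has_coefs_Derive_n rho M (x n) (a n) (h n) k Hr0 H3).
  rewrite (has_coefs_Derive_n rho M (x n) (a' n) (h' n) k Hr0 H4) in H2.
  set (f := INR (Factorial.fact k)) in *.
  apply Rmult_lt_compat_r with (r := f) in H1; [|exact Hfk].
  replace (e / 2 / f * f) with (e / 2) in H1 by (field; lra).
  replace (a n k * f) with ((a n k - a' n k) * f + a' n k * f) by ring.
  eapply Rle_lt_trans; [apply Rabs_triang|].
  rewrite Rabs_mult, (Rabs_pos_eq f) by lra; lra.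
Qed.

(** Analytic continuation: flatness bounds the value at the new centre by 2, so the relative norm
    bound becomes absolute; the new coefficients are then determined by the values for
    [0 < t < rho / 4], still in the old disc. *)
Lemma flat_at_step (rho C : R) (h : nat -> R -> R) (x y : nat -> R) :
  0 < rho -> 0 <= C -> flat_at rho h x -> (forall n, Rabs (y n) <= rho / 2) ->
  eventually (fun n => anorm_le rho (C * Rabs (h n (x n + y n)))
    (fun t => h n (x n + y n + t))) ->
  flat_at rho h (fun n => x n + y n).
Proof.
  intros Hr HC Hf Hy Hn.
  set (M := Rmax 1 (C * 2)).
  destruct (eventually_coefs rho M h (fun n => x n + y n)) as [a [Ha Hh]].
  - apply Rmax_l.
  - apply filter_imp with (2 := filter_and _ _ Hn (Hf 1 ltac:(lra))); intros n [H H'].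
    specialize (H' (y n) ltac:(specialize (Hy n); lra)).
    apply anorm_le_weaken with (2 := H).
    eapply Rle_trans; [|apply Rmax_r]; apply Rmult_le_compat_l; [exact HC|].
    pose proof (Rabs_triang (h n (x n + y n) - 1) 1) as T; rewrite Rabs_R1 in T.
    replace (h n (x n + y n) - 1 + 1) with (h n (x n + y n)) in T by ring; lra.
  - apply flat_at_of_coefs with M a; auto; [apply Rmax_l|].
    intros k.
    assert (Hb : forall n, coef_bound (rho / 4) (M + 1) (fun k => a n k - one_coefs k)).
    { intros n; apply coef_bound_plus; [lra| |].
      - apply coef_bound_radius_le with rho; [lra|apply Ha].
      - apply coef_bound_opp, one_coefs_bound. }
    apply (coefs_lim_zero eventually (rho / 4) (M + 1)
      (fun n k => a n k - one_coefs k) ltac:(lra) Hb).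
    intros t Ht e He.
    apply filter_imp with (2 := filter_and _ _ Hh (Hf e He)); intros n [H1 H2].
    assert (Ht' : Rabs t < rho) by (rewrite Rabs_pos_eq; lra).
    assert (Heq : PSeries (fun k => a n k - one_coefs k) t
      = PSeries (a n) t - PSeries one_coefs t).
    { apply (PSeries_minus (a n) one_coefs t); eapply coef_bound_ex_pseries; eauto.
      apply one_coefs_bound. }
    rewrite Heq, PSeries_one_coefs, <- (has_coefs_PSeries _ _ t _ _ H1 Ht'), Rplus_assoc.
    apply H2; pose proof (Rabs_triang (y n) t); specialize (Hy n).
    rewrite (Rabs_pos_eq t) in * by lra; lra.
Qed.

(** The path to [y n] is cut into the same number of steps for all [n], each of length at most
    [rho / 2]. The norm bound is assumed for all displacements up to [S] since it is applied at the
    intermediate centres. *)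
Lemma flat_at_all (rho C S : R) (h : nat -> R -> R) (x : nat -> R) :
  0 < rho -> 0 <= C -> flat_at rho h x ->
  (forall y, (forall n, Rabs (y n) <= S) ->
    eventually (fun n => anorm_le rho (C * Rabs (h n (x n + y n)))
      (fun t => h n (x n + y n + t)))) ->
  forall y, (forall n, Rabs (y n) <= S) -> flat_at rho h (fun n => x n + y n).
Proof.
  intros Hr HC Hf Hn y Hy.
  assert (HS : 0 <= S) by (specialize (Hy 0%nat); pose proof (Rabs_pos (y 0%nat)); lra).
  destruct (exists_inv_le (rho / 2 / (S + 1))) as [J HJ].
  { apply Rdiv_lt_0_compat; lra. }
  pose proof (inv_INR_pos J) as HJp; set (w := / (INR J + 1)) in *.
  assert (Hw : S * w <= rho / 2).
  { apply Rle_trans with ((S + 1) * w); [nra|].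
    replace (rho / 2) with ((S + 1) * (rho / 2 / (S + 1))) by (field; lra).
    apply Rmult_le_compat_l; lra. }
  assert (HJ1 : (INR J + 1) * w = 1).
  { unfold w; apply Rinv_r; pose proof (pos_INR J); lra. }
  assert (Hi : forall i, (i <= J + 1)%nat -> flat_at rho h (fun n => x n + INR i * w * y n)).
  { induction i as [|i IH]; intros Hle.
    - intros e He; apply filter_imp with (2 := Hf e He); intros n H t Ht.
      simpl; rewrite !Rmult_0_l, Rplus_0_r; auto.
    - assert (E : forall n, x n + INR i * w * y n + w * y n = x n + INR (Datatypes.S i) * w * y n).
      { intros n; rewrite S_INR; ring. }
      assert (Hst : flat_at rho h (fun n => (x n + INR i * w * y n) + w * y n)).
      { apply flat_at_step with C; auto; [apply IH; lia| |].
        - intros n; rewrite Rabs_mult, (Rabs_pos_eq w) by lra.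
          specialize (Hy n); nra.
        - assert (Hb : forall n, Rabs (INR (Datatypes.S i) * w * y n) <= S).
          { intros n; rewrite Rabs_mult.
            assert (Hc : 0 <= INR (Datatypes.S i) * w <= 1).
            { split; [apply Rmult_le_pos; [apply pos_INR|lra]|].
              rewrite <- HJ1; apply Rmult_le_compat_r; [lra|].
              apply le_INR in Hle; rewrite plus_INR in Hle; simpl (INR 1) in Hle; lra. }
            rewrite (Rabs_pos_eq (_ * w)) by lra.
            specialize (Hy n); pose proof (Rabs_pos (y n)); nra. }
          apply filter_imp with (2 := Hn _ Hb).
          intros n Hno; cbv beta in *; rewrite E; eapply anorm_le_ext; [|exact Hno].
          intros t _; reflexivity. }
      intros e He; apply filter_imp with (2 := Hst e He); intros n H t Ht.
      rewrite <- E; auto. }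
  intros e He; apply filter_imp with (2 := Hi (J + 1)%nat (Nat.le_refl _) e He).
  intros n H t Ht; specialize (H t Ht).
  rewrite plus_INR in H; simpl (INR 1) in H; rewrite HJ1, Rmult_1_l in H; exact H.
Qed.

Lemma ln_lip (u v s : R) : 0 < s -> s <= u -> s <= v -> Rabs (ln u - ln v) <= Rabs (u - v) / s.
Proof.
  assert (H : forall u v s, 0 < s -> s <= u -> s <= v -> ln u - ln v <= Rabs (u - v) / s).
  { clear; intros u v s Hs Hu Hv.
    rewrite <- ln_div by lra.
    pose proof (exp_ge_plus1 (ln (u / v))) as E.
    rewrite exp_ln in E by (apply Rdiv_lt_0_compat; lra).
    apply Rle_trans with (u / v - 1); [lra|].
    replace (u / v - 1) with ((u - v) * / v) by (field; lra).
    apply Rle_trans with (Rabs (u - v) * / v).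
    - apply Rmult_le_compat_r; [left; apply Rinv_0_lt_compat; lra|apply Rle_abs].
    - apply Rmult_le_compat_l; [apply Rabs_pos|apply Rinv_le_contravar; lra]. }
  intros Hs Hu Hv; apply Rabs_le; split.
  - pose proof (H v u s Hs Hv Hu) as E; rewrite Rabs_minus_sym in E; lra.
  - now apply H.
Qed.

Lemma in_U_0 : in_U 0.
Proof. unfold in_U; lra. Qed.

Lemma in_U_dist (y z : R) : in_U y -> in_U z -> Rabs (y - z) <= 2.
Proof. unfold in_U; intros; apply Rabs_le; lra. Qed.

Lemma is_lim_seq_unique_R (u : nat -> R) (l l' : R) :
  is_lim_seq u l -> is_lim_seq u l' -> l = l'.
Proof.
  intros H H'; pose proof (is_lim_seq_unique _ _ H) as E.
  rewrite (is_lim_seq_unique _ _ H') in E; now injection E.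
Qed.

(** One half of the decay, a power of [sqrt nu], absorbs [INR n] by Bernoulli's inequality. *)
Lemma pow_lim_zero_INR (nu C : R) : 0 < nu < 1 ->
  forall e, 0 < e -> exists N, forall n, (N <= n)%nat -> INR n * C * nu ^ n < e.
Proof.
  intros Hnu e He.
  set (sg := sqrt nu).
  assert (Hsg : 0 < sg < 1).
  { split; [apply sqrt_lt_R0; lra|rewrite <- sqrt_1; apply sqrt_lt_1_alt; lra]. }
  assert (Esg : nu = sg * sg) by (symmetry; apply sqrt_sqrt; lra).
  set (w := / sg - 1).
  assert (Hw : 0 < w).
  { unfold w; pose proof (Rinv_lt_contravar sg 1 ltac:(lra) ltac:(lra)); rewrite Rinv_1 in *; lra. }
  assert (Hn : forall n, INR n * sg ^ n <= / w).
  { intros n; pose proof (poly n w Hw) as HB.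
    replace (1 + w) with (/ sg) in HB by (unfold w; ring); rewrite pow_inv in HB.
    assert (Hp : 0 < sg ^ n) by (apply pow_lt; lra).
    apply Rmult_le_compat_r with (r := sg ^ n) in HB; [|lra].
    rewrite Rinv_l in HB by lra.
    apply Rmult_le_reg_r with w; [exact Hw|]; rewrite Rinv_l by lra; lra. }
  destruct (pow_lim_zero sg (/ w * Rabs C) ltac:(lra) e He) as [N HN].
  exists N; intros n HnN; eapply Rle_lt_trans; [|apply (HN n HnN)].
  rewrite Esg, Rpow_mult_distr.
  assert (Hp : 0 < sg ^ n) by (apply pow_lt; lra).
  replace (INR n * C * (sg ^ n * sg ^ n)) with ((INR n * sg ^ n) * C * sg ^ n) by ring.
  apply Rmult_le_compat_r; [lra|].
  apply Rle_trans with (INR n * sg ^ n * Rabs C).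
  - apply Rmult_le_compat_l; [apply Rmult_le_pos; [apply pos_INR|lra]|apply Rle_abs].
  - apply Rmult_le_compat_r; [apply Rabs_pos|apply Hn].
Qed.

Lemma ln_near_1 (u e : R) : 0 < e <= 1 -> Rabs (u - 1) < e / 2 -> Rabs (ln (Rabs u)) < e.
Proof.
  intros He Hu; pose proof Hu as Hu'; apply Rabs_def2 in Hu'.
  rewrite (Rabs_pos_eq u) by lra.
  pose proof (ln_lip u 1 (1 / 2) ltac:(lra) ltac:(lra) ltac:(lra)) as H.
  rewrite ln_1, Rminus_0_r in H; lra.
Qed.

Lemma continuity_separation (h : R -> R) (x e : R) :
  continuity h -> 0 < e ->
  exists d, 0 < d /\ forall y, Rabs (y - x) < d -> Rabs (h y - h x) < e.
Proof.
  intros Hc He; destruct (Hc x e He) as [d [Hd H]]; exists d; split; [exact Hd|].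
  intros y Hy; destruct (Req_dec x y) as [->|Hxy].
  - rewrite Rminus_diag, Rabs_R0; exact He.
  - apply (H y); split; [split; [exact I|exact Hxy]|exact Hy].
Qed.

(** Both strict inequalities are open in [x], so compactness bounds simultaneously the translate [M]
    and the separation from below. *)
Lemma uniform_separation (h : R -> R) (e : R) : continuity h ->
  (forall x, 0 <= x <= 1 -> exists M : nat, 0 < Rabs (h (x + INR M) - h x) < e) ->
  exists n : nat, forall x, 0 <= x <= 1 -> exists M : nat, (M <= n)%nat /\
    / (INR n + 1) <= Rabs (h (x + INR M) - h x) < e.
Proof.
  intros Hc H; apply compact_uniform.
  - intros x n m Hnm [M [HM B]]; exists M; split; [lia|].
    pose proof (inv_INR_decr n m Hnm); lra.
  - intros x Hx; destruct (H x Hx) as [M HM].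
    set (w := Rabs (h (x + INR M) - h x)) in *.
    set (g := Rmin (w / 2) (e - w)).
    assert (Hg : 0 < g) by (apply Rmin_pos; lra).
    assert (Hg1 : g <= w / 2) by apply Rmin_l.
    assert (Hg2 : g <= e - w) by apply Rmin_r.
    destruct (continuity_separation h x (g / 2) Hc ltac:(lra)) as [d1 [Hd1 H1]].
    destruct (continuity_separation h (x + INR M) (g / 2) Hc ltac:(lra)) as [d2 [Hd2 H2]].
    destruct (exists_inv_le (w / 2)) as [n0 Hn0]; [lra|].
    exists (n0 + M)%nat, (Rmin d1 d2); split; [now apply Rmin_pos|]; intros y Hy Hyx.
    exists M; split; [lia|].
    pose proof (inv_INR_decr n0 (n0 + M) ltac:(lia)).
    specialize (H1 y ltac:(eapply Rlt_le_trans; [exact Hyx|apply Rmin_l])).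
    assert (Hy2 : Rabs (y + INR M - (x + INR M)) < d2).
    { replace (y + INR M - (x + INR M)) with (y - x) by ring.
      eapply Rlt_le_trans; [exact Hyx|apply Rmin_r]. }
    specialize (H2 _ Hy2).
    assert (E : Rabs ((h (y + INR M) - h y) - (h (x + INR M) - h x)) < g).
    { replace ((h (y + INR M) - h y) - (h (x + INR M) - h x))
        with ((h (y + INR M) - h (x + INR M)) - (h y - h x)) by ring.
      eapply Rle_lt_trans; [apply Rabs_triang|]; rewrite Rabs_Ropp; lra. }
    pose proof (Rabs_triang_inv2 (h (y + INR M) - h y) (h (x + INR M) - h x)) as T.
    fold w in T; apply Rabs_le_between in T.
    revert E T; generalize (Rabs (h (y + INR M) - h y - (h (x + INR M) - h x))).
    intros z E T; lra.
Qed.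

Lemma pseries_zeros_0 (c : nat -> R) :
  Rbar_lt 0 (CV_radius c) ->
  (forall e, 0 < e -> exists t, 0 < Rabs t < e /\ PSeries c t = 0) -> c 0%nat = 0.
Proof.
  intros Hc Hz; apply cond_eq; intros e He.
  assert (Hcont : continuity_pt (PSeries c) 0).
  { apply PSeries_continuity; rewrite Rabs_R0; exact Hc. }
  destruct (Hcont e He) as [d [Hd H]]; destruct (Hz d Hd) as [t [Ht Et]].
  assert (Hne : 0 <> t) by (intros <-; rewrite Rabs_R0 in Ht; lra).
  specialize (H t); simpl in H; unfold Rdist in H.
  rewrite Et, PSeries_0, Rminus_0_r in H.
  rewrite Rminus_0_r; rewrite Rminus_0_l, Rabs_Ropp in H; apply H.
  split; [split; [exact I|exact Hne]|lra].
Qed.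

(** The identity theorem at an accumulation point of zeros: continuity kills the constant
    coefficient, and the zeros, being different from 0, survive division by [t]. *)
Lemma pseries_zeros (c : nat -> R) :
  Rbar_lt 0 (CV_radius c) ->
  (forall e, 0 < e -> exists t, 0 < Rabs t < e /\ PSeries c t = 0) -> forall k, c k = 0.
Proof.
  intros Hc Hz k; revert c Hc Hz; induction k as [|k IH]; intros c Hc Hz.
  - now apply pseries_zeros_0.
  - apply (IH (PS_decr_1 c)); [now rewrite CV_radius_decr_1|].
    intros e He; destruct (Hz e He) as [t [Ht Et]]; exists t; split; [exact Ht|].
    rewrite (PSeries_decr_1_aux c t (pseries_zeros_0 c Hc Hz)) in Et.
    apply Rmult_integral in Et.
    destruct Et as [->|Et]; [rewrite Rabs_R0 in Ht; lra|exact Et].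
Qed.

Lemma Derive_shift (h : R -> R) (q X : R) : Derive (fun x => h (x + q)) X = Derive h (X + q).
Proof. exact (Derive_n_comp_trans h 1 X q). Qed.

(** * The skew product in coordinates on the line *)

(** The map and its constants without reference to the circle. The constraint [sd_rho_L] makes the
    bound [eta] on curves invariant under the graph transform; [sd_eta_eps] lets two curves at
    distance [eps / 4] fit with their increments in one ball of radius [eps]. *)
Record skew_data : Type := {
  sd_b : nat;
  sd_g : R -> R -> R;
  sd_f : R -> R;
  sd_fi : R -> R;
  sd_eps : R; sd_L : R; sd_lam : R; sd_r : R; sd_kap : R; sd_rho : R; sd_eta : R;
  sd_b_pos : (1 <= sd_b)%nat;
  sd_per : forall x (q : Z) y, sd_g (x + IZR q) y = sd_g x y;
  sd_inU : forall x y, in_U y -> in_U (sd_g x y);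
  sd_good : forall x y, in_U y -> good_secant sd_g sd_eps sd_L sd_lam sd_r x y;
  sd_fi_Z : forall X (q : Z), sd_fi (X + INR sd_b * IZR q) = sd_fi X + IZR q;
  sd_fi_f : forall Y, sd_fi (sd_f Y) = Y;
  sd_f_pos : forall Y, 0 <= Y -> 0 <= sd_f Y;
  sd_fi_01 : forall X, 0 <= X <= INR sd_b -> 0 <= sd_fi X <= 1;
  sd_fi_der : forall X, Derive sd_fi X <> 0;
  sd_fi_norm : forall X, anorm_le sd_rho (sd_kap * sd_rho) (fun t => sd_fi (X + t) - sd_fi X);
  sd_eps_pos : 0 < sd_eps;
  sd_L_pos : 0 <= sd_L;
  sd_lam_bd : 0 < sd_lam < 1;
  sd_r_pos : 0 < sd_r;
  sd_kap_bd : 0 < sd_kap < 1;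
  sd_rho_pos : 0 < sd_rho;
  sd_rho_eta : sd_rho <= sd_eta;
  sd_rho_L : sd_L * sd_rho <= (1 - sd_kap) * sd_eta;
  sd_eta_eps : sd_eta <= sd_eps / 4
}.

Section Dynamics.

Variable D : skew_data.

Let b := sd_b D.
Let gl := sd_g D.
Let Fi := sd_fi D.
Let eps := sd_eps D.
Let L := sd_L D.
Let lam := sd_lam D.
Let r := sd_r D.
Let kap := sd_kap D.
Let rho := sd_rho D.
Let eta := sd_eta D.
Let b_pos : (1 <= b)%nat := sd_b_pos D.
Let gl_per : forall x (q : Z) y, gl (x + IZR q) y = gl x y := sd_per D.
Let gl_U : forall x y, in_U y -> in_U (gl x y) := sd_inU D.
Let gl_good : forall x y, in_U y -> good_secant gl eps L lam r x y := sd_good D.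
Let Fi_Z : forall X (q : Z), Fi (X + INR b * IZR q) = Fi X + IZR q := sd_fi_Z D.
Let Fi_norm : forall X, anorm_le rho (kap * rho) (fun t => Fi (X + t) - Fi X) := sd_fi_norm D.
Let Heps : 0 < eps := sd_eps_pos D.
Let HL : 0 <= L := sd_L_pos D.
Let Hlam : 0 < lam < 1 := sd_lam_bd D.
Let Hr : 0 < r := sd_r_pos D.
Let Hkap : 0 < kap < 1 := sd_kap_bd D.
Let Hrho : 0 < rho := sd_rho_pos D.
Let Hrho_eta : rho <= eta := sd_rho_eta D.
Let Hrho_L : L * rho <= (1 - kap) * eta := sd_rho_L D.
Let Heta_eps : eta <= eps / 4 := sd_eta_eps D.

Definition graph_tr (a : R -> R) (X : R) : R := gl (Fi X) (a (Fi X)).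
Definition gtr (n : nat) (a : R -> R) : R -> R := Nat.iter n graph_tr a.
Definition back (n : nat) (X : R) : R := Nat.iter n Fi X.

Definition valued_U (a : R -> R) : Prop := forall X, in_U (a X).
(** Increments are bounded instead of values: [eta] has to be small against [eps], whereas the
    values range over all of [U]. Radius and bound are the same at every base point. *)
Definition curve (a : R -> R) : Prop :=
  valued_U a /\ forall X, anorm_le rho eta (fun t => a (X + t) - a X).

Lemma back_S (n : nat) (X : R) : back (S n) X = back n (Fi X).
Proof. apply Nat.iter_succ_r. Qed.

Lemma back_add (n m : nat) (X : R) : back (n + m) X = back n (back m X).
Proof. apply Nat.iter_add. Qed.

Lemma gtr_add (n m : nat) (a : R -> R) : gtr (n + m) a = gtr n (gtr m a).
Proof. apply Nat.iter_add. Qed.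

Lemma gtr_U (n : nat) (a : R -> R) : valued_U a -> valued_U (gtr n a).
Proof. intros H; induction n as [|n IH]; [exact H|]; intros X; apply gl_U, IH. Qed.

Lemma const_U (c : R) : in_U c -> valued_U (fun _ => c).
Proof. now intros H X. Qed.

Lemma eta_pos : 0 < eta.
Proof. lra. Qed.

Lemma gl_secant_bounds (x y z : R) :
  in_U y -> in_U z -> r <= Rabs (secant gl x y z) <= lam.
Proof.
  apply secant_bounds.
  - intros c Hc; apply (gl_good x c Hc); rewrite Rminus_diag, Rabs_R0; lra.
  - intros c Hc; destruct (gl_good x c Hc) as [H1 [_ [H3 _]]].
    assert (Hb : ball3 x c eps x c c) by (unfold ball3; rewrite !Rminus_diag, Rabs_R0; lra).
    split; [now apply H3|exact (op_bound_val _ _ _ _ _ _ _ _ _ H1 Hb)].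
Qed.

Lemma gl_is_derive (x y : R) : in_U y -> is_derive (gl x) y (Derive (gl x) y).
Proof.
  intros Hy; rewrite <- secant_diag.
  apply (gl_good x y Hy); rewrite Rminus_diag, Rabs_R0; lra.
Qed.

Lemma gl_contract (x y z : R) :
  in_U y -> in_U z -> Rabs (gl x y - gl x z) <= lam * Rabs (y - z).
Proof.
  intros Hy Hz; rewrite secant_spec, Rabs_mult; apply Rmult_le_compat_r; [apply Rabs_pos|].
  now apply gl_secant_bounds.
Qed.

Lemma gl_inj (x y z : R) : in_U y -> in_U z -> gl x y = gl x z -> y = z.
Proof.
  intros Hy Hz H; apply NNPP; intros Hyz.
  pose proof (secant_spec gl x y z) as E; rewrite H, Rminus_diag in E.
  pose proof (proj1 (gl_secant_bounds x y z Hy Hz)) as B.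
  symmetry in E; apply Rmult_integral in E; destruct E as [E|E]; [|lra].
  rewrite E, Rabs_R0 in B; lra.
Qed.

Lemma Fi_lip (X X' : R) : Rabs (Fi X - Fi X') <= kap * Rabs (X - X').
Proof.
  assert (H0 : 0 <= kap * rho) by (apply Rmult_le_pos; lra).
  pose proof (anorm_le_increment_lip rho (kap * rho) Fi Hrho H0 Fi_norm X' X) as H.
  replace (kap * rho / rho) with kap in H by (field; lra); exact H.
Qed.

Lemma back_lip (n : nat) (X X' : R) : Rabs (back n X - back n X') <= kap ^ n * Rabs (X - X').
Proof.
  induction n as [|n IH]; simpl; [lra|].
  eapply Rle_trans; [apply Fi_lip|]; rewrite Rmult_assoc; apply Rmult_le_compat_l; [lra|exact IH].
Qed.

Lemma curve_lip (a : R -> R) : curve a ->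
  forall X X', Rabs (a X - a X') <= eta / rho * Rabs (X - X').
Proof.
  intros [_ H] X X'; apply (anorm_le_increment_lip rho eta a Hrho); [lra|exact H].
Qed.

Lemma back_norm (n : nat) (X : R) :
  anorm_le rho (kap ^ n * rho) (fun t => back n (X + t) - back n X).
Proof.
  induction n as [|n IH].
  - simpl; rewrite Rmult_1_l; apply anorm_le_ext with (fun t => t); [intros; ring|].
    apply anorm_le_id; lra.
  - pose proof (pow_le_1 kap n ltac:(lra)) as Hk.
    replace (kap ^ S n * rho) with (kap ^ n * (kap * rho)) by (simpl; ring).
    apply anorm_le_ext with (fun t => Fi (back n X + (back n (X + t) - back n X)) - Fi (back n X)).
    { intros t _; simpl; f_equal; f_equal; ring. }
    apply (anorm_le_comp rho rho (kap * rho) (kap ^ n * rho) (kap ^ n)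
      (fun s => Fi (back n X + s) - Fi (back n X))); auto; try lra.
    + rewrite Rplus_0_r; ring.
    + intros t Ht; eapply Rle_lt_trans; [apply back_lip|].
      replace (X + t - X) with t by ring; pose proof (Rabs_pos t); nra.
Qed.

Lemma curve_comp (a : R -> R) (n : nat) (X : R) : curve a ->
  anorm_le rho (kap ^ n * eta) (fun t => a (back n (X + t)) - a (back n X)).
Proof.
  intros [_ Ha].
  pose proof (pow_le_1 kap n ltac:(lra)) as Hk.
  apply anorm_le_ext with (fun t => a (back n X + (back n (X + t) - back n X)) - a (back n X)).
  { intros t _; f_equal; f_equal; ring. }
  apply (anorm_le_comp rho rho eta (kap ^ n * rho) (kap ^ n)
    (fun s => a (back n X + s) - a (back n X))); auto; try lra.
  - rewrite Rplus_0_r; ring.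
  - apply back_norm.
  - intros t Ht; eapply Rle_lt_trans; [apply back_lip|].
    replace (X + t - X) with t by ring; pose proof (Rabs_pos t); nra.
Qed.

(** The increment splits into a divided difference times the increment of [a], of norm at most
    [lam * kap * eta], and a variation of the base point in a fixed fibre coordinate, at most
    [L * kap * rho]; the choice of [rho] makes the sum at most [eta]. *)
Lemma graph_tr_curve (a : R -> R) : curve a -> curve (graph_tr a).
Proof.
  intros Ha; split; [intros X; apply gl_U, Ha|]; intros X.
  set (x1 := Fi X); set (y1 := a x1).
  destruct (gl_good x1 y1 (proj1 Ha x1)) as [H1 [H2 _]].
  pose proof (back_norm 1 X) as N1; simpl in N1; rewrite Rmult_1_r in N1; fold x1 in N1.
  pose proof (curve_comp a 1 X Ha) as N2; simpl in N2; rewrite Rmult_1_r in N2.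
  fold x1 in N2; fold y1 in N2.
  assert (Hkr : kap * rho <= eps) by nra.
  assert (Hke : kap * eta <= eps) by nra.
  assert (Hz : forall c M, 0 <= M -> anorm_le rho M (fun _ => c - c)).
  { intros c M HM; apply anorm_le_const_le; [lra|rewrite Rminus_diag, Rabs_R0; exact HM]. }
  assert (A : near3 rho x1 y1 eps (fun t => Fi (X + t)) (fun t => a (Fi (X + t))) (fun _ => y1)).
  { split; [now apply anorm_le_weaken with (2 := N1)|split].
    - now apply anorm_le_weaken with (2 := N2).
    - apply Hz; lra. }
  assert (B : near3 rho x1 y1 eps (fun t => Fi (X + t)) (fun _ => y1) (fun _ => y1)).
  { split; [now apply anorm_le_weaken with (2 := N1)|split]; apply Hz; lra. }
  assert (C : near3 rho x1 y1 eps (fun _ => x1) (fun _ => y1) (fun _ => y1)).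
  { split; [|split]; apply Hz; lra. }
  destruct (H1 rho 0 _ _ _ _ _ _ Hrho A A (dist3_refl rho 0 _ _ _ Hrho ltac:(lra)))
    as [S1 _].
  destruct (H2 rho (kap * rho) _ _ _ _ _ _ Hrho B C) as [_ S2].
  { split; [exact N1|split]; apply Hz; nra. }
  pose proof (anorm_le_mult rho _ _ _ _ ltac:(lra) S1 N2) as S3.
  pose proof (anorm_le_plus rho _ _ _ _ ltac:(lra) S3 S2) as S4.
  eapply anorm_le_ext; [|apply anorm_le_weaken with (2 := S4)].
  - intros t _; simpl; unfold graph_tr; fold x1; fold y1.
    rewrite <- secant_spec; ring.
  - assert (L * (kap * rho) <= (1 - kap) * eta).
    { replace (L * (kap * rho)) with (kap * (L * rho)) by ring.
      apply Rle_trans with (1 * (L * rho)); [|lra].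
      apply Rmult_le_compat_r; [apply Rmult_le_pos; lra|lra]. }
    assert (lam * (kap * eta) <= kap * eta).
    { assert (0 <= kap * eta) by (apply Rmult_le_pos; lra). nra. }
    lra.
Qed.

Lemma gtr_curve (n : nat) (a : R -> R) : curve a -> curve (gtr n a).
Proof. intros H; induction n as [|n IH]; [exact H|now apply graph_tr_curve]. Qed.

Lemma curve_shift (a : R -> R) (q : R) : curve a -> curve (fun X => a (X + q)).
Proof.
  intros [H1 H2]; split; [intros X; apply H1|]; intros X.
  eapply anorm_le_ext; [|apply (H2 (X + q))].
  intros t _; simpl; f_equal; f_equal; ring.
Qed.

Lemma curve_0 : curve (fun _ => 0).
Proof.
  split; [intros X; apply in_U_0|]; intros X.
  apply anorm_le_const_le; [lra|]; rewrite Rminus_diag, Rabs_R0; apply Rlt_le, eta_pos.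
Qed.

Lemma gtr_contract (n : nat) (a c : R -> R) (X : R) : valued_U a -> valued_U c ->
  Rabs (gtr n a X - gtr n c X) <= lam ^ n * Rabs (a (back n X) - c (back n X)).
Proof.
  intros Ha Hc; revert X; induction n as [|n IH]; intros X; [simpl; lra|].
  change (Rabs (gl (Fi X) (gtr n a (Fi X)) - gl (Fi X) (gtr n c (Fi X))) <=
    lam * lam ^ n * Rabs (a (back (S n) X) - c (back (S n) X))).
  rewrite back_S; eapply Rle_trans; [apply gl_contract; now apply gtr_U|].
  rewrite Rmult_assoc; apply Rmult_le_compat_l; [lra|apply IH].
Qed.

Lemma gtr_contract2 (n : nat) (a c : R -> R) (X : R) : valued_U a -> valued_U c ->
  Rabs (gtr n a X - gtr n c X) <= 2 * lam ^ n.
Proof.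
  intros Ha Hc; eapply Rle_trans; [now apply gtr_contract|].
  rewrite Rmult_comm; apply Rmult_le_compat_r; [apply pow_le; lra|now apply in_U_dist].
Qed.

Lemma gtr_contract1 (n : nat) (a c : R -> R) (X : R) : valued_U a -> valued_U c ->
  Rabs (gtr n a X - gtr n c X) <= Rabs (a (back n X) - c (back n X)).
Proof.
  intros Ha Hc; eapply Rle_trans; [now apply gtr_contract|].
  pose proof (pow_le_1 lam n ltac:(lra)).
  pose proof (Rabs_pos (a (back n X) - c (back n X))); nra.
Qed.

(** Source of the power of [r_min]: it is applied with [s] equal to that minimum. *)
Lemma gtr_lower (n : nat) (a c : R -> R) (X s : R) : valued_U a -> valued_U c ->
  0 <= s -> (forall x y, in_U y -> s <= Rabs (Derive (gl x) y)) ->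
  s ^ n * Rabs (a (back n X) - c (back n X)) <= Rabs (gtr n a X - gtr n c X).
Proof.
  intros Ha Hc Hs Hd; revert X; induction n as [|n IH]; intros X; [simpl; lra|].
  change (s * s ^ n * Rabs (a (back (S n) X) - c (back (S n) X)) <=
    Rabs (gl (Fi X) (gtr n a (Fi X)) - gl (Fi X) (gtr n c (Fi X)))).
  rewrite back_S, secant_spec, Rabs_mult, Rmult_assoc.
  apply Rmult_le_compat; [lra| |  |apply IH].
  - apply Rmult_le_pos; [now apply pow_le|apply Rabs_pos].
  - apply (secant_bounds gl lam s); try now apply gtr_U.
    + intros y Hy; rewrite secant_diag; now apply gl_is_derive.
    + intros y Hy; split; [rewrite secant_diag; now apply Hd|now apply gl_secant_bounds].
Qed.

Lemma gtr_inj (n : nat) (a c : R -> R) (X : R) : valued_U a -> valued_U c ->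
  gtr n a X = gtr n c X -> a (back n X) = c (back n X).
Proof.
  intros Ha Hc; revert X; induction n as [|n IH]; intros X H; [exact H|].
  rewrite back_S; apply IH.
  apply (gl_inj (Fi X)); [now apply gtr_U|now apply gtr_U|exact H].
Qed.

(** Each backward step divides a translation by [b], and [gl] does not see integer translations of
    the base. This is what turns concatenation of words into composition of graph transforms. *)
Lemma gtr_shift (n : nat) (a : R -> R) (X : R) (q : Z) :
  gtr n a (X + IZR (Z.of_nat b ^ Z.of_nat n * q)) = gtr n (fun Y => a (Y + IZR q)) X.
Proof.
  revert X; induction n as [|n IH]; intros X.
  - rewrite Z.pow_0_r, Z.mul_1_l; reflexivity.
  - rewrite Nat2Z.inj_succ, Z.pow_succ_r, <- Z.mul_assoc, mult_IZR, <- INR_IZR_INZ by lia.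
    change (gl (Fi (X + INR b * IZR (Z.of_nat b ^ Z.of_nat n * q)))
      (gtr n a (Fi (X + INR b * IZR (Z.of_nat b ^ Z.of_nat n * q))))
      = gl (Fi X) (gtr n (fun Y => a (Y + IZR q)) (Fi X))).
    now rewrite Fi_Z, gl_per, IH.
Qed.

Lemma back_shift (n : nat) (X : R) (q : Z) :
  back n (X + IZR (Z.of_nat b ^ Z.of_nat n * q)) = back n X + IZR q.
Proof.
  revert X; induction n as [|n IH]; intros X.
  - rewrite Z.pow_0_r, Z.mul_1_l; reflexivity.
  - rewrite Nat2Z.inj_succ, Z.pow_succ_r, <- Z.mul_assoc, mult_IZR, <- INR_IZR_INZ by lia.
    now rewrite !back_S, Fi_Z, IH.
Qed.

(* Each application of [graph_tr] multiplies the difference of two curves by a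
   divided difference of [gl]; at the j-th backward step this factor is constant
   up to a relative error of order [kap ^ j], whence the bounded distortion. *)
Lemma gtr_diff_norm (a c : R -> R) (del : R) (n j : nat) (X : R) :
  curve a -> curve c -> 0 < del ->
  del <= Rabs (a (back (n + j) X) - c (back (n + j) X)) <= eps / 4 ->
  anorm_le rho ((1 + 2 * eta / del) * exp (L * eta / r * kap ^ S j / (1 - kap))
      * Rabs (gtr n a (back j X) - gtr n c (back j X)))
    (fun t => gtr n a (back j (X + t)) - gtr n c (back j (X + t))).
Proof.
  intros Ha Hc Hdel; revert j; induction n as [|n IH]; intros j Hb.
  - simpl in *.
    pose proof (pow_le_1 kap j ltac:(lra)) as Hk.
    pose proof eta_pos as Heta.
    set (d0 := a (back j X) - c (back j X)) in *.
    (* Without any step left, both increments have norm at most [eta] while the difference is at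
       least [del]; this is the factor [1 + 2 * eta / del]. *)
    apply anorm_le_weaken with ((Rabs d0 + kap ^ j * eta) + kap ^ j * eta).
    + assert (E1 : 1 <= exp (L * eta / r * (kap * kap ^ j) / (1 - kap))).
      { apply exp_ge_1; apply Rdiv_le_0_compat; [|lra].
        apply Rmult_le_pos; [apply Rdiv_le_0_compat; nra|nra]. }
      assert (E2 : Rabs d0 + 2 * eta <= (1 + 2 * eta / del) * Rabs d0).
      { assert (2 * eta <= 2 * eta / del * Rabs d0).
        { apply Rle_trans with (2 * eta / del * del); [right; field; lra|].
          apply Rmult_le_compat_l; [apply Rdiv_le_0_compat; lra|lra]. }
        lra. }
      apply Rle_trans with (Rabs d0 + 2 * eta); [nra|].
      apply Rle_trans with ((1 + 2 * eta / del) * Rabs d0); [exact E2|].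
      assert (0 <= (1 + 2 * eta / del) * Rabs d0) by (pose proof (Rabs_pos d0); lra).
      nra.
    + pose proof (anorm_le_plus rho _ _ _ _ ltac:(lra)
        (anorm_le_const rho d0 ltac:(lra)) (curve_comp a j X Ha)) as S1.
      pose proof (anorm_le_minus rho _ _ _ _ ltac:(lra) S1 (curve_comp c j X Hc)) as S2.
      eapply anorm_le_ext; [|exact S2]; intros t _; simpl; unfold d0; ring.
  - replace (S n + j)%nat with (n + S j)%nat in Hb by lia.
    specialize (IH (S j) Hb).
    set (al := gtr n a) in *; set (be := gtr n c) in *.
    assert (Hal : curve al) by now apply gtr_curve.
    assert (Hbe : curve be) by now apply gtr_curve.
    set (x1 := back (S j) X) in *; set (y1 := al x1); set (z1 := be x1).
    assert (Hyz : Rabs (z1 - y1) <= eps / 4).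
    { rewrite Rabs_minus_sym; unfold y1, z1, al, be, x1.
      eapply Rle_trans; [apply gtr_contract1; [apply Ha|apply Hc]|].
      rewrite <- back_add; lra. }
    destruct (gl_good x1 y1 (proj1 Hal x1)) as [H1 [_ [H3 _]]].
    pose proof (pow_le_1 kap (S j) ltac:(lra)) as Hk.
    pose proof eta_pos as Heta.
    set (k1 := kap ^ S j) in *.
    pose proof (back_norm (S j) X) as N1; fold x1 in N1; fold k1 in N1.
    pose proof (curve_comp al (S j) X Hal) as N2; fold x1 in N2; fold k1 in N2; fold y1 in N2.
    pose proof (curve_comp be (S j) X Hbe) as N3; fold x1 in N3; fold k1 in N3; fold z1 in N3.
    assert (A : near3 rho x1 y1 eps (fun t => back (S j) (X + t))
      (fun t => al (back (S j) (X + t))) (fun t => be (back (S j) (X + t)))).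
    { split; [apply anorm_le_weaken with (2 := N1); nra|split].
      - apply anorm_le_weaken with (2 := N2); nra.
      - apply anorm_le_shift with (2 := N3); [lra|nra]. }
    assert (Bc : ball3 x1 y1 eps x1 y1 z1).
    { unfold ball3; rewrite !Rminus_diag, Rabs_R0; lra. }
    pose proof (ball3_near3 rho _ _ _ _ _ _ Hrho Bc) as B.
    destruct (H1 rho (k1 * eta) _ _ _ _ _ _ Hrho A B) as [_ S1].
    { split; [apply anorm_le_weaken with (2 := N1); nra|split; auto]. }
    set (s0 := secant gl x1 y1 z1) in *.
    assert (Hs0 : r <= Rabs s0) by now apply H3.
    pose proof (anorm_le_plus rho _ _ _ _ ltac:(lra)
      (anorm_le_const rho s0 ltac:(lra)) S1) as S2.
    pose proof (anorm_le_mult rho _ _ _ _ ltac:(lra) S2 IH) as S3.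
    eapply anorm_le_ext; [|apply anorm_le_weaken with (2 := S3)].
    + intros t _; cbv beta; fold s0.
      change (gtr (S n) a (back j (X + t))) with
        (gl (back (S j) (X + t)) (al (back (S j) (X + t)))).
      change (gtr (S n) c (back j (X + t))) with
        (gl (back (S j) (X + t)) (be (back (S j) (X + t)))).
      rewrite secant_spec; ring.
    + change (gtr (S n) a (back j X)) with (gl x1 y1).
      change (gtr (S n) c (back j X)) with (gl x1 z1).
      rewrite secant_spec, Rabs_mult; fold s0.
      set (d1 := Rabs (y1 - z1)).
      assert (Hd1 : 0 <= d1) by apply Rabs_pos.
      set (C := L * eta / r).
      assert (HC : 0 <= C) by (apply Rdiv_le_0_compat; nra).
      assert (E1 : Rabs s0 + L * (k1 * eta) <= Rabs s0 * exp (C * k1)).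
      { pose proof (exp_ge_plus1 (C * k1)) as E.
        apply Rle_trans with (Rabs s0 * (1 + C * k1));
          [|apply Rmult_le_compat_l; [apply Rabs_pos|exact E]].
        assert (L * (k1 * eta) <= Rabs s0 * (C * k1)); [|lra].
        replace (L * (k1 * eta)) with (r * (C * k1)) by (unfold C; field; lra).
        apply Rmult_le_compat_r; [nra|exact Hs0]. }
      (* The exponent is a geometric tail: removing its first term [C * k1] pays for the relative
         error of the present factor. *)
      assert (E2 : exp (C * k1 / (1 - kap)) = exp (C * k1) * exp (C * kap ^ S (S j) / (1 - kap))).
      { rewrite <- exp_plus; f_equal; change (kap ^ S (S j)) with (kap * k1); field; lra. }
      rewrite E2.
      set (e2 := exp (C * kap ^ S (S j) / (1 - kap))).
      assert (He2 : 0 < e2) by apply exp_pos.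
      assert (Hq : 0 <= 2 * eta / del) by (apply Rdiv_le_0_compat; lra).
      apply Rle_trans with ((Rabs s0 * exp (C * k1)) * ((1 + 2 * eta / del) * e2 * d1));
        [|right; ring].
      apply Rmult_le_compat_r; [|exact E1].
      apply Rmult_le_pos; [apply Rmult_le_pos; lra|exact Hd1].
Qed.

Definition distortion (del : R) : R :=
  (1 + 2 * eta / del) * exp (L * eta / r * kap / (1 - kap)).

Lemma distortion_pos (del : R) : 0 < del -> 0 < distortion del.
Proof.
  intros H; apply Rmult_lt_0_compat; [|apply exp_pos].
  pose proof eta_pos; assert (0 <= 2 * eta / del) by (apply Rdiv_le_0_compat; lra); lra.
Qed.

Lemma gtr_diff_norm0 (a c : R -> R) (del : R) (n : nat) (X : R) :
  curve a -> curve c -> 0 < del ->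
  del <= Rabs (a (back n X) - c (back n X)) <= eps / 4 ->
  anorm_le rho (distortion del * Rabs (gtr n a X - gtr n c X))
    (fun t => gtr n a (X + t) - gtr n c (X + t)).
Proof.
  intros Ha Hc Hd Hb.
  pose proof (gtr_diff_norm a c del n 0 X Ha Hc Hd) as H; rewrite Nat.add_0_r in H.
  specialize (H Hb); simpl in H; rewrite Rmult_1_r in H; exact H.
Qed.

(** * The limit curve *)

Definition Theta (X : R) : R := real (Lim_seq (fun n => gtr n (fun _ => 0) X)).

Lemma gtr0_cauchy (n m : nat) (X : R) : (n <= m)%nat ->
  Rabs (gtr m (fun _ => 0) X - gtr n (fun _ => 0) X) <= 2 * lam ^ n.
Proof.
  intros H; replace m with (n + (m - n))%nat by lia; rewrite gtr_add.
  apply gtr_contract2; [apply gtr_U|]; apply const_U, in_U_0.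
Qed.

Lemma Theta_is_lim (X : R) : is_lim_seq (fun n => gtr n (fun _ => 0) X) (Theta X).
Proof.
  apply Lim_seq_correct', ex_lim_seq_cauchy_corr; intros e.
  destruct (pow_lim_zero lam 2 ltac:(lra) (e / 2)) as [N HN].
  { pose proof (cond_pos e); lra. }
  exists N; intros n m Hn Hm; specialize (HN N (Nat.le_refl N)).
  pose proof (gtr0_cauchy N n X Hn) as H1; pose proof (gtr0_cauchy N m X Hm) as H2.
  set (u := gtr n _ X) in *; set (v := gtr m _ X) in *; set (w := gtr N _ X) in *.
  replace (u - v) with ((u - w) - (v - w)) by ring.
  eapply Rle_lt_trans; [apply Rabs_triang|]; rewrite Rabs_Ropp; lra.
Qed.

Lemma Theta_U : valued_U Theta.
Proof.
  intros X; pose proof (Theta_is_lim X) as H; split.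
  - refine (is_lim_seq_le _ _ (-1) _ _ (is_lim_seq_const _) H).
    intros n; apply gtr_U, const_U, in_U_0.
  - refine (is_lim_seq_le _ _ _ 1 _ H (is_lim_seq_const _)).
    intros n; apply gtr_U, const_U, in_U_0.
Qed.

Lemma Theta_curve : curve Theta.
Proof.
  split; [exact Theta_U|]; intros X.
  apply anorm_le_lim with
    (fun n t => gtr n (fun _ => 0) (X + t) - gtr n (fun _ => 0) X); [exact Hrho| |].
  - intros n; apply (gtr_curve n _ curve_0).
  - intros t _; apply is_lim_seq_minus'; apply Theta_is_lim.
Qed.

Lemma Theta_inv (X : R) : gl (Fi X) (Theta (Fi X)) = Theta X.
Proof.
  apply is_lim_seq_unique_R with (fun n => gtr (S n) (fun _ => 0) X).
  - apply is_lim_seq_eps; intros e He.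
    pose proof (proj1 (is_lim_seq_eps _ _) (Theta_is_lim (Fi X)) e He) as [N HN].
    exists N; intros n Hn; specialize (HN n Hn).
    eapply Rle_lt_trans; [|exact HN].
    change (gtr (S n) (fun _ => 0) X) with (gl (Fi X) (gtr n (fun _ => 0) (Fi X))).
    eapply Rle_trans; [apply gl_contract; [apply gtr_U, const_U, in_U_0|apply Theta_U]|].
    pose proof (Rabs_pos (gtr n (fun _ => 0) (Fi X) - Theta (Fi X))); nra.
  - apply (is_lim_seq_incr_1 (fun n => gtr n (fun _ => 0) X)), Theta_is_lim.
Qed.

Lemma Theta_gtr (n : nat) (X : R) : gtr n Theta X = Theta X.
Proof.
  revert X; induction n as [|n IH]; intros X; [reflexivity|].
  change (gl (Fi X) (gtr n Theta (Fi X)) = Theta X); rewrite IH; apply Theta_inv.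
Qed.

Lemma Theta_approx (n : nat) (a : R -> R) (X : R) : valued_U a ->
  Rabs (gtr n a X - Theta X) <= 2 * lam ^ n.
Proof.
  intros Ha; rewrite <- (Theta_gtr n X); apply gtr_contract2; [exact Ha|exact Theta_U].
Qed.


(** * Logarithms of products of divided differences *)

Lemma lam_kap_sqrt : exists nu, 0 < nu < 1 /\ lam <= nu * nu /\ kap <= nu * nu.
Proof.
  exists (sqrt (Rmax lam kap)).
  assert (H : 0 < Rmax lam kap < 1) by (unfold Rmax; destruct (Rle_dec lam kap); lra).
  rewrite sqrt_sqrt by lra; repeat split.
  - apply sqrt_lt_R0; lra.
  - rewrite <- sqrt_1; apply sqrt_lt_1_alt; lra.
  - apply Rmax_l.
  - apply Rmax_r.
Qed.

Definition ln_secant (x y z : R) : R := ln (Rabs (secant gl x y z)).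

Lemma r_lt_1 : r < 1.
Proof.
  pose proof (gl_secant_bounds 0 0 0 in_U_0 in_U_0); lra.
Qed.

(** The first summand is the Lipschitz constant of the logarithm of the divided difference at
    distances up to [eps / 4]; beyond that distance the second one suffices, since the logarithms
    lie between [ln r] and 0. *)
Definition ln_const : R := L / r + 4 * (- ln r) / eps.

Lemma ln_r_neg : ln r < 0.
Proof. rewrite <- ln_1; apply ln_increasing; [exact Hr|exact r_lt_1]. Qed.

Lemma ln_const_nonneg : 0 <= ln_const.
Proof.
  pose proof ln_r_neg; unfold ln_const.
  assert (0 <= L / r) by (apply Rdiv_le_0_compat; lra).
  assert (0 <= 4 * (- ln r) / eps) by (apply Rdiv_le_0_compat; lra). lra.
Qed.

Lemma ln_secant_lip (x y z x' y' z' d : R) :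
  in_U y -> in_U z -> in_U y' -> in_U z' ->
  Rabs (y - z) <= eps / 4 -> Rabs (y' - z') <= eps / 4 ->
  Rabs (x - x') <= d -> Rabs (y - y') <= d -> Rabs (z - z') <= d ->
  Rabs (ln_secant x y z - ln_secant x' y' z') <= ln_const * d.
Proof.
  intros Hy Hz Hy' Hz' Hyz Hyz' Hx Hdy Hdz.
  assert (Hd : 0 <= d) by (pose proof (Rabs_pos (x - x')); lra).
  pose proof (gl_secant_bounds x y z Hy Hz) as B1.
  pose proof (gl_secant_bounds x' y' z' Hy' Hz') as B2.
  pose proof ln_r_neg as Hln.
  assert (Hp1 : 0 <= L / r) by (apply Rdiv_le_0_compat; lra).
  assert (Hp2 : 0 <= 4 * (- ln r) / eps) by (apply Rdiv_le_0_compat; lra).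
  unfold ln_const, ln_secant.
  destruct (Rle_lt_dec d (eps / 4)) as [Hde|Hde].
  - apply Rle_trans with (L / r * d); [|nra].
    eapply Rle_trans; [apply (ln_lip _ _ r); lra|].
    replace (L / r * d) with (L * d / r) by (field; lra).
    apply Rmult_le_compat_r; [left; now apply Rinv_0_lt_compat|].
    eapply Rle_trans; [apply Rabs_triang_inv2|].
    apply (op_bound_lip x y eps lam L d (secant gl)).
    + apply (gl_good x y Hy).
    + unfold ball3; rewrite !Rminus_diag, Rabs_R0, (Rabs_minus_sym z); lra.
    + unfold ball3; rewrite (Rabs_minus_sym x'), (Rabs_minus_sym y').
      replace (z' - y) with ((z' - y') + (y' - y)) by ring.
      pose proof (Rabs_triang (z' - y') (y' - y)) as T.
      rewrite (Rabs_minus_sym z'), (Rabs_minus_sym y' y) in T; lra.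
    + exact Hx.
    + exact Hdy.
    + exact Hdz.
  - apply Rle_trans with (4 * (- ln r) / eps * d); [|nra].
    apply Rle_trans with (- ln r).
    + assert (Hb : forall u, r <= u <= lam -> ln r <= ln u <= 0).
      { intros u Hu; split.
        - destruct (Req_dec r u) as [Eu|Hne]; [rewrite <- Eu; lra|left; apply ln_increasing; lra].
        - rewrite <- ln_1; left; apply ln_increasing; lra. }
      pose proof (Hb _ B1); pose proof (Hb _ B2); apply Rabs_le; lra.
    + replace (4 * (- ln r) / eps * d) with (- ln r * (4 * d / eps)) by (field; lra).
      rewrite <- (Rmult_1_r (- ln r)) at 1; apply Rmult_le_compat_l; [lra|].
      apply Rmult_le_reg_r with eps; [lra|].
      replace (4 * d / eps * eps) with (4 * d) by (field; lra); lra.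
Qed.

(** The logarithm of the product of divided differences met in [m] applications of the graph
    transform. For [a = c = Theta] it is a Birkhoff sum of the logarithm of the fibre derivative
    along the limit curve. *)
Fixpoint ln_sum (m : nat) (a c : R -> R) (X : R) : R :=
  match m with
  | O => 0
  | S m => ln_secant (Fi X) (gtr m a (Fi X)) (gtr m c (Fi X)) + ln_sum m a c (Fi X)
  end.

Lemma gtr_diff_ln_sum (m : nat) (a c : R -> R) (X : R) :
  valued_U a -> valued_U c -> a (back m X) <> c (back m X) ->
  ln (Rabs (gtr m a X - gtr m c X))
    = ln_sum m a c X + ln (Rabs (a (back m X) - c (back m X))).
Proof.
  intros Ha Hc; revert X; induction m as [|m IH]; intros X Hne.
  - simpl; ring.
  - rewrite back_S in *; simpl ln_sum.
    change (gtr (S m) a X) with (gl (Fi X) (gtr m a (Fi X))).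
    change (gtr (S m) c X) with (gl (Fi X) (gtr m c (Fi X))).
    rewrite secant_spec, Rabs_mult, ln_mult.
    + rewrite IH by exact Hne; unfold ln_secant; ring.
    + pose proof (gl_secant_bounds (Fi X) _ _ (gtr_U m a Ha (Fi X)) (gtr_U m c Hc (Fi X))); lra.
    + apply Rabs_pos_lt; intros E; apply Hne, (gtr_inj m); auto; lra.
Qed.

(* A factor at the j-th step out of m depends on the pair of curves up to
   [lam ^ (m - j)], and on the base point up to [kap ^ j]; the geometric mean of
   the two bounds is uniform in j. *)
Lemma ln_sum_compare (nu : R) (a c a' c' : R -> R) (X X' : R) (m j : nat) :
  0 < nu < 1 -> lam <= nu * nu -> kap <= nu * nu ->
  curve a -> curve c -> curve a' -> curve c' ->
  (forall Z, Z = X \/ Z = X' ->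
    Rabs (a (back (m + j) Z) - c (back (m + j) Z)) <= eps / 4 /\
    Rabs (a' (back (m + j) Z) - c' (back (m + j) Z)) <= eps / 4) ->
  Rabs ((ln_sum m a c (back j X) - ln_sum m a c (back j X'))
      - (ln_sum m a' c' (back j X) - ln_sum m a' c' (back j X')))
    <= INR m * (ln_const * (4 + 2 * (eta / rho) * Rabs (X - X'))) * nu ^ (m + j).
Proof.
  intros Hnu Hl Hk Ha Hc Ha' Hc'; revert j; induction m as [|m IH]; intros j Hb.
  - simpl; rewrite !Rminus_diag, Rabs_R0; lra.
  - replace (S m + j)%nat with (m + S j)%nat in * by lia.
    specialize (IH (S j) Hb).
    pose proof ln_const_nonneg as HK.
    assert (Her : 1 <= eta / rho).
    { apply Rmult_le_reg_r with rho; [lra|].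
      replace (eta / rho * rho) with eta by (field; lra); lra. }
    pose proof (Rabs_pos (X - X')) as HXX.
    set (A := ln_const * (4 + 2 * (eta / rho) * Rabs (X - X'))) in *.
    assert (HA : 0 <= A) by (unfold A; apply Rmult_le_pos; [lra|nra]).
    simpl ln_sum.
    change (Fi (back j X)) with (back (S j) X); change (Fi (back j X')) with (back (S j) X').
    set (x := back (S j) X) in *; set (x' := back (S j) X') in *.
    assert (Hsmall : forall Z, Z = X \/ Z = X' ->
      Rabs (gtr m a (back (S j) Z) - gtr m c (back (S j) Z)) <= eps / 4 /\
      Rabs (gtr m a' (back (S j) Z) - gtr m c' (back (S j) Z)) <= eps / 4).
    { intros Z HZ; destruct (Hb Z HZ) as [B1 B2]; rewrite back_add in B1, B2; split.
      - eapply Rle_trans; [apply gtr_contract1; [apply Ha|apply Hc]|exact B1].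
      - eapply Rle_trans; [apply gtr_contract1; [apply Ha'|apply Hc']|exact B2]. }
    destruct (Hsmall X (or_introl eq_refl)) as [B1 B2].
    destruct (Hsmall X' (or_intror eq_refl)) as [B3 B4].
    fold x in B1, B2; fold x' in B3, B4.
    assert (HU : forall f, curve f -> valued_U (gtr m f)) by (intros f Hf; apply gtr_U, Hf).
    set (l1 := ln_secant x (gtr m a x) (gtr m c x)).
    set (l2 := ln_secant x' (gtr m a x') (gtr m c x')).
    set (l3 := ln_secant x (gtr m a' x) (gtr m c' x)).
    set (l4 := ln_secant x' (gtr m a' x') (gtr m c' x')).
    set (tau := (l1 - l2) - (l3 - l4)).
    assert (T1 : Rabs tau <= A * lam ^ m).
    { assert (Hp : 0 <= lam ^ m) by (apply pow_le; lra).
      assert (E1 : Rabs (l1 - l3) <= ln_const * (2 * lam ^ m)).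
      { apply ln_secant_lip; auto; try (apply HU; auto);
          try (apply gtr_contract2; [apply Ha || apply Hc|apply Ha' || apply Hc']).
        rewrite Rminus_diag, Rabs_R0; lra. }
      assert (E2 : Rabs (l2 - l4) <= ln_const * (2 * lam ^ m)).
      { apply ln_secant_lip; auto; try (apply HU; auto);
          try (apply gtr_contract2; [apply Ha || apply Hc|apply Ha' || apply Hc']).
        rewrite Rminus_diag, Rabs_R0; lra. }
      unfold tau; replace ((l1 - l2) - (l3 - l4)) with ((l1 - l3) - (l2 - l4)) by ring.
      eapply Rle_trans; [apply Rabs_triang|]; rewrite Rabs_Ropp.
      apply Rle_trans with (ln_const * 4 * lam ^ m); [lra|].
      apply Rmult_le_compat_r; [exact Hp|].
      unfold A; apply Rmult_le_compat_l; nra. }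
    assert (T2 : Rabs tau <= A * kap ^ S j).
    { assert (Hp : 0 <= kap ^ S j) by (apply pow_le; lra).
      set (d := eta / rho * (kap ^ S j * Rabs (X - X'))).
      assert (Hd : forall f, curve f -> Rabs (gtr m f x - gtr m f x') <= d).
      { intros f Hf; eapply Rle_trans; [apply curve_lip; now apply gtr_curve|].
        apply Rmult_le_compat_l; [lra|apply back_lip]. }
      assert (Hdx : Rabs (x - x') <= d).
      { eapply Rle_trans; [apply back_lip|]; unfold d.
        assert (0 <= kap ^ S j * Rabs (X - X')) by (apply Rmult_le_pos; lra). nra. }
      assert (E1 : Rabs (l1 - l2) <= ln_const * d) by (apply ln_secant_lip; auto; apply HU; auto).
      assert (E2 : Rabs (l3 - l4) <= ln_const * d) by (apply ln_secant_lip; auto; apply HU; auto).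
      unfold tau; eapply Rle_trans; [apply Rabs_triang|]; rewrite Rabs_Ropp.
      apply Rle_trans with (ln_const * (2 * (eta / rho) * Rabs (X - X')) * kap ^ S j);
        [unfold d in *; lra|].
      apply Rmult_le_compat_r; [exact Hp|].
      unfold A; apply Rmult_le_compat_l; lra. }
    assert (T : Rabs tau <= A * nu ^ (m + S j)).
    { assert (Hn0 : 0 <= nu ^ (m + S j)) by (apply pow_le; lra).
      apply Rsqr_incr_0; [|apply Rabs_pos|now apply Rmult_le_pos].
      unfold Rsqr.
      apply Rle_trans with ((A * lam ^ m) * (A * kap ^ S j)).
      - apply Rmult_le_compat; auto; apply Rabs_pos.
      - replace (A * nu ^ (m + S j) * (A * nu ^ (m + S j)))
          with (A * A * ((nu * nu) ^ m * (nu * nu) ^ S j)) 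
          by (rewrite pow_add, !Rpow_mult_distr; ring).
        replace (A * lam ^ m * (A * kap ^ S j)) with (A * A * (lam ^ m * kap ^ S j)) by ring.
        apply Rmult_le_compat_l; [nra|].
        apply Rmult_le_compat; try (apply pow_le; lra); apply pow_incr; lra. }
    rewrite S_INR.
    match goal with |- Rabs ?u <= _ =>
      replace u with (tau + ((ln_sum m a c x - ln_sum m a c x')
        - (ln_sum m a' c' x - ln_sum m a' c' x'))) by (unfold tau; ring) end.
    eapply Rle_trans; [apply Rabs_triang|].
    apply Rle_trans with (A * nu ^ (m + S j) + INR m * A * nu ^ (m + S j)); [|right; ring].
    apply Rplus_le_compat; [exact T|exact IH].
Qed.

(** Backward images of points at distance [S] are within [kap ^ N * S], and curves are uniformly
    Lipschitz; the bounds [del] and [eps / 8] are relaxed by a factor 2 to absorb the change. *)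
Lemma sep_shift (del S : R) : 0 < del -> 0 <= S -> exists n0, forall N a c X y,
  (n0 <= N)%nat -> curve a -> curve c ->
  del <= Rabs (a (back N X) - c (back N X)) <= eps / 8 -> Rabs y <= S ->
  del / 2 <= Rabs (a (back N (X + y)) - c (back N (X + y))) <= eps / 4.
Proof.
  intros Hdel HS.
  destruct (pow_lim_zero kap (2 * (eta / rho) * S) ltac:(lra) (Rmin (del / 2) (eps / 8)))
    as [n0 Hn0]; [apply Rmin_pos; lra|].
  exists n0; intros N a c X y HN Ha Hc B Hy; specialize (Hn0 N HN).
  pose proof (Rmin_l (del / 2) (eps / 8)); pose proof (Rmin_r (del / 2) (eps / 8)).
  set (p := back N X) in *; set (p' := back N (X + y)).
  assert (Hp : Rabs (p' - p) <= kap ^ N * S).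
  { eapply Rle_trans; [apply back_lip|]; replace (X + y - X) with y by ring.
    apply Rmult_le_compat_l; [apply pow_le; lra|exact Hy]. }
  assert (Her : 0 < eta / rho) by (apply Rdiv_lt_0_compat; lra).
  assert (Hl : forall f, curve f -> Rabs (f p' - f p) <= eta / rho * (kap ^ N * S)).
  { intros f Hf; eapply Rle_trans; [now apply curve_lip|].
    apply Rmult_le_compat_l; lra. }
  pose proof (Hl _ Ha) as L1; pose proof (Hl _ Hc) as L2.
  assert (E : Rabs ((a p' - c p') - (a p - c p)) <= 2 * (eta / rho) * S * kap ^ N).
  { replace ((a p' - c p') - (a p - c p)) with ((a p' - a p) - (c p' - c p)) by ring.
    eapply Rle_trans; [apply Rabs_triang|]; rewrite Rabs_Ropp; lra. }
  pose proof (Rabs_triang_inv2 (a p' - c p') (a p - c p)) as T.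
  apply Rabs_le_between in T.
  revert T; generalize (Rabs (a p' - c p')) (Rabs (a p - c p)) B.
  intros u v B' T; lra.
Qed.

(** A perturbation [d] of the initial curves has shrunk to [lam ^ m * d] after [m] steps, so the
    errors of the factors form a geometric series; the bound is its exact partial sum, so that the
    induction closes. *)
Lemma ln_sum_close (m : nat) (a c a' c' : R -> R) (d X : R) :
  valued_U a -> valued_U c -> valued_U a' -> valued_U c' ->
  (forall Y, Rabs (a Y - a' Y) <= d /\ Rabs (c Y - c' Y) <= d) ->
  Rabs (a (back m X) - c (back m X)) <= eps / 4 ->
  Rabs (a' (back m X) - c' (back m X)) <= eps / 4 ->
  Rabs (ln_sum m a c X - ln_sum m a' c' X) <= ln_const * d * ((1 - lam ^ m) / (1 - lam)).
Proof.
  intros Ha Hc Ha' Hc' Hd; revert X; induction m as [|m IH]; intros X B B'.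
  - simpl; rewrite !Rminus_diag, Rabs_R0; right; field; lra.
  - rewrite back_S in B, B'; specialize (IH (Fi X) B B'); simpl ln_sum.
    set (x := Fi X) in *.
    assert (Hcl : forall f f', valued_U f -> valued_U f' -> (forall Y, Rabs (f Y - f' Y) <= d) ->
      Rabs (gtr m f x - gtr m f' x) <= lam ^ m * d).
    { intros f f' Hf Hf' Hff; eapply Rle_trans; [now apply gtr_contract|].
      apply Rmult_le_compat_l; [apply pow_le; lra|apply Hff]. }
    assert (H0d : 0 <= lam ^ m * d).
    { apply Rmult_le_pos; [apply pow_le; lra|].
      pose proof (proj1 (Hd 0)); pose proof (Rabs_pos (a 0 - a' 0)); lra. }
    assert (H1 : Rabs (ln_secant x (gtr m a x) (gtr m c x)
      - ln_secant x (gtr m a' x) (gtr m c' x)) <= ln_const * (lam ^ m * d)).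
    { apply ln_secant_lip; try (apply gtr_U; auto).
      - eapply Rle_trans; [now apply gtr_contract1|exact B].
      - eapply Rle_trans; [now apply gtr_contract1|exact B'].
      - rewrite Rminus_diag, Rabs_R0; exact H0d.
      - apply Hcl; auto; intros; apply Hd.
      - apply Hcl; auto; intros; apply Hd. }
    set (u := ln_secant x (gtr m a x) (gtr m c x)) in *.
    set (u' := ln_secant x (gtr m a' x) (gtr m c' x)) in *.
    replace (u + ln_sum m a c x - (u' + ln_sum m a' c' x))
      with ((u - u') + (ln_sum m a c x - ln_sum m a' c' x)) by ring.
    eapply Rle_trans; [apply Rabs_triang|].
    apply Rle_trans with
      (ln_const * (lam ^ m * d) + ln_const * d * ((1 - lam ^ m) / (1 - lam))); [lra|].
    right; simpl; field; lra.
Qed.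

Lemma gtr_diff_close (m : nat) (a c a' c' : R -> R) (d del X : R) :
  0 < del -> valued_U a -> valued_U c -> valued_U a' -> valued_U c' ->
  (forall Y, Rabs (a Y - a' Y) <= d /\ Rabs (c Y - c' Y) <= d) ->
  del <= Rabs (a (back m X) - c (back m X)) <= eps / 4 ->
  del <= Rabs (a' (back m X) - c' (back m X)) <= eps / 4 ->
  Rabs (ln (Rabs (gtr m a X - gtr m c X)) - ln (Rabs (gtr m a' X - gtr m c' X)))
    <= (ln_const / (1 - lam) + 2 / del) * d.
Proof.
  intros Hdel Ha Hc Ha' Hc' Hd B B'.
  assert (Hne : forall u v, del <= Rabs (u - v) -> u <> v).
  { intros u v H ->; rewrite Rminus_diag, Rabs_R0 in H; lra. }
  rewrite !gtr_diff_ln_sum by (auto; apply Hne; lra).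
  set (p := back m X) in *.
  pose proof (ln_sum_close m a c a' c' d X Ha Hc Ha' Hc' Hd (proj2 B) (proj2 B')) as H1.
  assert (H0d : 0 <= d).
  { pose proof (proj1 (Hd 0)); pose proof (Rabs_pos (a 0 - a' 0)); lra. }
  assert (H2 : ln_const * d * ((1 - lam ^ m) / (1 - lam)) <= ln_const / (1 - lam) * d).
  { replace (ln_const * d * ((1 - lam ^ m) / (1 - lam)))
      with (ln_const / (1 - lam) * d * (1 - lam ^ m)) by (field; lra).
    assert (0 <= ln_const / (1 - lam) * d).
    { apply Rmult_le_pos; [apply Rdiv_le_0_compat; [apply ln_const_nonneg|lra]|exact H0d]. }
    pose proof (pow_le_1 lam m ltac:(lra)); nra. }
  assert (H3 : Rabs (ln (Rabs (a p - c p)) - ln (Rabs (a' p - c' p))) <= 2 / del * d).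
  { eapply Rle_trans; [apply (ln_lip _ _ del); lra|].
    replace (2 / del * d) with (2 * d / del) by (field; lra).
    apply Rmult_le_compat_r; [left; now apply Rinv_0_lt_compat|].
    eapply Rle_trans; [apply Rabs_triang_inv2|].
    replace (a p - c p - (a' p - c' p)) with ((a p - a' p) - (c p - c' p)) by ring.
    eapply Rle_trans; [apply Rabs_triang|]; rewrite Rabs_Ropp.
    destruct (Hd p); lra. }
  match goal with |- Rabs (?x + ?y - (?z + ?w)) <= _ =>
    replace (x + y - (z + w)) with ((x - z) + (y - w)) by ring end.
  eapply Rle_trans; [apply Rabs_triang|]; lra.
Qed.

(* A sequence of counterexamples to the conclusion, for a fixed separation
   [del]; the pair violating the k-th bound may depend on [k], but stays close
   to a reference pair. *)
Definition flat_pair (del : R) (n N : nat) (X : R) (a c : R -> R) (k : nat)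
  (a' c' : R -> R) : Prop :=
  curve a' /\ curve c' /\
  del <= Rabs (a' (back N X) - c' (back N X)) <= eps / 8 /\
  (forall Y, Rabs (a Y - a' Y) <= 2 * lam ^ n /\ Rabs (c Y - c' Y) <= 2 * lam ^ n) /\
  Rabs (Derive_n (fun x => gtr N a' x - gtr N c' x) k X)
    <= / (INR n + 1) * Rabs (gtr N a' X - gtr N c' X).

Definition flat_family (del : R) : Prop :=
  forall n : nat, exists (N : nat) (X : R) (a c : R -> R),
    (n <= N)%nat /\ curve a /\ curve c /\
    del <= Rabs (a (back N X) - c (back N X)) <= eps / 8 /\
    forall k, (1 <= k <= n)%nat -> exists a' c', flat_pair del n N X a c k a' c'.

(** Bundled so that a single choice for each [n] selects all components consistently. *)
Record flat_term (del : R) (n : nat) : Type := {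
  ft_N : nat; ft_X : R; ft_a : R -> R; ft_c : R -> R;
  ft_le : (n <= ft_N)%nat; ft_ca : curve ft_a; ft_cc : curve ft_c;
  ft_sep : del <= Rabs (ft_a (back ft_N ft_X) - ft_c (back ft_N ft_X)) <= eps / 8;
  ft_pair : forall k, (1 <= k <= n)%nat ->
    exists a' c', flat_pair del n ft_N ft_X ft_a ft_c k a' c'
}.

Lemma flat_family_seq (del : R) : flat_family del -> forall n, inhabited (flat_term del n).
Proof.
  intros H n; destruct (H n) as [N [X [a [c [H1 [H2 [H3 [H4 H5]]]]]]]].
  exact (inhabits (Build_flat_term del n N X a c H1 H2 H3 H4 H5)).
Qed.

Definition norm_diff (N : nat) (a c : R -> R) (X x : R) : R :=
  / (gtr N a X - gtr N c X) * (gtr N a x - gtr N c x).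

Lemma gtr_diff_neq_0 (N : nat) (a c : R -> R) (X del : R) : valued_U a -> valued_U c ->
  0 < del -> del <= Rabs (a (back N X) - c (back N X)) -> gtr N a X - gtr N c X <> 0.
Proof.
  intros Ha Hc Hdel B E.
  assert (E' : a (back N X) = c (back N X)) by (apply gtr_inj; auto; lra).
  rewrite E', Rminus_diag, Rabs_R0 in B; lra.
Qed.

Lemma norm_diff_norm (del : R) (N : nat) (a c : R -> R) (X x : R) :
  curve a -> curve c -> 0 < del ->
  del <= Rabs (a (back N x) - c (back N x)) <= eps / 4 ->
  anorm_le rho (distortion del * Rabs (norm_diff N a c X x))
    (fun t => norm_diff N a c X (x + t)).
Proof.
  intros Ha Hc Hdel B.
  pose proof (gtr_diff_norm0 a c del N x Ha Hc Hdel B) as H.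
  apply (anorm_le_scal rho _ (/ (gtr N a X - gtr N c X)) _ ltac:(lra)) in H.
  eapply anorm_le_weaken; [|exact H].
  unfold norm_diff; rewrite Rabs_mult; right; ring.
Qed.

Lemma norm_diff_self (N : nat) (a c : R -> R) (X : R) :
  gtr N a X - gtr N c X <> 0 -> norm_diff N a c X X = 1.
Proof. intros H; unfold norm_diff; now apply Rinv_l. Qed.

Lemma norm_diff_norm_self (del : R) (N : nat) (a c : R -> R) (X : R) :
  curve a -> curve c -> 0 < del ->
  del <= Rabs (a (back N X) - c (back N X)) <= eps / 4 ->
  anorm_le rho (distortion del) (fun t => norm_diff N a c X (X + t)).
Proof.
  intros Ha Hc Hdel B; pose proof (norm_diff_norm del N a c X X Ha Hc Hdel B) as H.
  rewrite norm_diff_self, Rabs_R1, Rmult_1_r in H; [exact H|].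
  apply (gtr_diff_neq_0 N a c X del); [apply Ha|apply Hc|exact Hdel|apply B].
Qed.

(* On a disc where both quotients stay within [1/2] of [1], their logarithms
   can be compared without worrying about signs. *)
Lemma norm_diff_close (del : R) : 0 < del -> exists rho1 K,
  0 < rho1 < rho /\ 0 <= K /\ exists n0, forall N a c a' c' X d t,
  (n0 <= N)%nat -> curve a -> curve c -> curve a' -> curve c' ->
  (forall Y, Rabs (a Y - a' Y) <= d /\ Rabs (c Y - c' Y) <= d) ->
  del <= Rabs (a (back N X) - c (back N X)) <= eps / 8 ->
  del <= Rabs (a' (back N X) - c' (back N X)) <= eps / 8 ->
  Rabs t < rho1 ->
  Rabs (norm_diff N a c X (X + t) - norm_diff N a' c' X (X + t)) <= K * d.
Proof.
  intros Hdel.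
  destruct (sep_shift del rho Hdel ltac:(lra)) as [n0 Hsep].
  pose proof (distortion_pos del Hdel) as HC; set (C := distortion del) in *.
  (* The normalised differences are [C / rho]-Lipschitz about [X], where they equal 1; on this disc
     they stay within [1 / 2] of 1. *)
  set (rho1 := rho / (2 * C + 2)).
  assert (Hr1 : 0 < rho1 < rho).
  { unfold rho1; split; [apply Rdiv_lt_0_compat; lra|].
    apply Rmult_lt_reg_r with (2 * C + 2); [lra|].
    replace (rho / (2 * C + 2) * (2 * C + 2)) with rho by (field; lra); nra. }
  set (K0 := ln_const / (1 - lam) + 2 / (del / 2)).
  assert (HK0 : 0 <= K0).
  { unfold K0; pose proof ln_const_nonneg.
    assert (0 <= ln_const / (1 - lam)) by (apply Rdiv_le_0_compat; lra).
    assert (0 <= 2 / (del / 2)) by (apply Rdiv_le_0_compat; lra). lra. }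
  exists rho1, (4 * K0); split; [exact Hr1|split; [lra|]]; exists n0.
  intros N a c a' c' X d t HN Ha Hc Ha' Hc' Hd B B' Ht.
  assert (Htr : Rabs t <= rho) by lra.
  pose proof (Hsep N a c X t HN Ha Hc B Htr) as Bt.
  pose proof (Hsep N a' c' X t HN Ha' Hc' B' Htr) as Bt'.
  assert (Hpos : forall a c, curve a -> curve c ->
    del <= Rabs (a (back N X) - c (back N X)) <= eps / 8 ->
    1 / 2 <= norm_diff N a c X (X + t) <= 2).
  { intros f1 f2 Hf1 Hf2 Bf.
    pose proof (norm_diff_norm_self del N f1 f2 X Hf1 Hf2 Hdel ltac:(lra)) as H; fold C in H.
    pose proof (anorm_le_lip _ _ t _ H ltac:(lra)) as H1; cbv beta in H1.
    rewrite Rplus_0_r, norm_diff_self in H1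
      by (apply (gtr_diff_neq_0 N f1 f2 X del); [apply Hf1|apply Hf2|lra|lra]).
    assert (H2 : C / rho * Rabs t <= 1 / 2).
    { apply Rle_trans with (C / rho * rho1).
      - apply Rmult_le_compat_l; [apply Rdiv_le_0_compat; lra|lra].
      - unfold rho1; replace (C / rho * (rho / (2 * C + 2))) with (C / (2 * C + 2)) by (field; lra).
        apply Rmult_le_reg_r with (2 * C + 2); [lra|].
        replace (C / (2 * C + 2) * (2 * C + 2)) with C by (field; lra); lra. }
    apply Rabs_le_between in H1; lra. }
  pose proof (Hpos a c Ha Hc B) as P; pose proof (Hpos a' c' Ha' Hc' B') as P'.
  assert (Hln : forall a c, curve a -> curve c ->
    del / 2 <= Rabs (a (back N X) - c (back N X)) <= eps / 4 ->
    del / 2 <= Rabs (a (back N (X + t)) - c (back N (X + t))) <= eps / 4 ->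
    ln (Rabs (norm_diff N a c X (X + t)))
      = ln (Rabs (gtr N a (X + t) - gtr N c (X + t))) - ln (Rabs (gtr N a X - gtr N c X))).
  { intros f1 f2 H1 H2 H3 H4; unfold norm_diff.
    assert (E1 := gtr_diff_neq_0 N f1 f2 X (del / 2) (proj1 H1) (proj1 H2) ltac:(lra) (proj1 H3)).
    assert (E2 := gtr_diff_neq_0 N f1 f2 (X + t) (del / 2) (proj1 H1) (proj1 H2) ltac:(lra) (proj1 H4)).
    apply Rabs_pos_lt in E1; apply Rabs_pos_lt in E2.
    rewrite Rabs_mult, Rabs_inv, ln_mult, ln_Rinv; auto; [ring|].
    now apply Rinv_0_lt_compat. }
  pose proof (gtr_diff_close N a c a' c' d (del / 2) X ltac:(lra) (proj1 Ha) (proj1 Hc)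
    (proj1 Ha') (proj1 Hc') Hd ltac:(lra) ltac:(lra)) as G0.
  pose proof (gtr_diff_close N a c a' c' d (del / 2) (X + t) ltac:(lra) (proj1 Ha) (proj1 Hc)
    (proj1 Ha') (proj1 Hc') Hd Bt Bt') as Gt.
  fold K0 in G0, Gt.
  pose proof (Hln a c Ha Hc ltac:(lra) Bt) as E; pose proof (Hln a' c' Ha' Hc' ltac:(lra) Bt') as E'.
  set (u := norm_diff N a c X (X + t)) in *; set (u' := norm_diff N a' c' X (X + t)) in *.
  rewrite Rabs_pos_eq in E, E' by lra.
  assert (Hl : Rabs (ln u - ln u') <= 2 * (K0 * d)).
  { rewrite E, E'; match goal with |- Rabs (?x - ?y - (?z - ?w)) <= _ =>
      replace (x - y - (z - w)) with ((x - z) - (y - w)) by ring end.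
    eapply Rle_trans; [apply Rabs_triang|]; rewrite Rabs_Ropp; lra. }
  assert (Hexp : forall x y, 1 / 2 <= x <= 2 -> 1 / 2 <= y <= 2 -> x - y <= 2 * Rabs (ln x - ln y)).
  { clear; intros x y Hx Hy.
    pose proof (exp_ge_plus1 (ln y - ln x)) as H.
    replace (exp (ln y - ln x)) with (y * / x) in H
      by (unfold Rminus; rewrite exp_plus, exp_Ropp, !exp_ln by lra; reflexivity).
    assert (H1 : x * (1 + (ln y - ln x)) <= y).
    { apply Rle_trans with (x * (y * / x)); [apply Rmult_le_compat_l; lra|right; field; lra]. }
    pose proof (Rle_abs (ln x - ln y)); pose proof (Rabs_pos (ln x - ln y)).
    apply Rle_trans with (x * (ln x - ln y)); [lra|].
    apply Rle_trans with (x * Rabs (ln x - ln y)); [apply Rmult_le_compat_l; lra|].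
    apply Rmult_le_compat_r; lra. }
  pose proof (Hexp u u' P P') as X1; pose proof (Hexp u' u P' P) as X2.
  rewrite (Rabs_minus_sym (ln u')) in X2; apply Rabs_le; lra.
Qed.

(** The failing pair of order [k] makes the k-th derivative small for its own quotient; closeness
    transfers this to the reference pair, whose quotient is then flat at [X n], and bounded
    distortion propagates the flatness to any bounded distance. *)
Lemma flat_family_ratio (del : R) (s : forall n, flat_term del n) :
  0 < del ->
  let N n := ft_N _ _ (s n) in let X n := ft_X _ _ (s n) in
  let a n := ft_a _ _ (s n) in let c n := ft_c _ _ (s n) in
  (forall S y, (forall n, Rabs (y n) <= S) -> eventually (fun n =>
     del / 2 <= Rabs (a n (back (N n) (X n + y n)) - c n (back (N n) (X n + y n))) <= eps / 4)) /\
  (forall S y, (forall n, Rabs (y n) <= S) -> forall e, 0 < e -> eventually (fun n =>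
     Rabs ((gtr (N n) (a n) (X n + y n) - gtr (N n) (c n) (X n + y n)) /
           (gtr (N n) (a n) (X n) - gtr (N n) (c n) (X n)) - 1) < e)).
Proof.
  intros Hdel N X a c.
  assert (Ha : forall n, curve (a n)) by (intros n; apply (ft_ca _ _ (s n))).
  assert (Hc : forall n, curve (c n)) by (intros n; apply (ft_cc _ _ (s n))).
  assert (HN : forall n, (n <= N n)%nat) by (intros n; apply (ft_le _ _ (s n))).
  assert (B : forall n, del <= Rabs (a n (back (N n) (X n)) - c n (back (N n) (X n))) <= eps / 8)
    by (intros n; apply (ft_sep _ _ (s n))).
  assert (Hpair : forall n k, (1 <= k <= n)%nat -> exists a' c',
    flat_pair del n (N n) (X n) (a n) (c n) k a' c') by (intros n; apply (ft_pair _ _ (s n))).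
  assert (Hsep : forall S y, (forall n, Rabs (y n) <= S) -> eventually (fun n =>
     del / 2 <= Rabs (a n (back (N n) (X n + y n)) - c n (back (N n) (X n + y n))) <= eps / 4)).
  { intros S y Hy.
    assert (HS : 0 <= S) by (specialize (Hy 0%nat); pose proof (Rabs_pos (y 0%nat)); lra).
    destruct (sep_shift del S Hdel HS) as [n0 H]; exists n0; intros n Hn.
    apply H; auto; specialize (HN n); lia. }
  split; [exact Hsep|].
  intros S y Hy.
  set (h := fun n x => norm_diff (N n) (a n) (c n) (X n) x).
  set (C := distortion (del / 2)).
  assert (HC : 0 < C) by (apply distortion_pos; lra).
  assert (Hnorm : forall S y, (forall n, Rabs (y n) <= S) ->
    eventually (fun n => anorm_le rho (C * Rabs (h n (X n + y n)))
      (fun t => h n (X n + y n + t)))).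
  { clear S y Hy; intros S y Hy.
    apply filter_imp with (2 := Hsep S y Hy); intros n Bn.
    apply norm_diff_norm; auto; lra. }
  assert (Hnorm0 : forall n, anorm_le rho C (fun t => h n (X n + t))).
  { intros n; apply norm_diff_norm_self; auto; [lra|specialize (B n); lra]. }
  assert (Hflat : flat_at rho h X).
  { apply flat_at_base with C; [exact Hrho| | |].
    - intros n; apply norm_diff_self, (gtr_diff_neq_0 _ _ _ _ del); auto; try apply B;
        [apply Ha|apply Hc].
    - exists 0%nat; intros n _; apply Hnorm0.
    - intros k e Hk He.
      assert (Hex : forall n, exists p : (R -> R) * (R -> R), (k <= n)%nat ->
        flat_pair del n (N n) (X n) (a n) (c n) k (fst p) (snd p)).
      { intros n; destruct (Nat.le_gt_cases k n) as [Hkn|Hkn].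
        - destruct (Hpair n k ltac:(lia)) as [a' [c' H]]; now exists (a', c').
        (* A default for the finitely many [n < k], where no failing pair is provided; the limit
           ignores them. *)
        - exists (a n, c n); lia. }
      destruct (choice _ Hex) as [p Hp0].
      set (a' := fun n => fst (p n)); set (c' := fun n => snd (p n)).
      assert (Hp : forall n, (k <= n)%nat ->
        flat_pair del n (N n) (X n) (a n) (c n) k (a' n) (c' n)) by exact Hp0.
      destruct (norm_diff_close del Hdel) as [rho1 [K [Hr1 [HK [n0 Hclose]]]]].
      apply (derive_transfer rho rho1 C h
        (fun n x => norm_diff (N n) (a' n) (c' n) (X n) x) X k); auto.
      + exists 0%nat; intros n _; apply Hnorm0.
      + exists k; intros n Hn; destruct (Hp n Hn) as [P1 [P2 [P3 _]]].
        apply norm_diff_norm_self; auto; lra.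
      + intros t Ht e' He'.
        destruct (pow_lim_zero lam (K * 2) ltac:(lra) e' He') as [n1 Hn1].
        exists (n0 + n1 + k)%nat; intros n Hn.
        destruct (Hp n ltac:(lia)) as [P1 [P2 [P3 [P4 _]]]].
        eapply Rle_lt_trans; [apply (Hclose (N n) (a n) (c n) (a' n) (c' n) (X n) (2 * lam ^ n) t);
          auto|].
        * specialize (HN n); lia.
        * rewrite Rabs_pos_eq; lra.
        * specialize (Hn1 n ltac:(lia)); lra.
      + intros e' He'.
        destruct (exists_inv_le (e' / 2)) as [n1 Hn1]; [lra|].
        exists (n1 + k)%nat; intros n Hn.
        destruct (Hp n ltac:(lia)) as [P1 [P2 [P3 [_ P5]]]].
        assert (HD0 := gtr_diff_neq_0 (N n) (a' n) (c' n) (X n) del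
          (proj1 P1) (proj1 P2) Hdel (proj1 P3)).
        apply Rabs_pos_lt in HD0.
        unfold norm_diff; rewrite Derive_n_scal_l, Rabs_mult, Rabs_inv.
        set (D0 := Rabs (gtr (N n) (a' n) (X n) - gtr (N n) (c' n) (X n))) in *.
        apply Rle_lt_trans with (/ D0 * (/ (INR n + 1) * D0)).
        { apply Rmult_le_compat_l; [left; now apply Rinv_0_lt_compat|exact P5]. }
        replace (/ D0 * (/ (INR n + 1) * D0))
          with (/ (INR n + 1)) by (field; pose proof (pos_INR n); lra).
        pose proof (inv_INR_decr n1 n ltac:(lia)); lra. }
  pose proof (flat_at_all rho C S h X Hrho (Rlt_le _ _ HC) Hflat (Hnorm S) y Hy) as Hall.
  intros e He; apply filter_imp with (2 := Hall e He); intros n H.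
  specialize (H 0 ltac:(rewrite Rabs_R0; lra)); rewrite Rplus_0_r in H.
  unfold h, norm_diff in H; unfold Rdiv; rewrite Rmult_comm; exact H.
Qed.

(** The differences of the reference pair are nearly equal at translates of [X] and [X']. Writing
    them as a product over the last [m] steps times an earlier difference, which hardly varies by
    bounded distortion, the two products must nearly agree; they are then compared with those along
    [Theta]. *)
Lemma flat_family_ln_sum (del X X' e : R) :
  0 < del -> 0 < e -> flat_family del ->
  exists m0, forall m, (m0 <= m)%nat ->
    Rabs (ln_sum m Theta Theta X - ln_sum m Theta Theta X') < e.
Proof.
  intros Hdel He Hff.
  set (s := fun n => epsilon (flat_family_seq del Hff n) (fun _ => True)).
  set (N := fun n => ft_N _ _ (s n)); set (Xs := fun n => ft_X _ _ (s n)).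
  set (a := fun n => ft_a _ _ (s n)); set (c := fun n => ft_c _ _ (s n)).
  assert (Hratio : (forall S y, (forall n, Rabs (y n) <= S) -> eventually (fun n =>
     del / 2 <= Rabs (a n (back (N n) (Xs n + y n)) - c n (back (N n) (Xs n + y n))) <= eps / 4)) /\
  (forall S y, (forall n, Rabs (y n) <= S) -> forall e, 0 < e -> eventually (fun n =>
     Rabs ((gtr (N n) (a n) (Xs n + y n) - gtr (N n) (c n) (Xs n + y n)) /
           (gtr (N n) (a n) (Xs n) - gtr (N n) (c n) (Xs n)) - 1) < e)))
    by exact (flat_family_ratio del s Hdel).
  destruct Hratio as [Hsep Hrat].
  destruct lam_kap_sqrt as [nu [Hnu [Hln Hkn]]].
  set (C := distortion (del / 2)) in *.
  assert (HC : 0 < C) by (apply distortion_pos; lra).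
  set (e1 := Rmin 1 (e / 5)).
  assert (He1 : 0 < e1 <= 1) by (split; [apply Rmin_pos; lra|apply Rmin_l]).
  assert (He1' : e1 <= e / 5) by apply Rmin_r.
  pose proof (Rabs_pos (X - X')) as HXX.
  destruct (pow_lim_zero_INR nu (ln_const * (4 + 2 * (eta / rho) * Rabs (X - X'))) Hnu
    (e / 5) ltac:(lra)) as [m1 Hm1].
  destruct (pow_lim_zero kap (C / rho * Rabs (X - X')) ltac:(lra) (e1 / 2) ltac:(lra))
    as [m2 Hm2].
  destruct (pow_lim_zero kap (Rabs (X - X')) ltac:(lra) rho Hrho) as [m3 Hm3].
  exists (m1 + m2 + m3)%nat; intros m Hm.
  specialize (Hm1 m ltac:(lia)); specialize (Hm2 m ltac:(lia)); specialize (Hm3 m ltac:(lia)).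
  set (B := (Z.of_nat b ^ Z.of_nat m)%Z).
  assert (HB : 1 <= IZR B) by (apply IZR_le; pose proof (Z.pow_pos_nonneg (Z.of_nat b) (Z.of_nat m)); lia).
  (* Translation by a multiple of [b ^ m] brings [X] within [b ^ m] of [Xs n], a bound independent
     of [n], without affecting the last [m] steps. *)
  set (q := fun n => Int_part ((Xs n - X) / IZR B)).
  set (y := fun n => X + IZR (B * q n) - Xs n).
  set (y' := fun n => X' + IZR (B * q n) - Xs n).
  assert (Hy : forall n, Rabs (y n) <= IZR B + Rabs (X - X')).
  { intros n; unfold y; rewrite mult_IZR.
    destruct (base_Int_part ((Xs n - X) / IZR B)) as [Q1 Q2]; fold (q n) in Q1, Q2.
    assert (E : (Xs n - X) / IZR B * IZR B = Xs n - X) by (field; lra).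
    apply Rabs_le; nra. }
  assert (Hy' : forall n, Rabs (y' n) <= IZR B + Rabs (X - X') + Rabs (X - X')).
  { intros n; replace (y' n) with (y n + (X' - X)) by (unfold y, y'; ring).
    eapply Rle_trans; [apply Rabs_triang|]; rewrite (Rabs_minus_sym X'); specialize (Hy n); lra. }
  assert (He2 : 0 < e1 / 2) by lra.
  pose proof (Hsep _ y Hy) as F1; pose proof (Hsep _ y' Hy') as F2.
  pose proof (Hrat _ y Hy _ He2) as F3; pose proof (Hrat _ y' Hy' _ He2) as F4.
  destruct (filter_and _ _ (filter_and _ _ F1 F2) (filter_and _ _ F3 F4)) as [n0 Hn0].
  clear F1 F2 F3 F4.
  (* Here [n >= m] guarantees that at least [m] steps are available. *)
  set (n := (n0 + m)%nat).
  destruct (Hn0 n ltac:(lia)) as [[B1 B2] [R1 R2]]; clear Hn0 Hsep Hrat.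
  pose proof (ft_le _ _ (s n)) as HN; fold (N n) in HN.
  assert (Ha : curve (a n)) by apply (ft_ca _ _ (s n)).
  assert (Hc : curve (c n)) by apply (ft_cc _ _ (s n)).
  replace (Xs n + y n) with (X + IZR (B * q n)) in * by (unfold y; ring).
  replace (Xs n + y' n) with (X' + IZR (B * q n)) in * by (unfold y'; ring).
  set (an := a n) in *; set (cn := c n) in *; set (Nn := N n) in *.
  (* The first [Nn - m] applications are absorbed into new curves, so that the remaining [m] are
     evaluated at [X] and [X'] themselves. *)
  set (ah := fun Y => gtr (Nn - m) an (Y + IZR (q n))).
  set (ch := fun Y => gtr (Nn - m) cn (Y + IZR (q n))).
  assert (Hah : curve ah) by (apply curve_shift, gtr_curve, Ha).
  assert (Hch : curve ch) by (apply curve_shift, gtr_curve, Hc).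
  assert (Egtr : forall f Z, gtr Nn f (Z + IZR (B * q n))
    = gtr m (fun Y => gtr (Nn - m) f (Y + IZR (q n))) Z).
  { intros f Z; replace Nn with (m + (Nn - m))%nat at 1 by lia.
    rewrite gtr_add; apply gtr_shift. }
  assert (Eback : forall Z, back Nn (Z + IZR (B * q n)) = back (Nn - m) (back m Z + IZR (q n))).
  { intros Z; replace Nn with ((Nn - m) + m)%nat at 1 by lia.
    rewrite back_add; f_equal; apply back_shift. }
  rewrite !Eback in B1, B2; rewrite !Egtr in R1, R2.
  fold ah ch in R1, R2.
  set (D0 := gtr Nn an (Xs n) - gtr Nn cn (Xs n)) in *.
  assert (Hne : forall Z, del / 2 <= Rabs (an (back (Nn - m) (back m Z + IZR (q n)))
      - cn (back (Nn - m) (back m Z + IZR (q n)))) -> ah (back m Z) <> ch (back m Z)).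
  { intros Z HZ E; apply gtr_inj in E; [|apply Ha|apply Hc].
    rewrite E, Rminus_diag, Rabs_R0 in HZ; lra. }
  pose proof (Hne X (proj1 B1)) as Hne1; pose proof (Hne X' (proj1 B2)) as Hne2.
  pose proof (gtr_diff_ln_sum m ah ch X (proj1 Hah) (proj1 Hch) Hne1) as L1.
  pose proof (gtr_diff_ln_sum m ah ch X' (proj1 Hah) (proj1 Hch) Hne2) as L2.
  set (u := gtr m ah X - gtr m ch X) in *; set (u' := gtr m ah X' - gtr m ch X') in *.
  assert (HD0 : D0 <> 0).
  { intros E; rewrite E in R1; unfold Rdiv in R1.
    rewrite Rinv_0, Rmult_0_r, Rminus_0_l, Rabs_Ropp, Rabs_R1 in R1; lra. }
  assert (Hu : u <> 0).
  { intros E; rewrite E in R1; unfold Rdiv in R1.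
    rewrite Rmult_0_l, Rminus_0_l, Rabs_Ropp, Rabs_R1 in R1; lra. }
  assert (Hu' : u' <> 0).
  { intros E; rewrite E in R2; unfold Rdiv in R2.
    rewrite Rmult_0_l, Rminus_0_l, Rabs_Ropp, Rabs_R1 in R2; lra. }
  apply (ln_near_1 _ _ He1) in R1; apply (ln_near_1 _ _ He1) in R2.
  unfold Rdiv in R1, R2.
  rewrite Rabs_mult, Rabs_inv, ln_mult, ln_Rinv in R1
    by (try apply Rinv_0_lt_compat; now apply Rabs_pos_lt).
  rewrite Rabs_mult, Rabs_inv, ln_mult, ln_Rinv in R2
    by (try apply Rinv_0_lt_compat; now apply Rabs_pos_lt).
  rewrite L1 in R1; rewrite L2 in R2.
  set (v := ah (back m X) - ch (back m X)) in *.
  set (v' := ah (back m X') - ch (back m X')) in *.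
  assert (Hv : v <> 0) by (unfold v; intros E; apply Hne1; lra).
  assert (Hv' : v' <> 0) by (unfold v'; intros E; apply Hne2; lra).
  (* The points [back m X] and [back m X'] are at distance of order [kap ^ m], and the difference of
     the new curves has norm at most [C * Rabs v], so its relative change is small. *)
  assert (Hvv : Rabs (ln (Rabs v') - ln (Rabs v)) < e1).
  { pose proof (gtr_diff_norm0 an cn (del / 2) (Nn - m) (back m X + IZR (q n))
      Ha Hc ltac:(lra) B1) as H; fold C in H.
    set (t := back m X' - back m X).
    assert (Ht : Rabs t <= Rabs (X - X') * kap ^ m).
    { unfold t; eapply Rle_trans; [apply back_lip|].
      rewrite (Rabs_minus_sym X'); right; ring. }
    pose proof (anorm_le_lip _ _ t _ H ltac:(lra)) as H'; cbv beta in H'.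
    rewrite Rplus_0_r in H'.
    replace (back m X + IZR (q n) + t) with (back m X' + IZR (q n)) in H' by (unfold t; ring).
    fold (ah (back m X)) (ch (back m X)) (ah (back m X')) (ch (back m X')) in H'.
    fold v v' in H'.
    pose proof (Rabs_pos_lt v Hv) as Hvp.
    assert (Hr1 : Rabs (v' / v - 1) < e1 / 2).
    { replace (v' / v - 1) with ((v' - v) * / v) by (field; exact Hv).
      rewrite Rabs_mult, Rabs_inv.
      apply Rmult_lt_reg_r with (Rabs v); [exact Hvp|].
      rewrite Rmult_assoc, Rinv_l, Rmult_1_r by lra.
      eapply Rle_lt_trans; [exact H'|].
      replace (C * Rabs v / rho * Rabs t) with (C / rho * Rabs t * Rabs v) by (field; lra).
      apply Rmult_lt_compat_r; [exact Hvp|].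
      eapply Rle_lt_trans; [|exact Hm2].
      rewrite Rmult_assoc; apply Rmult_le_compat_l; [apply Rdiv_le_0_compat; lra|exact Ht]. }
    apply (ln_near_1 _ _ He1) in Hr1; unfold Rdiv in Hr1.
    rewrite Rabs_mult, Rabs_inv, ln_mult, ln_Rinv in Hr1
      by (try apply Rinv_0_lt_compat; now apply Rabs_pos_lt).
    exact Hr1. }
  pose proof (ln_sum_compare nu ah ch Theta Theta X X' m 0 Hnu Hln Hkn Hah Hch
    Theta_curve Theta_curve) as Hcmp.
  rewrite Nat.add_0_r in Hcmp.
  assert (Hth : forall Z, Rabs (Theta Z - Theta Z) <= eps / 4).
  { intros Z; rewrite Rminus_diag, Rabs_R0; lra. }
  assert (Hcmp' := Hcmp ltac:(intros Z [->| ->]; (split; [|apply Hth]);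
    unfold ah, ch; (eapply Rle_trans; [apply gtr_contract1; [apply Ha|apply Hc]|lra]))).
  simpl (back 0 _) in Hcmp'.
  clear - Hcmp' Hm1 Hvv R1 R2 He1'.
  set (w := ln_sum m ah ch X) in *; set (w' := ln_sum m ah ch X') in *.
  set (z := ln_sum m Theta Theta X) in *; set (z' := ln_sum m Theta Theta X') in *.
  apply Rabs_def2 in R1; apply Rabs_def2 in R2; apply Rabs_def2 in Hvv.
  assert (Hc2 := Rle_lt_trans _ _ _ Hcmp' Hm1); apply Rabs_def2 in Hc2.
  apply Rabs_def1; lra.
Qed.

(** A sum of [S m] terms started at the image of [Y] under [sd_f] is one term at [Y] plus the sum of
    [m] terms started at [Y]. Both long sums have vanishing differences between the two points,
    hence so does the extra term. *)
Lemma flat_family_derivative_const (del Y Y' : R) :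
  0 < del -> flat_family del ->
  Rabs (Derive (gl Y) (Theta Y)) = Rabs (Derive (gl Y') (Theta Y')).
Proof.
  intros Hdel Hff.
  assert (HT : forall m x, gtr m Theta x = Theta x) by (intros; apply Theta_gtr).
  assert (Hs : forall m x, ln_sum (S m) Theta Theta (sd_f D x)
    = ln (Rabs (Derive (gl x) (Theta x))) + ln_sum m Theta Theta x).
  { intros m x; simpl; unfold ln_secant, Fi; rewrite sd_fi_f, !HT, secant_diag; reflexivity. }
  set (p := Rabs (Derive (gl Y) (Theta Y))); set (p' := Rabs (Derive (gl Y') (Theta Y'))).
  assert (Hp : 0 < p /\ 0 < p').
  { unfold p, p'; rewrite <- !secant_diag.
    pose proof (gl_secant_bounds Y _ _ (Theta_U Y) (Theta_U Y)).
    pose proof (gl_secant_bounds Y' _ _ (Theta_U Y') (Theta_U Y')). lra. }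
  apply ln_inv; [apply Hp|apply Hp|].
  apply cond_eq; intros e He.
  destruct (flat_family_ln_sum del Y Y' (e / 2) Hdel ltac:(lra) Hff) as [m1 H1].
  destruct (flat_family_ln_sum del (sd_f D Y) (sd_f D Y') (e / 2) Hdel ltac:(lra) Hff)
    as [m2 H2].
  specialize (H1 (m1 + m2)%nat ltac:(lia)); specialize (H2 (S (m1 + m2)) ltac:(lia)).
  rewrite !Hs in H2; fold p p' in H2.
  apply Rabs_def2 in H1; apply Rabs_def2 in H2; apply Rabs_def1; lra.
Qed.


(** * Derivatives of curves and periodicity of the limit curve *)

Lemma curve_is_derive (a : R -> R) (X : R) : curve a ->
  exists co, has_coefs rho eta co (fun t => a (X + t) - a X) /\
    forall t, Rabs t < rho -> is_derive a (X + t) (PSeries (PS_derive co) t).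
Proof.
  intros Ha; destruct (proj2 Ha X) as [co Hco]; exists co; split; [exact Hco|].
  intros t Ht.
  pose proof (has_coefs_is_derive rho eta X t co (fun x => a x - a X) Hco Ht) as H.
  apply (is_derive_plus (fun x => a x - a X) (fun _ => a X) (X + t)
    (PSeries (PS_derive co) t) 0) in H; [|apply (is_derive_const (a X))].
  replace (PSeries (PS_derive co) t) with (Hierarchy.plus (PSeries (PS_derive co) t) 0)
    by (change (Hierarchy.plus ?x ?y) with (x + y); ring_R).
  apply is_derive_ext with (2 := H); intros y.
  change (a y - a X + a X = a y); ring.
Qed.

Lemma curve_ex_derive (a : R -> R) (X : R) : curve a -> ex_derive a X.
Proof.
  intros Ha; destruct (curve_is_derive a X Ha) as [co [_ H]].
  specialize (H 0 ltac:(rewrite Rabs_R0; lra)); rewrite Rplus_0_r in H; exists (PSeries (PS_derive co) 0); exact H.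
Qed.

Lemma curve_continuity (a : R -> R) : curve a -> continuity a.
Proof.
  intros Ha X; apply continuity_pt_filterlim, (ex_derive_continuous a).
  now apply curve_ex_derive.
Qed.

Lemma curve_derive_continuity (a : R -> R) : curve a -> continuity (Derive a).
Proof.
  intros Ha X; apply continuity_pt_filterlim.
  destruct (curve_is_derive a X Ha) as [co [[Hco _] Hd]].
  assert (H0 : Rabs 0 < rho) by (rewrite Rabs_R0; lra).
  assert (Hc : continuous (fun x => PSeries (PS_derive co) (x - X)) X).
  { apply (continuous_comp (fun x => x - X) (PSeries (PS_derive co))).
    - apply (ex_derive_continuous (fun x => x - X)); auto_derive; auto.
    - rewrite Rminus_diag; apply continuity_pt_filterlim, PSeries_continuity.
      rewrite CV_radius_derive; exact (coef_bound_radius rho eta 0 co Hco H0). }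
  apply continuous_ext_loc with (2 := Hc).
  assert (E : forall x : R, Rabs (x - X) < rho -> PSeries (PS_derive co) (x - X) = Derive a x).
  { intros x Hx; symmetry; apply is_derive_unique; pose proof (Hd (x - X) Hx) as H.
    replace (X + (x - X)) with x in H by ring; exact H. }
  exists (mkposreal rho Hrho); exact E.
Qed.

Lemma curve_derive_bound (a : R -> R) (X : R) : curve a -> Rabs (Derive a X) <= eta / rho.
Proof.
  intros Ha; destruct (curve_is_derive a X Ha) as [co [[Hco _] Hd]].
  specialize (Hd 0 ltac:(rewrite Rabs_R0; lra)); rewrite Rplus_0_r, PSeries_0 in Hd.
  rewrite (is_derive_unique _ _ _ Hd); unfold PS_derive; simpl INR; rewrite Rmult_1_l.
  pose proof (coef_bound_term rho eta co 1 ltac:(lra) Hco) as H; rewrite pow_1 in H.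
  apply Rmult_le_reg_r with rho; [lra|].
  replace (eta / rho * rho) with eta by (field; lra); exact H.
Qed.

(** Difference quotients with step [t] determine the derivatives up to [K * t], by the common bound
    on second-order remainders; [t] is fixed first, and then the values are close to within
    [4 * lam ^ m] in total. *)
Lemma gtr_derive_approx (e : R) : 0 < e -> exists m0, forall m a p, (m0 <= m)%nat ->
  curve a -> Rabs (Derive (gtr m a) p - Derive Theta p) < e.
Proof.
  intros He; pose proof eta_pos as Heta.
  set (K := 2 * eta / (rho * rho)).
  assert (HK : 0 < K) by (apply Rdiv_lt_0_compat; nra).
  set (t := Rmin (rho / 2) (e / (2 * K))).
  assert (Ht : 0 < t).
  { apply Rmin_pos; [lra|apply Rdiv_lt_0_compat; lra]. }
  assert (Htr : t <= rho / 2) by apply Rmin_l.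
  assert (HtK : K * t <= e / 2).
  { replace (e / 2) with (K * (e / (2 * K))) by (field; lra).
    apply Rmult_le_compat_l; [lra|apply Rmin_r]. }
  destruct (pow_lim_zero lam (4 / t) ltac:(lra) (e / 2) ltac:(lra)) as [m0 Hm0].
  exists m0; intros m a p Hm Ha; specialize (Hm0 m Hm).
  destruct (curve_is_derive _ p (gtr_curve m a Ha)) as [co [Hco Hd]].
  destruct (curve_is_derive _ p Theta_curve) as [co' [Hco' Hd']].
  assert (H0 : Rabs 0 < rho) by (rewrite Rabs_R0; lra).
  specialize (Hd 0 H0); specialize (Hd' 0 H0); rewrite Rplus_0_r, PSeries_0 in Hd, Hd'.
  apply is_derive_unique in Hd; apply is_derive_unique in Hd'.
  unfold PS_derive in Hd, Hd'; simpl INR in Hd, Hd'; rewrite Rmult_1_l in Hd, Hd'.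
  rewrite Hd, Hd'; clear Hd Hd'.
  pose proof (has_coefs_0 _ _ _ _ Hrho Hco) as Z1; pose proof (has_coefs_0 _ _ _ _ Hrho Hco') as Z2.
  cbv beta in Z1, Z2; rewrite Rplus_0_r, Rminus_diag in Z1, Z2.
  assert (Htr' : Rabs t < rho) by (rewrite Rabs_pos_eq; lra).
  assert (Hth : 0 <= t / rho < 1).
  { split; [apply Rdiv_le_0_compat; lra|apply (Rdiv_lt_1 _ _ Hrho); lra]. }
  assert (Htt : Rabs t <= t / rho * rho) by (rewrite Rabs_pos_eq by lra; right; field; lra).
  pose proof (pseries_tail rho eta (t / rho) t _ co 1 Hrho (proj1 Hco) Hth Htt
    (proj2 Hco t Htr')) as T1.
  pose proof (pseries_tail rho eta (t / rho) t _ co' 1 Hrho (proj1 Hco') Hth Htt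
    (proj2 Hco' t Htr')) as T2.
  rewrite sum_Sn, sum_O in T1, T2; change (Hierarchy.plus ?x ?y) with (x + y) in T1, T2.
  rewrite <- Z1 in T1; rewrite <- Z2 in T2; simpl pow in T1, T2.
  assert (EK : eta * (t / rho * (t / rho * 1)) = K / 2 * t * t) by (unfold K; field; lra).
  rewrite EK in T1, T2.
  pose proof (Theta_approx m a p (proj1 Ha)) as A1.
  pose proof (Theta_approx m a (p + t) (proj1 Ha)) as A2.
  set (u1 := gtr m a (p + t)) in *; set (u0 := gtr m a p) in *.
  set (v1 := Theta (p + t)) in *; set (v0 := Theta p) in *.
  assert (H : Rabs (t * (co 1%nat - co' 1%nat)) <= 4 * lam ^ m + K * t * t).
  { apply Rabs_le_between in T1; apply Rabs_le_between in T2.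
    apply Rabs_le_between in A1; apply Rabs_le_between in A2; apply Rabs_le; lra. }
  rewrite Rabs_mult, (Rabs_pos_eq t) in H by lra.
  apply Rmult_lt_reg_l with t; [exact Ht|].
  eapply Rle_lt_trans; [exact H|].
  apply Rmult_lt_compat_l with (r := t) in Hm0; [|exact Ht].
  replace (t * (4 / t * lam ^ m)) with (4 * lam ^ m) in Hm0 by (field; lra).
  nra.
Qed.

Lemma back_f (n : nat) (Y : R) : back n (Nat.iter n (sd_f D) Y) = Y.
Proof.
  induction n as [|n IH]; [reflexivity|].
  rewrite back_S; simpl; unfold Fi; now rewrite sd_fi_f.
Qed.

(* The backward images of the points [x0 + n] are dense in the half-line. *)
Lemma backward_density (h : R -> R) (x0 : R) :
  continuity h -> 0 <= x0 <= 1 ->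
  (forall X, (forall M : nat, h (X + INR M) = h X) ->
     forall M : nat, h (Fi X + INR M) = h (Fi X)) ->
  (forall M : nat, h (x0 + INR M) = h x0) ->
  forall y, 0 <= y -> h (y + 1) = h y.
Proof.
  intros Hc Hx0 Hstep Hbase y Hy.
  set (Q := fun X => forall M : nat, h (X + INR M) = h X).
  assert (Hn : forall n X, Q X -> Q (back n X)).
  { induction n as [|n IH]; intros X HX; [exact HX|]; exact (Hstep _ (IH X HX)). }
  assert (Hz : forall z : nat, Q (x0 + INR z)).
  { intros z M; rewrite Rplus_assoc, <- plus_INR, !Hbase; reflexivity. }
  assert (Hfn : forall n, 0 <= Nat.iter n (sd_f D) y).
  { induction n as [|n IH]; [exact Hy|now apply sd_f_pos]. }
  (* The point [x0 + z n] is within 1 of the n-th forward image of [y], so its n-th backward image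
     is within [kap ^ n] of [y]. *)
  set (z := fun n => Z.to_nat (Int_part (Nat.iter n (sd_f D) y))).
  set (p := fun n => back n (x0 + INR (z n))).
  assert (Hp : is_lim_seq p y).
  { apply is_lim_seq_eps; intros e He.
    destruct (pow_lim_zero kap 1 ltac:(lra) e He) as [N HN]; exists N; intros n HnN.
    eapply Rle_lt_trans; [|apply (HN n HnN)].
    unfold p; rewrite <- (back_f n y) at 1.
    eapply Rle_trans; [apply back_lip|]; rewrite Rmult_comm.
    apply Rmult_le_compat_r; [apply pow_le; lra|].
    set (w := Nat.iter n (sd_f D) y).
    destruct (base_Int_part w) as [I1 I2].
    assert (HI : (0 <= Int_part w)%Z).
    { specialize (Hfn n); fold w in Hfn; assert (-1 < IZR (Int_part w)) by lra.
      apply lt_IZR in H; lia. }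
    unfold z; rewrite INR_IZR_INZ, Z2Nat.id by exact HI; fold w.
    apply Rabs_le; lra. }
  assert (L1 : is_lim_seq (fun n => h (p n)) (h y)).
  { apply is_lim_seq_continuous; [apply Hc|exact Hp]. }
  assert (L2 : is_lim_seq (fun n => h (p n + 1)) (h (y + 1))).
  { apply (is_lim_seq_continuous h (fun n => p n + 1)); [apply Hc|].
    apply is_lim_seq_plus'; [exact Hp|apply is_lim_seq_const]. }
  apply is_lim_seq_unique_R with (2 := L1).
  apply is_lim_seq_ext with (2 := L2); intros n.
  exact (Hn n _ (Hz (z n)) 1%nat).
Qed.

(** Restricted to the half-line because values of words are natural numbers; the attractor is later
    read off at nonnegative points, which the lift preserves. *)
Definition half_periodic : Prop := forall y, 0 <= y -> Theta (y + 1) = Theta y.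

Lemma Fi_nat (X : R) (M : nat) : Fi (X + INR b * INR M) = Fi X + INR M.
Proof. rewrite (INR_IZR_INZ M); apply Fi_Z. Qed.

Lemma gl_nat (x y : R) (M : nat) : gl (x + INR M) y = gl x y.
Proof. rewrite INR_IZR_INZ; apply gl_per. Qed.

(** Equality of all translates at [X] passes to [Fi X]: translation by [b * M] at [X] is translation
    by [M] at [Fi X], and the fibre maps are injective. *)
Lemma Theta_separated (x : R) : ~ half_periodic -> 0 <= x <= 1 ->
  exists M : nat, Theta (x + INR M) <> Theta x.
Proof.
  intros Hnp Hx; apply NNPP; intros Hn; apply Hnp.
  intros y Hy; apply (backward_density Theta x); auto.
  - apply curve_continuity, Theta_curve.
  - intros X HX M; apply (gl_inj (Fi X)); try apply Theta_U.
    rewrite Theta_inv, <- (HX (b * M)%nat), mult_INR.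
    rewrite <- (Theta_inv (X + INR b * INR M)), Fi_nat, gl_nat.
    reflexivity.
  - intros M; apply NNPP; intros HM; apply Hn; now exists M.
Qed.

Lemma back_01 (n : nat) (x : R) : 0 <= x <= 1 -> 0 <= back n x <= 1.
Proof.
  intros H; induction n as [|n IH]; [exact H|].
  apply sd_fi_01; split; [apply IH|].
  pose proof (le_INR 1 b b_pos) as Hb1; simpl in Hb1.
  change (back n x <= INR b); lra.
Qed.

(** Separation is taken at [back m x] and carried forward by [m] steps: injectivity keeps it
    nonzero, contraction makes it small, and [M] becomes [b ^ m * M]. *)
Lemma Theta_separated_close (x e : R) : ~ half_periodic -> 0 <= x <= 1 -> 0 < e ->
  exists M : nat, 0 < Rabs (Theta (x + INR M) - Theta x) < e.
Proof.
  intros Hnp Hx He.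
  destruct (pow_lim_zero lam 2 ltac:(lra) e He) as [m Hm]; specialize (Hm m (Nat.le_refl m)).
  destruct (Theta_separated (back m x) Hnp (back_01 m x Hx)) as [M HM].
  exists (b ^ m * M)%nat.
  assert (E : Theta (x + INR (b ^ m * M)) = gtr m (fun Y => Theta (Y + INR M)) x).
  { rewrite <- (Theta_gtr m (x + INR (b ^ m * M))).
    rewrite INR_IZR_INZ, Nat2Z.inj_mul, Nat2Z.inj_pow, gtr_shift, <- INR_IZR_INZ.
    reflexivity. }
  rewrite E, <- (Theta_gtr m x); split.
  - apply Rabs_pos_lt; intros H; apply HM.
    apply (gtr_inj m (fun Y => Theta (Y + INR M)) Theta x); [intros Y; apply Theta_U|
      exact Theta_U|lra].
  - eapply Rle_lt_trans; [apply gtr_contract2; [intros Y; apply Theta_U|exact Theta_U]|exact Hm].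
Qed.

(** * The case of a constant fibre derivative *)

Lemma gl_fibre_coefs (x y : R) : in_U y ->
  exists co, has_coefs eps L co (fun t => gl x (y + t)).
Proof.
  intros Hy; destruct (gl_good x y Hy) as [_ [H _]].
  assert (Hn : near3 eps x y eps (fun _ => x) (fun t => y + t) (fun _ => y)).
  { split; [|split].
    - apply anorm_le_const_le; [lra|rewrite Rminus_diag, Rabs_R0; lra].
    - apply anorm_le_ext with (fun t => t); [intros; ring|apply anorm_le_id; lra].
    - apply anorm_le_const_le; [lra|rewrite Rminus_diag, Rabs_R0; lra]. }
  exact (proj1 (H eps 0 _ _ _ _ _ _ Heps Hn Hn (dist3_refl eps 0 _ _ _ Heps (Rle_refl 0)))).
Qed.

Lemma fibre_derivative_rigid (x y c : R) : in_U y ->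
  (forall e, 0 < e -> exists t, 0 < Rabs t < e /\ Derive (gl x) (y + t) = c) ->
  forall t, Rabs t < eps -> Derive (gl x) (y + t) = c.
Proof.
  intros Hy Hz; destruct (gl_fibre_coefs x y Hy) as [co Hco].
  assert (Hd : forall t, Rabs t < eps -> Derive (gl x) (y + t) = PSeries (PS_derive co) t).
  { intros t Ht; apply is_derive_unique; exact (has_coefs_is_derive _ _ _ _ _ _ Hco Ht). }
  assert (Hrad : forall t, Rabs t < eps -> Rbar_lt (Rabs t) (CV_radius (PS_derive co))).
  { intros t Ht; rewrite CV_radius_derive; exact (coef_bound_radius _ _ _ _ (proj1 Hco) Ht). }
  set (co1 := PS_minus (PS_derive co) (PS_scal c one_coefs)).
  assert (Hone : forall t, Rabs t < eps -> is_pseries (PS_scal c one_coefs) t c).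
  { intros t Ht.
    pose proof (is_pseries_scal c one_coefs t 1 (Rmult_comm _ _)) as H.
    replace c with (scal c 1) at 2 by (unfold scal; simpl; unfold mult; simpl; ring_R).
    apply H; rewrite <- (PSeries_one_coefs t); apply PSeries_correct.
    eapply coef_bound_ex_pseries; [apply (one_coefs_bound eps)|exact Ht]. }
  assert (Hco1 : forall t, Rabs t < eps -> is_pseries co1 t (PSeries (PS_derive co) t - c)).
  { intros t Ht; apply (is_pseries_minus (PS_derive co) (PS_scal c one_coefs)); [|auto].
    apply PSeries_correct, CV_radius_inside, Hrad, Ht. }
  assert (Hr1 : Rbar_lt 0 (CV_radius co1)).
  { apply Rbar_lt_le_trans with (eps / 2); [simpl; lra|].
    rewrite <- (Rabs_pos_eq (eps / 2)) by lra.
    apply Rbar_not_lt_le; intros Hlt.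
    apply (CV_disk_outside co1 (eps / 2) Hlt), ex_series_lim_0, ex_pseries_R.
    eexists; apply Hco1; rewrite Rabs_pos_eq; lra. }
  assert (Hzero : forall k, co1 k = 0).
  { apply pseries_zeros; [exact Hr1|]; intros e He.
    destruct (Hz (Rmin e eps)) as [t [Ht Et]]; [now apply Rmin_pos|].
    pose proof (Rmin_l e eps); pose proof (Rmin_r e eps).
    exists t; split; [lra|].
    rewrite (is_pseries_unique _ _ _ (Hco1 t ltac:(lra))), <- Hd, Et by lra; ring. }
  intros t Ht; rewrite Hd by exact Ht.
  assert (E : PSeries co1 t = 0).
  { rewrite (PSeries_ext co1 (fun _ => 0)) by exact Hzero; apply PSeries_const_0. }
  rewrite (is_pseries_unique _ _ _ (Hco1 t Ht)) in E; lra.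
Qed.

(** Continuation along the segment from [y0] to [y]: the step is at most [eps / 2], so each new
    centre is an accumulation point of points where the value is already known. *)
Lemma fibre_derivative_const (x y0 c : R) : in_U y0 ->
  (forall e, 0 < e -> exists t, 0 < Rabs t < e /\ Derive (gl x) (y0 + t) = c) ->
  forall y, in_U y -> Derive (gl x) y = c.
Proof.
  intros Hy0 Hz y Hy.
  destruct (exists_inv_le (eps / 4)) as [J HJ]; [lra|].
  pose proof (inv_INR_pos J) as HJp; set (w := / (INR J + 1)) in *.
  assert (HJ1 : (INR J + 1) * w = 1).
  { unfold w; apply Rinv_r; pose proof (pos_INR J); lra. }
  pose proof (in_U_dist y y0 Hy Hy0) as Hd.
  assert (Hi : forall i, (i <= J + 1)%nat -> forall t, Rabs t < eps ->
    Derive (gl x) (y0 + INR i * w * (y - y0) + t) = c).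
  { induction i as [|i IH]; intros Hle.
    - simpl; rewrite !Rmult_0_l, Rplus_0_r; now apply fibre_derivative_rigid.
    - assert (Hc : 0 <= INR (S i) * w <= 1).
      { split; [apply Rmult_le_pos; [apply pos_INR|lra]|].
        rewrite <- HJ1; apply Rmult_le_compat_r; [lra|].
        apply le_INR in Hle; rewrite plus_INR in Hle; simpl (INR 1) in Hle; lra. }
      apply fibre_derivative_rigid.
      + unfold in_U in *; nra.
      + intros e He; exists (Rmin (e / 2) (eps / 4)).
        assert (Hm : 0 < Rmin (e / 2) (eps / 4)) by (apply Rmin_pos; lra).
        pose proof (Rmin_l (e / 2) (eps / 4)); pose proof (Rmin_r (e / 2) (eps / 4)).
        rewrite Rabs_pos_eq by lra; split; [lra|].
        rewrite <- (IH ltac:(lia) (w * (y - y0) + Rmin (e / 2) (eps / 4))).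
        * f_equal; rewrite S_INR; ring.
        * eapply Rle_lt_trans; [apply Rabs_triang|].
          rewrite Rabs_mult, (Rabs_pos_eq w), (Rabs_pos_eq (Rmin _ _)) by lra; nra. }
  pose proof (Hi (J + 1)%nat (Nat.le_refl _) 0 ltac:(rewrite Rabs_R0; lra)) as H.
  rewrite plus_INR in H; simpl (INR 1) in H; rewrite HJ1 in H.
  replace (y0 + 1 * (y - y0) + 0) with y in H by ring; exact H.
Qed.

Lemma secant_diag_lip (x y x' y' d : R) : in_U y -> d <= eps ->
  Rabs (x' - x) <= d -> Rabs (y' - y) <= d ->
  Rabs (Derive (gl x') y' - Derive (gl x) y) <= L * d.
Proof.
  intros Hy Hd Hx' Hy'; rewrite <- !secant_diag.
  apply (op_bound_lip x y eps lam L d (secant gl)); auto.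
  - apply (gl_good x y Hy).
  - unfold ball3; lra.
  - pose proof (Rabs_pos (x' - x)); unfold ball3; rewrite !Rminus_diag, Rabs_R0; lra.
Qed.

Lemma fibre_derivative_const_at (x : R) : ~ half_periodic ->
  (forall Y Y', Rabs (Derive (gl Y) (Theta Y)) = Rabs (Derive (gl Y') (Theta Y'))) ->
  0 <= x <= 1 -> forall y, in_U y -> Derive (gl x) y = Derive (gl x) (Theta x).
Proof.
  intros Hnp Hconst Hx; apply fibre_derivative_const with (Theta x); [apply Theta_U|].
  intros e He.
  set (c := Derive (gl x) (Theta x)).
  assert (Hc : r <= Rabs c).
  { unfold c; rewrite <- secant_diag; apply gl_secant_bounds; apply Theta_U. }
  (* Only the absolute value is known to be constant. With [L * d < r] a change of sign is
     impossible, since both derivatives have absolute value at least [r]. *)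
  set (d := Rmin (Rmin e eps) (r / (L + 1))).
  assert (Hd : 0 < d) by (repeat apply Rmin_pos; try lra; apply Rdiv_lt_0_compat; lra).
  assert (Hde : d <= e) by (eapply Rle_trans; [apply Rmin_l|apply Rmin_l]).
  assert (Hdp : d <= eps) by (eapply Rle_trans; [apply Rmin_l|apply Rmin_r]).
  assert (Hdr : L * d < r).
  { assert (H : d <= r / (L + 1)) by apply Rmin_r.
    apply Rmult_le_compat_r with (r := L + 1) in H; [|lra].
    replace (r / (L + 1) * (L + 1)) with r in H by (field; lra); nra. }
  destruct (Theta_separated_close x d Hnp Hx Hd) as [M HM].
  exists (Theta (x + INR M) - Theta x); split; [lra|].
  replace (Theta x + (Theta (x + INR M) - Theta x)) with (Theta (x + INR M)) by ring.
  assert (E1 : Rabs (Derive (gl x) (Theta (x + INR M))) = Rabs c).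
  { unfold c; rewrite <- (Hconst (x + INR M) x); f_equal; apply Derive_ext.
    intros t; now rewrite gl_nat. }
  assert (E2 : Rabs (Derive (gl x) (Theta (x + INR M)) - c) <= L * d).
  { apply secant_diag_lip; [apply Theta_U|exact Hdp| |lra].
    rewrite Rminus_diag, Rabs_R0; lra. }
  revert E1 E2; generalize (Derive (gl x) (Theta (x + INR M))); intros u E1 E2.
  revert E1 E2 Hc; unfold Rabs; repeat destruct (Rcase_abs _); lra.
Qed.

(** Across fibres the absolute value is fixed and nonzero, and the derivative is continuous in [x],
    so a change of sign would contradict the intermediate value theorem. *)
Lemma fibre_derivative_constant : ~ half_periodic ->
  (forall Y Y', Rabs (Derive (gl Y) (Theta Y)) = Rabs (Derive (gl Y') (Theta Y'))) ->
  exists k, k <> 0 /\ forall x y, in_U y -> Derive (gl x) y = k.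
Proof.
  intros Hnp Hconst.
  set (k := fun x => Derive (gl x) 0).
  assert (Hper : forall x (q : Z) y, Derive (gl (x + IZR q)) y = Derive (gl x) y).
  { intros x q y; apply Derive_ext; intros t; apply gl_per. }
  assert (H01 : forall x, 0 <= x <= 1 ->
    (forall y, in_U y -> Derive (gl x) y = k x) /\ Rabs (k x) = Rabs (k 0)).
  { intros x Hx.
    pose proof (fibre_derivative_const_at x Hnp Hconst Hx) as H.
    pose proof (fibre_derivative_const_at 0 Hnp Hconst ltac:(lra)) as H'.
    unfold k; rewrite (H 0 in_U_0), (H' 0 in_U_0); split; [exact H|apply Hconst]. }
  assert (Hall : forall x,
    (forall y, in_U y -> Derive (gl x) y = k x) /\ Rabs (k x) = Rabs (k 0)).
  { intros x; destruct (base_fp x) as [Hf1 Hf2].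
    assert (Ex : x = frac_part x + IZR (Int_part x)) by (unfold frac_part; ring).
    destruct (H01 (frac_part x) ltac:(lra)) as [H1 H2]; unfold k in *.
    rewrite Ex; split; [intros y Hy|]; rewrite !Hper; auto. }
  assert (Hk0 : 0 < Rabs (k 0)).
  { unfold k; rewrite <- secant_diag.
    pose proof (gl_secant_bounds 0 0 0 in_U_0 in_U_0); lra. }
  assert (Hcont : continuity k).
  { intros x e He.
    assert (Hd : 0 < Rmin eps (e / (L + 1))).
    { apply Rmin_pos; [lra|apply Rdiv_lt_0_compat; lra]. }
    exists (Rmin eps (e / (L + 1))); split; [exact Hd|].
    intros x' [_ Hx']; simpl in *; unfold Rdist in *.
    assert (H2 : Rabs (x' - x) < e / (L + 1)) by (eapply Rlt_le_trans; [exact Hx'|apply Rmin_r]).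
    assert (H1 : Rabs (x' - x) < eps) by (eapply Rlt_le_trans; [exact Hx'|apply Rmin_l]).
    eapply Rle_lt_trans; [apply (secant_diag_lip x 0 x' 0 (Rabs (x' - x)) in_U_0)|].
    - lra.
    - lra.
    - rewrite Rminus_diag, Rabs_R0; apply Rabs_pos.
    - apply Rmult_lt_compat_r with (r := L + 1) in H2; [|lra].
      replace (e / (L + 1) * (L + 1)) with e in H2 by (field; lra).
      pose proof (Rabs_pos (x' - x)); nra. }
  exists (k 0); split; [intros E; rewrite E, Rabs_R0 in Hk0; lra|].
  intros x y Hy; destruct (Hall x) as [H1 H2]; rewrite (H1 y Hy).
  apply NNPP; intros Hne.
  destruct (IVT_gen k 0 x 0 Hcont) as [z [_ Hz]].
  - assert (E : k x = - k 0).
    { revert H2 Hne; unfold Rabs; repeat destruct (Rcase_abs _); lra. }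
    rewrite E; unfold Rmin, Rmax; repeat destruct (Rle_dec _ _); lra.
  - destruct (Hall z) as [_ H3]; rewrite Hz, Rabs_R0 in H3; lra.
Qed.

Lemma gl_affine (k x y z : R) :
  (forall x y, in_U y -> Derive (gl x) y = k) -> in_U y -> in_U z ->
  gl x y - gl x z = k * (y - z).
Proof.
  intros Hk Hy Hz; destruct (MVT_gen (gl x) z y (fun _ => k)) as [c [_ E]]; [| |exact E].
  - intros c Hc; rewrite <- (Hk x c); [apply gl_is_derive|]; unfold in_U in *;
      unfold Rmin, Rmax in Hc; destruct (Rle_dec z y); lra.
  - intros c Hc; apply continuity_pt_filterlim, (ex_derive_continuous (gl x)).
    eexists; apply gl_is_derive; unfold in_U in *;
      unfold Rmin, Rmax in Hc; destruct (Rle_dec z y); lra.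
Qed.

Lemma gtr_affine (k : R) (n : nat) (a c : R -> R) (X : R) :
  (forall x y, in_U y -> Derive (gl x) y = k) -> valued_U a -> valued_U c ->
  gtr n a X - gtr n c X = k ^ n * (a (back n X) - c (back n X)).
Proof.
  intros Hk Ha Hc; revert X; induction n as [|n IH]; intros X; [simpl; ring|].
  rewrite back_S; change (gl (Fi X) (gtr n a (Fi X)) - gl (Fi X) (gtr n c (Fi X))
    = k * k ^ n * (a (back n (Fi X)) - c (back n (Fi X)))).
  rewrite (gl_affine k) by (auto; now apply gtr_U); rewrite IH; ring.
Qed.

Lemma Fi_ex_derive (X : R) : ex_derive Fi X.
Proof.
  destruct (Fi_norm X) as [co Hco].
  pose proof (has_coefs_is_derive rho _ X 0 co (fun x => Fi x - Fi X) Hco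
    ltac:(rewrite Rabs_R0; lra)) as H; rewrite Rplus_0_r in H.
  apply (ex_derive_ext (fun x => (Fi x - Fi X) + Fi X)); [intros; ring_R|].
  apply (ex_derive_plus (fun x => Fi x - Fi X) (fun _ => Fi X)); [exact (ex_intro _ _ H)|].
  apply ex_derive_const.
Qed.

Lemma back_derive (n : nat) (X s : R) : 0 <= s -> (forall X, s <= Rabs (Derive Fi X)) ->
  ex_derive (back n) X /\ s ^ n <= Rabs (Derive (back n) X).
Proof.
  intros Hs Hd; revert X; induction n as [|n IH]; intros X.
  - split; [apply ex_derive_id|].
    change (s ^ 0 <= Rabs (Derive (fun x => x) X)); rewrite Derive_id, Rabs_R1; simpl; lra.
  - destruct (IH X) as [H1 H2]; split.
    + apply (ex_derive_comp Fi (back n)); [apply Fi_ex_derive|exact H1].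
    + change (s * s ^ n <= Rabs (Derive (fun x => Fi (back n x)) X)).
      rewrite Derive_comp by (auto using Fi_ex_derive).
      rewrite Rabs_mult, Rmult_comm.
      apply Rmult_le_compat; auto using pow_le.
Qed.

(** Here the difference is exactly [k ^ n] times a difference composed with the n-th inverse
    iterate, so the chain rule contributes the power of [s], later [kappa_min]. *)
Lemma gtr_affine_derive (k s : R) (n : nat) (a c : R -> R) (X : R) :
  (forall x y, in_U y -> Derive (gl x) y = k) -> curve a -> curve c ->
  0 <= s -> (forall X, s <= Rabs (Derive Fi X)) ->
  (Rabs k * s) ^ n * Rabs (Derive a (back n X) - Derive c (back n X))
    <= Rabs (Derive (fun x => gtr n a x - gtr n c x) X).
Proof.
  intros Hk Ha Hc Hs Hd; destruct (back_derive n X s Hs Hd) as [H1 H2].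
  assert (Ea := curve_ex_derive a (back n X) Ha); assert (Ec := curve_ex_derive c (back n X) Hc).
  rewrite (Derive_ext (fun x => gtr n a x - gtr n c x)
    (fun x => k ^ n * (a (back n x) - c (back n x)))).
  2:{ intros x; apply gtr_affine; [exact Hk|apply Ha|apply Hc]. }
  rewrite Derive_scal, (Derive_comp (fun y => a y - c y) (back n)); [|now apply (ex_derive_minus a c)|exact H1].
  rewrite Derive_minus by auto.
  rewrite !Rabs_mult, <- RPow_abs, Rpow_mult_distr, Rmult_assoc.
  apply Rmult_le_compat_l; [apply pow_le, Rabs_pos|].
  apply Rmult_le_compat_r; [apply Rabs_pos|exact H2].
Qed.

Lemma Theta_derive_separated (k x : R) : ~ half_periodic -> k <> 0 ->
  (forall x y, in_U y -> Derive (gl x) y = k) -> 0 <= x <= 1 ->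
  exists M : nat, Derive Theta (x + INR M) <> Derive Theta x.
Proof.
  intros Hnp Hk0 Hk Hx; apply NNPP; intros Hn; apply Hnp.
  assert (Hex : forall X, ex_derive Theta X) by (intros; apply curve_ex_derive, Theta_curve).
  assert (Hexs : forall q X, ex_derive (fun x => Theta (x + q)) X).
  { intros q X; apply (ex_derive_comp Theta (fun x => x + q)); [apply Hex|auto_derive; auto]. }
  assert (Hper : forall y, 0 <= y -> Derive Theta (y + 1) = Derive Theta y).
  { apply (backward_density (Derive Theta) x); auto.
    - apply curve_derive_continuity, Theta_curve.
    - intros X HX M.
      assert (E : forall Z, Theta (Z + INR b * INR M) - Theta Z
        = k * (Theta (Fi Z + INR M) - Theta (Fi Z))).
      { intros Z; rewrite <- (Theta_inv (Z + INR b * INR M)), <- (Theta_inv Z).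
        rewrite Fi_nat, gl_nat; apply gl_affine; auto; apply Theta_U. }
      assert (E' : Derive Theta (X + INR b * INR M) - Derive Theta X
        = k * (Derive Fi X * (Derive Theta (Fi X + INR M) - Derive Theta (Fi X)))).
      { rewrite <- (Derive_shift Theta (INR b * INR M)), <- (Derive_shift Theta (INR M)).
        rewrite <- !Derive_minus by auto.
        rewrite (Derive_ext _ _ X E), Derive_scal; f_equal.
        apply (Derive_comp (fun y => Theta (y + INR M) - Theta y) Fi); [|apply Fi_ex_derive].
        apply (ex_derive_minus (fun y => Theta (y + INR M)) Theta); auto. }
      rewrite <- mult_INR, HX, Rminus_diag in E'; symmetry in E'.
      (* Periodicity of the derivative passes to [Fi X] because both [k] and the derivative of [Fi]
         can be cancelled. *)
      apply Rmult_integral in E'; destruct E' as [E'|E']; [contradiction|].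
      apply Rmult_integral in E'; destruct E' as [E'|E'].
      + now apply sd_fi_der in E'.
      + lra.
    - intros M; apply NNPP; intros HM; apply Hn; now exists M. }
  set (c := Theta (0 + 1) - Theta 0).
  assert (Hc : forall y, 0 <= y -> Theta (y + 1) - Theta y = c).
  { intros y Hy.
    destruct (MVT_gen (fun x => Theta (x + 1) - Theta x) 0 y (fun _ => 0)) as [z [_ Ez]].
    - intros z Hz; rewrite Rmin_left in Hz by exact Hy.
      replace 0 with (Derive Theta (z + 1) - Derive Theta z)
        by (rewrite Hper by lra; ring).
      rewrite <- Derive_shift.
      apply (is_derive_minus (fun x => Theta (x + 1)) Theta); apply Derive_correct; auto.
    - intros z _; apply continuity_pt_filterlim.
      apply (ex_derive_continuous (fun x => Theta (x + 1) - Theta x)).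
      apply (ex_derive_minus (fun x => Theta (x + 1)) Theta); auto.
    - unfold c; lra. }
  assert (Hn2 : forall n : nat, Theta (INR n) = Theta 0 + INR n * c).
  { induction n as [|n IH]; [simpl; ring|].
    rewrite S_INR; pose proof (Hc (INR n) (pos_INR n)); lra. }
  assert (Hc0 : c = 0).
  { apply NNPP; intros Hne.
    destruct (INR_unbounded (3 / Rabs c)) as [n Hn3].
    pose proof (Rabs_pos_lt c Hne) as Hp.
    apply Rmult_gt_compat_r with (r := Rabs c) in Hn3; [|exact Hp].
    replace (3 / Rabs c * Rabs c) with 3 in Hn3 by (field; lra).
    pose proof (in_U_dist _ _ (Theta_U (INR n)) (Theta_U 0)) as B.
    rewrite Hn2 in B; replace (Theta 0 + INR n * c - Theta 0) with (INR n * c) in B by ring.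
    rewrite Rabs_mult, (Rabs_pos_eq (INR n)) in B by apply pos_INR; lra. }
  intros y Hy; specialize (Hc y Hy); lra.
Qed.

End Dynamics.

(** * Words *)

Fixpoint word_val (b : nat) (u : list nat) : nat :=
  match u with nil => O | i :: u => (i + b * word_val b u)%nat end.

Lemma word_val_app (b : nat) (u v : list nat) :
  word_val b (u ++ v) = (word_val b u + b ^ length u * word_val b v)%nat.
Proof.
  induction u as [|i u IH]; simpl; [lia|]; rewrite IH; ring.
Qed.

Lemma word_val_surj (b n M : nat) : (M < b ^ n)%nat ->
  exists w, is_word b w /\ length w = n /\ word_val b w = M.
Proof.
  revert M; induction n as [|n IH]; intros M HM; simpl in HM.
  - exists nil; repeat split; [constructor|simpl; lia].
  - assert (Hb : b <> 0%nat) by (intros ->; lia).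
    destruct (IH (M / b)%nat) as [w [H1 [H2 H3]]].
    { apply Nat.Div0.div_lt_upper_bound; lia. }
    exists (M mod b :: w)%nat; repeat split.
    + constructor; [now apply Nat.mod_upper_bound|exact H1].
    + simpl; now rewrite H2.
    + simpl; rewrite H3; pose proof (Nat.div_mod_eq M b); lia.
Qed.

Lemma fold_right_map_S (f : nat -> R -> R) (y : R) (l : list nat) :
  fold_right f y (map S l) = fold_right (fun k => f (S k)) y l.
Proof. induction l as [|k l IH]; simpl; [reflexivity|now rewrite IH]. Qed.

Lemma theta2_cons (F : R -> R) (g : circle -> R -> R) (i : nat) (u : list nat) (x y : R) :
  theta2 F g (i :: u) x y = g (proj (branch F i x)) (theta2 F g u (branch F i x) y).
Proof.
  unfold theta2; simpl length; simpl List.seq; rewrite <- seq_shift; simpl.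
  now rewrite fold_right_map_S.
Qed.

Section Words.

Variables (D : skew_data) (F : R -> R) (g : circle -> R -> R).
Hypothesis Hg : sd_g D = fun x y => g (proj x) y.
Hypothesis HFi : sd_fi D = inverse F.

Notation b := (sd_b D).

(** The head [i] is the lowest digit: [Fi] maps [x + i + b * val] to [Fi (x + i) + val], and the
    last summand is invisible to [gl]. *)
Lemma theta_gtr (u : list nat) (x : R) :
  theta F g u x = gtr D (length u) (fun _ => 0) (x + INR (word_val b u)).
Proof.
  unfold theta; revert x; induction u as [|i u IH]; intros x; [reflexivity|].
  rewrite theta2_cons, IH.
  change (gtr D (length (i :: u)) (fun _ => 0) (x + INR (word_val b (i :: u)))) with
    (sd_g D (sd_fi D (x + INR (i + b * word_val b u)))
       (gtr D (length u) (fun _ => 0) (sd_fi D (x + INR (i + b * word_val b u))))).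
  rewrite plus_INR, mult_INR, <- Rplus_assoc, Fi_nat, gl_nat, Hg, HFi; reflexivity.
Qed.

(** The curve on the line belonging to the suffix [v]; a prefix acts on it by the graph
    transform. *)
Definition tail_curve (v : list nat) (Y : R) : R :=
  gtr D (length v) (fun _ => 0) (Y + INR (word_val b v)).

Lemma tail_curve_curve (v : list nat) : curve D (tail_curve v).
Proof. apply curve_shift, gtr_curve, curve_0. Qed.

Lemma gtr_nat_shift (n M : nat) (a : R -> R) (X : R) :
  gtr D n a (X + INR (b ^ n * M)) = gtr D n (fun Y => a (Y + INR M)) X.
Proof.
  rewrite !INR_IZR_INZ, Nat2Z.inj_mul, Nat2Z.inj_pow; apply gtr_shift.
Qed.

Lemma tail_curve_app (u v : list nat) (Y : R) :
  tail_curve (u ++ v) Y = gtr D (length u) (tail_curve v) (Y + INR (word_val b u)).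
Proof.
  unfold tail_curve at 1; rewrite length_app, word_val_app, plus_INR, <- Rplus_assoc.
  rewrite gtr_add; apply gtr_nat_shift.
Qed.

Lemma theta_diff_gtr (u v w : list nat) (x : R) :
  theta_diff F g (u ++ v) (u ++ w) x
  = gtr D (length u) (tail_curve v) (x + INR (word_val b u))
    - gtr D (length u) (tail_curve w) (x + INR (word_val b u)).
Proof.
  unfold theta_diff; rewrite !theta_gtr, <- !tail_curve_app; reflexivity.
Qed.

Lemma Derive_n_theta_diff (u v w : list nat) (k : nat) (x : R) :
  Derive_n (theta_diff F g (u ++ v) (u ++ w)) k x
  = Derive_n (fun X => gtr D (length u) (tail_curve v) X - gtr D (length u) (tail_curve w) X)
      k (x + INR (word_val b u)).
Proof.
  rewrite (Derive_n_ext _ (fun x => (fun X => gtr D (length u) (tail_curve v) X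
    - gtr D (length u) (tail_curve w) X) (x + INR (word_val b u)))).
  - apply (Derive_n_comp_trans (fun X => gtr D (length u) (tail_curve v) X
      - gtr D (length u) (tail_curve w) X)).
  - intros t; apply theta_diff_gtr.
Qed.

Lemma tail_curve_Theta (u v : list nat) (Y : R) :
  Rabs (tail_curve (u ++ v) Y - Theta D (Y + INR (word_val b u))) <= 2 * sd_lam D ^ length u.
Proof. rewrite tail_curve_app; apply Theta_approx, tail_curve_curve. Qed.

Lemma tail_curve_close (u v : list nat) (Y : R) :
  Rabs (tail_curve u Y - tail_curve (u ++ v) Y) <= 2 * sd_lam D ^ length u.
Proof.
  rewrite tail_curve_app; apply gtr_contract2; [apply const_U, in_U_0|apply tail_curve_curve].
Qed.

Lemma Derive_tail_curve (u v : list nat) (Y : R) :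
  Derive (tail_curve (u ++ v)) Y
  = Derive (gtr D (length u) (tail_curve v)) (Y + INR (word_val b u)).
Proof.
  rewrite <- Derive_shift; apply Derive_ext; intros t; apply tail_curve_app.
Qed.

(** Whatever the prefix, suffix curves are compared at a point of [[0,1]], which is why compactness
    of that interval gives constants independent of [u]. *)
Lemma back_word (u : list nat) (x : R) : is_word b u -> 0 <= x <= 1 ->
  0 <= back D (length u) (x + INR (word_val b u)) <= 1.
Proof.
  revert x; induction u as [|i u IH]; intros x Hu Hx.
  - simpl; rewrite Rplus_0_r; exact Hx.
  - inversion Hu as [|? ? Hi Hu']; subst.
    simpl length; simpl word_val; rewrite back_S, plus_INR, mult_INR, <- Rplus_assoc, Fi_nat.
    apply IH; [exact Hu'|]; apply sd_fi_01.
    apply le_INR in Hi; rewrite S_INR in Hi; pose proof (pos_INR i); lra.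
Qed.

End Words.

(** * The attractor *)

Lemma circle_eq (p q : circle) : circle_rep p = circle_rep q -> p = q.
Proof.
  destruct p as [x Hx], q as [y Hy]; simpl; intros ->; f_equal; apply proof_irrelevance.
Qed.

Lemma frac_part_Z (x : R) (q : Z) : frac_part (x + IZR q) = frac_part x.
Proof.
  symmetry; apply (Int_part_frac_part_spec (x + IZR q) (Int_part x + q) (frac_part x)).
  - apply frac_part_bound.
  - rewrite plus_IZR; unfold frac_part; ring.
Qed.

Lemma proj_Z (x : R) (q : Z) : proj (x + IZR q) = proj x.
Proof. apply circle_eq; simpl; apply frac_part_Z. Qed.

Lemma proj_rep (c : circle) : proj (circle_rep c) = c.
Proof.
  apply circle_eq; simpl; symmetry.
  apply (Int_part_frac_part_spec (circle_rep c) 0 (circle_rep c)); [apply c|ring].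
Qed.

Section Attractor.

Variables (D : skew_data) (f : circle -> circle) (F : R -> R) (g : circle -> R -> R).
Hypothesis Hg : sd_g D = fun x y => g (proj x) y.
Hypothesis HF : sd_f D = F.
Hypothesis HFFi : forall X, F (sd_fi D X) = X.
Hypothesis Hlift : is_lift f F.
Hypothesis Hper : half_periodic D.

Lemma skew_iter (n : nat) (X : R) (a : R -> R) :
  Nat.iter n (skew f g) (proj X, a X)
  = (proj (Nat.iter n F X), gtr D n a (Nat.iter n F X)).
Proof.
  induction n as [|n IH]; [reflexivity|].
  simpl Nat.iter at 1; rewrite IH; unfold skew; simpl fst; simpl snd.
  set (Z := Nat.iter n F X); change (Nat.iter (S n) F X) with (F Z).
  change (gtr D (S n) a (F Z)) with (sd_g D (sd_fi D (F Z)) (gtr D n a (sd_fi D (F Z)))).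
  rewrite <- (proj2 Hlift Z), <- HF, sd_fi_f, Hg; reflexivity.
Qed.

Lemma Theta_half_periodic (n : nat) (y : R) : 0 <= y -> Theta D (y + INR n) = Theta D y.
Proof.
  intros Hy; induction n as [|n IH]; [simpl; now rewrite Rplus_0_r|].
  rewrite S_INR, <- Rplus_assoc, Hper, IH; [reflexivity|].
  pose proof (pos_INR n); lra.
Qed.

Lemma Theta_frac_part (X : R) : 0 <= X -> Theta D X = Theta D (frac_part X).
Proof.
  intros HX; pose proof (frac_part_bound X) as B.
  assert (HI : (0 <= Int_part X)%Z).
  { destruct (base_Int_part X) as [H1 H2].
    assert (H : -1 < IZR (Int_part X)) by lra; apply lt_IZR in H; lia. }
  assert (E : X = frac_part X + INR (Z.to_nat (Int_part X))).
  { rewrite INR_IZR_INZ, Z2Nat.id by exact HI; unfold frac_part; ring. }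
  rewrite E at 1; apply Theta_half_periodic; lra.
Qed.

Lemma iter_nonneg (n : nat) (y : R) : 0 <= y -> 0 <= Nat.iter n F y.
Proof.
  intros Hy; induction n as [|n IH]; [exact Hy|].
  change (0 <= F (Nat.iter n F y)).
  pose proof (sd_f_pos D _ IH) as H; rewrite HF in H; exact H.
Qed.

Lemma half_periodic_single_graph : single_graph (attractor f g).
Proof.
  exists (fun c => Theta D (circle_rep c)); split; [intros c; apply Theta_U|split].
  - intros x; simpl.
    (* The translate by [m] keeps a neighbourhood of radius 1 inside the half-line on which
       periodicity is known. *)
    destruct (INR_unbounded (1 - x)) as [m Hm].
    pose proof (sd_rho_pos D) as Hrho.
    assert (HN : anorm_le (sd_rho D) (sd_eta D + Rabs (Theta D (x + INR m)))
      (fun t => Theta D (x + INR m + t))).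
    { eapply anorm_le_ext; [|apply anorm_le_plus; [|apply (proj2 (Theta_curve D) (x + INR m))|
        apply (anorm_le_const _ (Theta D (x + INR m)))]; lra].
      intros t _; simpl; ring. }
    destruct HN as [co Hco].
    assert (Hr : 0 < Rmin (sd_rho D) 1) by (apply Rmin_pos; lra).
    exists co, (mkposreal _ Hr); simpl; intros y Hy.
    assert (H1 : Rabs (y - x) < 1) by (eapply Rlt_le_trans; [exact Hy|apply Rmin_r]).
    assert (H2 : Rabs (y - x) < sd_rho D) by (eapply Rlt_le_trans; [exact Hy|apply Rmin_l]).
    apply Rabs_def2 in H1.
    pose proof (proj2 Hco (y - x) H2) as H; cbv beta in H.
    replace (x + INR m + (y - x)) with (y + INR m) in H by ring.
    rewrite (Theta_frac_part (y + INR m)), INR_IZR_INZ, frac_part_Z in H by lra; exact H.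
  - intros [c y]; simpl; split.
    (* An n-th preimage, seen as a constant curve, puts the point within [2 * lam ^ n] of the graph,
       for every [n]. *)
    + intros H; apply cond_eq; intros e He.
      pose proof (sd_lam_bd D) as Hl.
      destruct (pow_lim_zero (sd_lam D) 2 ltac:(lra) e He) as [n Hn].
      specialize (Hn n (Nat.le_refl n)).
      destruct (H n) as [[c' y'] [Hy' E]]; simpl in Hy'.
      rewrite <- (proj_rep c') in E; rewrite (skew_iter n (circle_rep c') (fun _ => y')) in E.
      set (X := Nat.iter n F (circle_rep c')) in *.
      assert (HX : 0 <= X).
      { apply iter_nonneg, c'. }
      injection E as E1 E2.
      rewrite <- E1, <- E2; simpl circle_rep; rewrite <- Theta_frac_part by exact HX.
      eapply Rle_lt_trans; [apply Theta_approx, const_U, Hy'|exact Hn].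
    + intros -> n.
      exists (proj (back D n (circle_rep c)), Theta D (back D n (circle_rep c))).
      split; [apply Theta_U|].
      rewrite skew_iter, Theta_gtr.
      assert (E : forall X, Nat.iter n F (back D n X) = X).
      { induction n as [|n IH]; intros X; [reflexivity|].
        rewrite Nat.iter_succ_r; simpl back; unfold back; simpl.
        change (Nat.iter n F (F (sd_fi D (back D n X))) = X); rewrite HFFi; apply IH. }
      rewrite E, proj_rep; reflexivity.
Qed.

End Attractor.

(** * Minima and counterexamples *)

(** [real] sends infinite values to 0; the element [e0] and the lower bound 0 show that the infimum
    is finite. *)
Lemma Glb_Rbar_nonneg (E : R -> Prop) (e0 : R) :
  E e0 -> (forall e, E e -> 0 <= e) ->
  0 <= real (Glb_Rbar E) /\ forall e, E e -> real (Glb_Rbar E) <= e.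
Proof.
  intros He0 Hpos; destruct (Glb_Rbar_correct E) as [Hlb Hglb].
  assert (H0 : Rbar_le 0 (Glb_Rbar E)) by (apply Hglb; intros e He; now apply Hpos).
  pose proof (Hlb e0 He0) as H1.
  destruct (Glb_Rbar E) as [l| |]; simpl in *; try contradiction.
  split; [exact H0|]; intros e He; exact (Hlb e He).
Qed.

Lemma r_min_spec (g : circle -> R -> R) :
  0 <= r_min g /\ forall x y, in_U y -> r_min g <= Rabs (Derive (g x) y).
Proof.
  destruct (Glb_Rbar_nonneg (fun r => exists (x : circle) (y : R),
    in_U y /\ r = Rabs (Derive (g x) y)) (Rabs (Derive (g (proj 0)) 0))) as [H1 H2].
  - exists (proj 0), 0; split; [apply in_U_0|reflexivity].
  - intros e [x [y [_ ->]]]; apply Rabs_pos.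
  - split; [exact H1|]; intros x y Hy; apply H2; now exists x, y.
Qed.

Lemma kappa_min_spec (b : nat) (F : R -> R) : (1 <= b)%nat ->
  (forall X (q : Z), inverse F (X + INR b * IZR q) = inverse F X + IZR q) ->
  0 <= kappa_min b F /\ forall X, kappa_min b F <= Rabs (Derive (inverse F) X).
Proof.
  intros Hb HZ.
  destruct (Glb_Rbar_nonneg (fun r => exists (i : nat) (x : R),
    (i < b)%nat /\ 0 <= x <= 1 /\ r = Rabs (Derive (branch F i) x))
    (Rabs (Derive (branch F 0) 0))) as [H1 H2].
  - exists 0%nat, 0; repeat split; try lra; lia.
  - intros e [i [x [_ [_ ->]]]]; apply Rabs_pos.
  - split; [exact H1|]; intros X.
    assert (Hb1 : 1 <= INR b) by (apply (le_INR 1) in Hb; exact Hb).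
    (* Reduction modulo [b], then the integer part of the remainder, gives the branch and the point
       of [[0,1]] at which [kappa_min] controls the derivative. *)
    set (q := Int_part (X / INR b)); set (Y := X - INR b * IZR q).
    assert (HY : 0 <= Y < INR b).
    { destruct (base_Int_part (X / INR b)) as [I1 I2]; fold q in I1, I2.
      assert (E : X / INR b * INR b = X) by (field; lra). unfold Y; nra. }
    set (j := Int_part Y).
    destruct (base_Int_part Y) as [J1 J2]; fold j in J1, J2.
    assert (Hj0 : (0 <= j)%Z).
    { assert (H : -1 < IZR j) by lra; apply lt_IZR in H; lia. }
    assert (Hjb : (Z.to_nat j < b)%nat).
    { apply INR_lt; rewrite INR_IZR_INZ, Z2Nat.id by exact Hj0; lra. }
    assert (Ej : INR (Z.to_nat j) = IZR j) by (rewrite INR_IZR_INZ, Z2Nat.id by exact Hj0; auto).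
    assert (E : Derive (inverse F) X = Derive (branch F (Z.to_nat j)) (Y - IZR j)).
    { unfold branch; rewrite Derive_shift, Ej.
      replace (Y - IZR j + IZR j) with Y by ring.
      replace X with (Y + INR b * IZR q) by (unfold Y; ring).
      rewrite <- Derive_shift, (Derive_ext _ (fun x => inverse F x + IZR q)) by (intros; apply HZ).
      unfold Derive; f_equal; apply Lim_ext; intros h; f_equal; ring. }
    rewrite E; apply H2; exists (Z.to_nat j), (Y - IZR j); repeat split; auto; lra.
Qed.

Lemma inverse_Derive (b : nat) (F : R -> R) :
  F 0 = 0 -> has_degree F b -> (forall x, analytic_at F x) -> (forall x, 1 < Derive F x) ->
  forall X, 0 < Derive (inverse F) X < 1.
Proof.
  intros hF0 hdeg hFan hexp X.
  destruct (inverse_anorm b F hF0 hdeg hFan hexp) as [rho0 [kap [Hr [Hk HN]]]].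
  destruct (HN rho0 X ltac:(lra)) as [co Hco].
  pose proof (has_coefs_is_derive rho0 _ X 0 co (fun x => inverse F x - inverse F X) Hco
    ltac:(rewrite Rabs_R0; lra)) as H; rewrite Rplus_0_r in H.
  assert (Hex : ex_derive (inverse F) X).
  { apply (ex_derive_ext (fun x => (inverse F x - inverse F X) + inverse F X));
      [intros; ring_R|].
    apply (ex_derive_plus (fun x => inverse F x - inverse F X) (fun _ => inverse F X));
      [exact (ex_intro _ _ H)|apply ex_derive_const]. }
  assert (E : Derive (inverse F) X * Derive F (inverse F X) = 1).
  { rewrite <- (Derive_comp F (inverse F) X).
    - rewrite (Derive_ext _ (fun x => x)); [apply Derive_id|].
      intros x; apply (lift_inverse F hF0 hFan hexp).
    - eexists; apply (lift_is_derive F hFan).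
    - exact Hex. }
  specialize (hexp (inverse F X)); nra.
Qed.

Lemma exists_skew_data (b : nat) (f : circle -> circle) (F : R -> R) (g : circle -> R -> R) :
  (2 <= b)%nat -> F 0 = 0 -> has_degree F b -> (forall x, analytic_at F x) ->
  (forall x, 1 < Derive F x) ->
  (forall x y, in_U y -> analytic2_at (fun s t => g (proj s) t) x y) ->
  (forall x y, in_U y -> 0 < Rabs (Derive (g x) y) < 1) ->
  (forall p, in_U (snd p) -> in_U (snd (skew f g p))) ->
  exists D : skew_data, sd_b D = b /\ sd_g D = (fun x y => g (proj x) y) /\
    sd_f D = F /\ sd_fi D = inverse F.
Proof.
  intros hb hF0 hdeg hFan hexp hgan hgy hT.
  assert (Hper : forall x (q : Z) y, g (proj (x + IZR q)) y = g (proj x) y)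
    by (intros; now rewrite proj_Z).
  destruct (good_secant_uniform (fun x y => g (proj x) y) Hper hgan
    (fun x y Hy => hgy (proj x) y Hy)) as [eps [L [lam [r [He [HL [Hlam [Hr Hgood]]]]]]]].
  destruct (inverse_anorm b F hF0 hdeg hFan hexp) as [rho0 [kap [Hrho0 [Hk HN]]]].
  set (eta := eps / 4).
  (* The three terms answer the contraction of the inverse, [sd_rho_eta] and [sd_rho_L]; the [+ 1]
     avoids division by zero. *)
  set (rho := Rmin (Rmin rho0 eta) ((1 - kap) * eta / (L + 1))).
  assert (Hq : 0 < (1 - kap) * eta / (L + 1)).
  { apply Rdiv_lt_0_compat; [apply Rmult_lt_0_compat; unfold eta; lra|lra]. }
  assert (Hrho : 0 < rho) by (repeat apply Rmin_pos; unfold eta in *; lra).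
  assert (Hr1 : rho <= rho0) by (eapply Rle_trans; [apply Rmin_l|apply Rmin_l]).
  assert (Hr2 : rho <= eta) by (eapply Rle_trans; [apply Rmin_l|apply Rmin_r]).
  assert (Hr3 : L * rho <= (1 - kap) * eta).
  { assert (H : rho <= (1 - kap) * eta / (L + 1)) by apply Rmin_r.
    apply Rmult_le_compat_r with (r := L + 1) in H; [|lra].
    replace ((1 - kap) * eta / (L + 1) * (L + 1)) with ((1 - kap) * eta) in H by (field; lra).
    nra. }
  unshelve eexists (Build_skew_data b (fun x y => g (proj x) y) F (inverse F)
    eps L lam r kap rho eta _ Hper _ Hgood _ _ _ _ _ _ He HL Hlam Hr Hk Hrho Hr2 Hr3 (Rle_refl _)).
  - lia.
  - intros x y Hy; exact (hT (proj x, y) Hy).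
  - apply (inverse_Z b F hF0 hdeg hFan hexp).
  - apply (inverse_lift F hF0 hFan hexp).
  - intros Y HY; pose proof (lift_expand F hFan hexp 0 Y HY); rewrite hF0 in *; lra.
  - intros X HX; split; [apply (inverse_nonneg F hF0 hFan hexp); lra|].
    apply (inverse_le_1 b F hF0 hdeg hFan hexp); lra.
  - intros X E; pose proof (inverse_Derive b F hF0 hdeg hFan hexp X); lra.
  - intros X; apply HN; lra.
  - repeat split.
Qed.

Section Counterexamples.

Variables (D : skew_data) (F : R -> R) (g : circle -> R -> R) (rm km : R).
Hypothesis Hg : sd_g D = fun x y => g (proj x) y.
Hypothesis HFi : sd_fi D = inverse F.
Hypothesis Hb : (2 <= sd_b D)%nat.
Hypothesis Hrm : 0 <= rm.
Hypothesis Hrm' : forall x y, in_U y -> rm <= Rabs (Derive (sd_g D x) y).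
Hypothesis Hkm : 0 <= km <= 1.
Hypothesis Hkm' : forall X, km <= Rabs (Derive (sd_fi D) X).
Hypothesis Hnp : ~ half_periodic D.
(** The negated conclusion for [K = N = S n] and [c = / (INR n + 2)]; the shift by 2 keeps [c < 1]
    at [n = 0]. *)
Hypothesis Hfail : forall n : nat, exists (x : R) (u : list nat),
  0 <= x <= 1 /\ is_word (sd_b D) u /\ (S n <= length u)%nat /\
  forall k wa wb, (1 <= k <= S n)%nat ->
    is_word (sd_b D) wa -> length wa = S n -> is_word (sd_b D) wb -> length wb = S n ->
    exists wc wd, is_word (sd_b D) wc /\ is_word (sd_b D) wd /\
      Rabs (Derive_n (theta_diff F g (u ++ wa ++ wc) (u ++ wb ++ wd)) k x)
        < / (INR n + 2) * (rm * km) ^ length u.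

(** Since [S n < b ^ S n], words of length [S n] realise every translate that uniform separation may
    ask for. *)
Lemma separating_words (n M : nat) : (M <= n)%nat -> exists wa wb,
  (is_word (sd_b D) wa /\ length wa = S n /\ word_val (sd_b D) wa = M) /\
  (is_word (sd_b D) wb /\ length wb = S n /\ word_val (sd_b D) wb = 0%nat).
Proof.
  intros HM.
  assert (Hlt : (S n < sd_b D ^ S n)%nat) by (apply Nat.pow_gt_lin_r; lia).
  destruct (word_val_surj (sd_b D) (S n) M) as [wa Ha]; [lia|].
  destruct (word_val_surj (sd_b D) (S n) 0) as [wb Hw]; [lia|].
  now exists wa, wb.
Qed.

Lemma counterexamples_flat_family : exists del, 0 < del /\ flat_family D del.
Proof.
  pose proof (sd_eps_pos D) as Heps; pose proof (sd_lam_bd D) as Hlam.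
  (* Separation below [eps / 16] for the limit curve, plus an approximation error below [eps / 16],
     stays within the [eps / 8] of [flat_family]; from below, half of [d0] survives. *)
  destruct (uniform_separation (Theta D) (sd_eps D / 16)) as [n1 Hn1].
  { apply (curve_continuity D), Theta_curve. }
  { intros x Hx; apply Theta_separated_close; auto; lra. }
  pose proof (inv_INR_pos n1) as Hd0; set (d0 := / (INR n1 + 1)) in *.
  exists (d0 / 2); split; [lra|]; intros n.
  destruct (pow_lim_zero (sd_lam D) 4 ltac:(lra) (Rmin (d0 / 2) (sd_eps D / 16)))
    as [n2 Hn2]; [apply Rmin_pos; lra|].
  (* Chosen so that [/ (INR m + 2)] absorbs both the required [/ (INR n + 1)] and the separation
     [d0 / 2], as failure is measured against [rm ^ N] and flatness against the actual
     difference. *)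
  destruct (INR_unbounded ((INR n + 1) / (d0 / 2))) as [n3 Hn3].
  set (m := (n + n1 + n2 + n3)%nat).
  destruct (Hfail m) as [x [u [Hx [Hu [Hlen Hf]]]]].
  pose proof (back_word D u x Hu Hx) as Hp.
  set (N := length u) in *; set (X := x + INR (word_val (sd_b D) u)) in *.
  set (p := back D N X) in *.
  destruct (Hn1 p Hp) as [M [HM HMs]].
  destruct (separating_words m M ltac:(lia)) as [wa [wb [[A1 [A2 A3]] [B1 [B2 B3]]]]].
  specialize (Hn2 (S m) ltac:(lia)).
  pose proof (Rmin_l (d0 / 2) (sd_eps D / 16)) as M1.
  pose proof (Rmin_r (d0 / 2) (sd_eps D / 16)) as M2.
  assert (Hsep : forall wc wd, d0 / 2 <=
    Rabs (tail_curve D (wa ++ wc) p - tail_curve D (wb ++ wd) p) <= sd_eps D / 8).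
  { intros wc wd.
    pose proof (tail_curve_Theta D wa wc p) as T1; rewrite A2, A3 in T1.
    pose proof (tail_curve_Theta D wb wd p) as T2; rewrite B2, B3 in T2.
    simpl (INR 0) in T2; rewrite Rplus_0_r in T2.
    set (u1 := tail_curve D (wa ++ wc) p) in *; set (u2 := tail_curve D (wb ++ wd) p) in *.
    set (v1 := Theta D (p + INR M)) in *; set (v2 := Theta D p) in *.
    assert (E : Rabs ((u1 - u2) - (v1 - v2)) <= 4 * sd_lam D ^ S m).
    { replace ((u1 - u2) - (v1 - v2)) with ((u1 - v1) - (u2 - v2)) by ring.
      eapply Rle_trans; [apply Rabs_triang|]; rewrite Rabs_Ropp; lra. }
    pose proof (Rabs_triang_inv2 (u1 - u2) (v1 - v2)) as T; apply Rabs_le_between in T.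
    revert E T; generalize (Rabs (u1 - u2 - (v1 - v2))); intros z E T; lra. }
  exists N, X, (tail_curve D wa), (tail_curve D wb).
  split; [lia|split; [apply tail_curve_curve|split; [apply tail_curve_curve|split]]].
  { pose proof (Hsep nil nil) as H; rewrite !app_nil_r in H; exact H. }
  intros k Hk.
  destruct (Hf k wa wb ltac:(lia) A1 A2 B1 B2) as [wc [wd [C1 [C2 C3]]]].
  exists (tail_curve D (wa ++ wc)), (tail_curve D (wb ++ wd)).
  split; [apply tail_curve_curve|split; [apply tail_curve_curve|split; [apply Hsep|split]]].
  - assert (Hpow : sd_lam D ^ S m <= sd_lam D ^ n).
    { replace (S m) with (n + (S m - n))%nat by lia; rewrite pow_add.
      pose proof (pow_le_1 (sd_lam D) n ltac:(lra)).
      pose proof (pow_le_1 (sd_lam D) (S m - n) ltac:(lra)); nra. }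
    intros Y; pose proof (tail_curve_close D wa wc Y) as T1; rewrite A2 in T1.
    pose proof (tail_curve_close D wb wd Y) as T2; rewrite B2 in T2; split; lra.
  - rewrite (Derive_n_theta_diff D F g Hg HFi) in C3; fold N X in C3.
    left; eapply Rlt_le_trans; [exact C3|].
    set (a' := tail_curve D (wa ++ wc)) in *; set (c' := tail_curve D (wb ++ wd)) in *.
    pose proof (gtr_lower D N a' c' X rm (proj1 (tail_curve_curve D (wa ++ wc)))
      (proj1 (tail_curve_curve D (wb ++ wd))) Hrm Hrm') as Hlow; fold p in Hlow.
    pose proof (Hsep wc wd) as Hs; fold a' c' in Hs.
    assert (Hrp : 0 <= rm ^ N) by now apply pow_le.
    assert (Hkp : (rm * km) ^ N <= rm ^ N).
    { rewrite Rpow_mult_distr; pose proof (pow_le_1 km N Hkm); nra. }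
    assert (Hm : 0 < INR m + 2) by (pose proof (pos_INR m); lra).
    assert (Hq : / (INR m + 2) <= / (INR n + 1) * (d0 / 2)).
    { assert (Hn0 : 0 < INR n + 1) by (pose proof (pos_INR n); lra).
      replace (/ (INR n + 1) * (d0 / 2)) with (/ ((INR n + 1) / (d0 / 2))) by (field; lra).
      apply Rinv_le_contravar; [apply Rdiv_lt_0_compat; lra|].
      assert (INR n3 <= INR m) by (apply le_INR; lia). lra. }
    apply Rle_trans with (/ (INR m + 2) * rm ^ N).
    { apply Rmult_le_compat_l; [left; now apply Rinv_0_lt_compat|exact Hkp]. }
    apply Rle_trans with (/ (INR n + 1) * (d0 / 2) * rm ^ N).
    { now apply Rmult_le_compat_r. }
    rewrite Rmult_assoc; apply Rmult_le_compat_l; [left; apply inv_INR_pos|].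
    eapply Rle_trans; [|exact Hlow]; rewrite Rmult_comm; apply Rmult_le_compat_l; lra.
Qed.

Lemma counterexamples_absurd : False.
Proof.
  destruct counterexamples_flat_family as [del [Hdel Hff]].
  destruct (fibre_derivative_constant D Hnp
    (fun Y Y' => flat_family_derivative_const D del Y Y' Hdel Hff)) as [k [Hk0 Hk]].
  pose proof (sd_eta_eps D) as He1; pose proof (sd_rho_pos D) as He2.
  (* The upper bound demanded here is met through [curve_derive_bound]; the lower bound [d0] is what
     matters. *)
  destruct (uniform_separation (Derive (Theta D)) (2 * (sd_eta D / sd_rho D) + 1)) as [n1 Hn1].
  { apply (curve_derive_continuity D), Theta_curve. }
  { intros x Hx; destruct (Theta_derive_separated D k x Hnp Hk0 Hk Hx) as [M HM].
    exists M; split; [apply Rabs_pos_lt; lra|].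
    pose proof (curve_derive_bound D (Theta D) (x + INR M) (Theta_curve D)).
    pose proof (curve_derive_bound D (Theta D) x (Theta_curve D)).
    pose proof (Rabs_triang (Derive (Theta D) (x + INR M)) (- Derive (Theta D) x)) as T.
    rewrite Rabs_Ropp in T; unfold Rminus; lra. }
  pose proof (inv_INR_pos n1) as Hd0; set (d0 := / (INR n1 + 1)) in *.
  destruct (gtr_derive_approx D (d0 / 4) ltac:(lra)) as [m0 Hm0].
  destruct (exists_inv_le (d0 / 4) ltac:(lra)) as [n2 Hn2].
  set (m := (n1 + m0 + n2)%nat).
  destruct (Hfail m) as [x [u [Hx [Hu [Hlen Hf]]]]].
  pose proof (back_word D u x Hu Hx) as Hp.
  set (N := length u) in *; set (X := x + INR (word_val (sd_b D) u)) in *.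
  set (p := back D N X) in *.
  destruct (Hn1 p Hp) as [M [HM HMs]].
  destruct (separating_words m M ltac:(lia)) as [wa [wb [[A1 [A2 A3]] [B1 [B2 B3]]]]].
  destruct (Hf 1%nat wa wb ltac:(lia) A1 A2 B1 B2) as [wc [wd [C1 [C2 C3]]]].
  rewrite (Derive_n_theta_diff D F g Hg HFi) in C3; fold N X in C3; simpl Derive_n in C3.
  pose proof (gtr_affine_derive D k km N (tail_curve D (wa ++ wc)) (tail_curve D (wb ++ wd)) X
    Hk (tail_curve_curve D _) (tail_curve_curve D _) (proj1 Hkm) Hkm') as G; fold p in G.
  rewrite !Derive_tail_curve, A2, A3, B2, B3 in G.
  simpl (INR 0) in G; rewrite Rplus_0_r in G.
  pose proof (Hm0 (S m) (tail_curve D wc) (p + INR M) ltac:(lia) (tail_curve_curve D wc)) as T1.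
  pose proof (Hm0 (S m) (tail_curve D wd) p ltac:(lia) (tail_curve_curve D wd)) as T2.
  set (u1 := Derive (gtr D (S m) (tail_curve D wc)) (p + INR M)) in *.
  set (u2 := Derive (gtr D (S m) (tail_curve D wd)) p) in *.
  set (v1 := Derive (Theta D) (p + INR M)) in *; set (v2 := Derive (Theta D) p) in *.
  assert (E : d0 / 2 <= Rabs (u1 - u2)).
  { assert (E : Rabs ((v1 - v2) - (u1 - u2)) <= d0 / 2).
    { replace ((v1 - v2) - (u1 - u2)) with (- ((u1 - v1) - (u2 - v2))) by ring.
      rewrite Rabs_Ropp; eapply Rle_trans; [apply Rabs_triang|]; rewrite Rabs_Ropp; lra. }
    pose proof (Rabs_triang_inv (v1 - v2) (u1 - u2)); lra. }
  assert (Hrk : rm <= Rabs k) by (rewrite <- (Hk 0 0 in_U_0); apply Hrm', in_U_0).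
  assert (Hpw : (rm * km) ^ N <= (Rabs k * km) ^ N).
  { apply pow_incr; split; [apply Rmult_le_pos; lra|apply Rmult_le_compat_r; lra]. }
  assert (Hpw0 : 0 <= (rm * km) ^ N) by (apply pow_le, Rmult_le_pos; lra).
  assert (Hm2 : / (INR m + 2) <= d0 / 4).
  { pose proof (inv_INR_decr n2 m ltac:(lia)).
    assert (/ (INR m + 2) <= / (INR m + 1)).
    { apply Rinv_le_contravar; pose proof (pos_INR m); lra. }
    lra. }
  set (P := (rm * km) ^ N) in *.
  assert (F1 : P * (d0 / 2) <= (Rabs k * km) ^ N * Rabs (u1 - u2)).
  { apply Rmult_le_compat; lra. }
  assert (F2 : / (INR m + 2) * P <= d0 / 4 * P) by now apply Rmult_le_compat_r.
  (* The inequality is strict because the failure is, so the contradiction also covers [P = 0]. *)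
  assert (F3 : P * (d0 / 2) < d0 / 4 * P) by lra.
  nra.
Qed.

End Counterexamples.

Theorem proposition9p2
  (b : nat) (f : circle -> circle) (F : R -> R) (g : circle -> R -> R)
  (hb : (2 <= b)%nat)
  (hf0 : f (proj 0) = proj 0)
  (hlift : is_lift f F)
  (hF0 : F 0 = 0)
  (hdeg : has_degree F b)
  (hFan : forall x, analytic_at F x)
  (hexp : forall x, 1 < Rabs (Derive F x))
  (horient : forall x, 0 < Derive F x)
  (hgan : forall x y, in_U y -> analytic2_at (fun s t => g (proj s) t) x y)
  (hgy : forall x y, in_U y -> 0 < Rabs (Derive (g x) y) < 1)
  (hT : forall p, in_U (snd p) -> in_U (snd (skew f g p)))
  (hS : ~ single_graph (attractor f g)) :
  exists (K N : nat) (c : R),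
    (0 < K)%nat /\ (0 < N)%nat /\ 0 < c < 1 /\
    forall (x : R) (u : list nat),
      0 <= x <= 1 -> is_word b u -> (N <= length u)%nat ->
      exists (k : nat) (wa wb : list nat),
        (1 <= k <= K)%nat /\
        (is_word b wa /\ length wa = N) /\
        (is_word b wb /\ length wb = N) /\
        forall wc wd : list nat, is_word b wc -> is_word b wd ->
          Rabs (Derive_n (theta_diff F g (u ++ wa ++ wc) (u ++ wb ++ wd)) k x)
            >= c * (r_min g * kappa_min b F) ^ length u.
Proof.
  assert (hexp' : forall x, 1 < Derive F x).
  { intros x; specialize (hexp x); rewrite Rabs_pos_eq in hexp; [exact hexp|].
    specialize (horient x); lra. }
  destruct (exists_skew_data b f F g hb hF0 hdeg hFan hexp' hgan hgy hT)
    as [D [Eb [Eg [EF EFi]]]].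
  assert (Hnp : ~ half_periodic D).
  { intros Hper; apply hS, (half_periodic_single_graph D f F g Eg EF); auto.
    intros X; rewrite EFi; apply (lift_inverse F hF0 hFan hexp'). }
  destruct (r_min_spec g) as [Hr0 Hr1].
  destruct (kappa_min_spec b F ltac:(lia) (inverse_Z b F hF0 hdeg hFan hexp')) as [Hk0 Hk1].
  apply NNPP; intros Hno.
  apply (counterexamples_absurd D F g (r_min g) (kappa_min b F) Eg EFi); auto.
  - now rewrite Eb.
  - intros x y Hy; rewrite Eg; now apply Hr1.
  - split; [exact Hk0|].
    pose proof (inverse_Derive b F hF0 hdeg hFan hexp' 0) as H; specialize (Hk1 0).
    rewrite Rabs_pos_eq in Hk1; lra.
  - intros X; rewrite EFi; apply Hk1.
  - rewrite Eb; intros n; apply NNPP; intros Hn; apply Hno.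
    pose proof (pos_INR n) as Hn0.
    exists (S n), (S n), (/ (INR n + 2)); split; [lia|split; [lia|split]].
    { split; [apply Rinv_0_lt_compat; lra|].
      rewrite <- Rinv_1; apply Rinv_lt_contravar; lra. }
    intros x u Hx Hu Hl; apply NNPP; intros H1; apply Hn; exists x, u.
    split; [exact Hx|split; [exact Hu|split; [exact Hl|]]].
    intros k wa wb Hk Ha1 Ha2 Hb1 Hb2; apply NNPP; intros H2; apply H1.
    exists k, wa, wb; split; [exact Hk|split; [now split|split; [now split|]]].
    intros wc wd Hc Hd; apply Rle_ge, Rnot_lt_le; intros Hlt; apply H2; now exists wc, wd.
Qed.
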